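(* Let $V:\mathbb{R}^n\to\mathbb{R}$ be a smooth function which is bounded above, and for $\varepsilon>0$ let $L_\varepsilon(x,v)=\frac12|v|^2-\varepsilon V(x)$ on $T\mathbb{R}^n$, with cost $$c_\varepsilon(x,y)=\inf\int_0^1 L_\varepsilon(\gamma(t),\dot\gamma(t))\,dt,$$ the infimum being over all smooth curves $\gamma:[0,1]\to\mathbb{R}^n$ with $\gamma(0)=x$, $\gamma(1)=y$. Assume there are a constant $C>0$ and a nonempty bounded open subset $\mathcal U$ of $T\mathbb{R}^n$ such that $$\int_0^1\int_0^\tau\Big\langle u,(1-t)\,\partial_s^2\,\mathrm{Hess}\,V_{x+t(v+sw)}\,u\Big\rangle\Big|_{s=0}\,dt\,d\tau\ \ge\ C$$ for all $(x,v)\in\mathcal U$ and all unit vectors $u,w\in T_x\mathbb{R}^n$ which are orthogonal to each other. Then there is a nonempty open set $\mathcal O=\mathcal M\times\mathcal N\subseteq\mathbb{R}^n\times\mathbb{R}^n$ such that, for all small enough $\varepsilon>0$, the cost $c_\varepsilon$ satisfies the strong Ma-Trudinger-Wang condition (A3s) on $\mathcal O$.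
   Context: $\mathrm{Hess}\,V_p$ is the Hessian matrix of $V$ at the point $p$; tangent and cotangent spaces of $\mathbb{R}^n$ are identified by the Euclidean inner product. Let $\mathcal O=\mathcal M\times\mathcal N\subseteq\mathbb{R}^n\times\mathbb{R}^n$ be open and let $c$ be a cost for which the following hold on $\mathcal O$: (A0) $c$ is $C^4$ on $\mathcal O$; (A1) for each $x\in\mathcal M$ the map $y\mapsto d_xc(x,y)$ is injective on $\mathcal N$; (A2) for each $(x,y)\in\mathcal O$ the linear map $v\mapsto d_xd_yc(x,y)(v)$ from $T_y\mathbb{R}^n$ to $T_x^*\mathbb{R}^n$ is injective. (The condition (A3s) on $\mathcal O$ below is formulated for costs satisfying (A0)–(A2) on $\mathcal O$.) For $x\in\mathcal M$ let $\mathcal K_x=\{-d_xc(x,y):y\in\mathcal N\}$, and for $\alpha\in\mathcal K_x$ let $\exp^c(x,\alpha)$ be the unique $y\in\mathcal N$ with $d_xc(x,y)=-\alpha$. The cross-curvature is $$\mathcal C_x(u,\alpha,\alpha_1)=-\frac32\,\partial_s^2\partial_t^2\,c\big(\gamma(t),\exp^c(x,\alpha+s\alpha_1)\big)\Big|_{t=s=0},\quad u\in T_x\mathbb{R}^n,\ \alpha\in\mathcal K_x,\ \alpha_1\in T_x^*\mathbb{R}^n,$$ where $\gamma$ is any curve with $\gamma(0)=x$, $\dot\gamma(0)=u$. The Ma-Trudinger-Wang curvature $MTW$ is the restriction of $\mathcal C$ to the set of $(x,u,\alpha,\alpha_1)$ with $x\in\mathcal M$ and $\alpha_1(u)=0$.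 The cost $c$ satisfies the strong MTW condition (A3s) on $\mathcal O$ if $MTW\ge 0$ and $MTW_x(u,\alpha,\alpha_1)=0$ only if $u=0$ or $\alpha_1=0$. *)

(* Defs.v *)
From mathcomp Require Import all_boot all_order all_algebra.
From mathcomp Require Import all_classical all_reals all_analysis.

Set Implicit Arguments.
Unset Strict Implicit.
Unset Printing Implicit Defensive.

Import Order.TTheory GRing.Theory Num.Theory.
Import numFieldNormedType.Exports.

Local Open Scope classical_set_scope.
Local Open Scope ring_scope.

(* R^n is ['rV[R]_n]. The norm [`|_|] that the library puts on it is the sup
   norm; it is used only for the topology and for boundedness. Euclidean
   lengths and orthogonality always go through [dot]. *)
Definition dot (R : realType) (n : nat) (u v : 'rV[R]_n) : R :=
  \sum_(i < n) u 0 i * v 0 i.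

Definition enorm (R : realType) (n : nat) (u : 'rV[R]_n) : R :=
  Num.sqrt (dot u u).

Section Smoothness.
Variables (R : realType) (V W : normedModType R).

(* [f] is C^k on the set [A], which is meant to be open. In finite dimension
   the Frechet derivative is C^k iff all directional derivatives are. *)
Fixpoint Ck (k : nat) (A : set V) (f : V -> W) : Prop :=
  match k with
  | 0 => forall x, A x -> {for x, continuous f}
  | k'.+1 => (forall x, A x -> differentiable f x) /\
             (forall v : V, Ck k' A (fun x => 'D_v f x))
  end.

Definition smooth (f : V -> W) : Prop := forall k, Ck k setT f.

End Smoothness.

(* The gradient, i.e. the differential of [f] at [x] as an element of R^n under
   the Euclidean identification of tangent and cotangent spaces. *)
Definition grad (R : realType) (n : nat) (f : 'rV[R]_n -> R) (x : 'rV[R]_n)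
    : 'rV[R]_n :=
  \row_i 'D_(delta_mx 0 i) f x.

Definition Hess (R : realType) (n : nat) (V : 'rV[R]_n -> R) (p : 'rV[R]_n)
    : 'M[R]_n :=
  \matrix_(i, j) 'D_(delta_mx 0 i) (fun q => 'D_(delta_mx 0 j) V q) p.

Definition lagrangian (R : realType) (n : nat) (V : 'rV[R]_n -> R) (e : R)
    (x v : 'rV[R]_n) : R :=
  2^-1 * enorm v ^+ 2 - e * V x.

(* Smooth curves on [0, 1] are taken as (restrictions of) smooth curves defined
   on all of R. When [V] is bounded above and [e > 0] the set of actions is
   nonempty and bounded below, so the real-valued [inf] is the true infimum. *)
Definition cost (R : realType) (n : nat) (V : 'rV[R]_n -> R) (e : R)
    (x y : 'rV[R]_n) : R :=
  inf [set a : R | exists g : R -> 'rV[R]_n,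
    [/\ smooth g, g 0 = x, g 1 = y &
        a = \int[lebesgue_measure]_(t in `[0%R, 1%R])
              lagrangian V e (g t) (derive1 g t)]].

Section MTW.
Variables (R : realType) (n : nat).
Local Notation E := 'rV[R]_n.
Variables (c : E -> E -> R) (M N : set E).

Definition dx (x y : E) : E := grad (fun x' => c x' y) x.

Definition dxdy (x y v : E) : E :=
  grad (fun x' => 'D_v (fun y' => c x' y') y) x.

Definition A0 : Prop := Ck 4 (M `*` N) (fun z : E * E => c z.1 z.2).

Definition A1 : Prop := forall x, M x -> set_inj N (dx x).

Definition A2 : Prop := forall x y, M x -> N y -> injective (dxdy x y).

Definition Kset (x : E) : set E := [set - dx x y | y in N].

(* Only meaningful for [alpha] in [Kset x], where under A1 there is exactly one
   such [y]; arbitrary elsewhere. *)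
Definition cexp (x alpha : E) : E :=
  get [set y : E | N y /\ dx x y = - alpha].

(* The base curve [g] is a parameter: the cross-curvature
   C_x(u, alpha, alpha1) is computed along any [g] with g(0) = x and
   g'(0) = u. *)
Definition cross_curvature (g : R -> E) (x alpha alpha1 : E) : R :=
  - (3 / 2) *
  derive1n 2 (fun s : R =>
    derive1n 2 (fun t : R => c (g t) (cexp x (alpha + s *: alpha1))) 0) 0.

Definition MTW_strong : Prop :=
  forall (x u alpha alpha1 : E) (g : R -> E),
    M x -> Kset x alpha -> dot alpha1 u = 0 ->
    smooth g -> g 0 = x -> derive1 g 0 = u ->
    0 <= cross_curvature g x alpha alpha1 /\
    (cross_curvature g x alpha alpha1 = 0 -> u = 0 \/ alpha1 = 0).

(* The curvature condition only makes sense for costs satisfying A0-A2, which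
   are therefore part of A3s. *)
Definition A3s : Prop := [/\ A0, A1, A2 & MTW_strong].

End MTW.

(* Main.v *)
(* Extremals of the action solve z'' = - eps grad V(z) with z 0 = x, z 1 = y. On
   C([0, 1]) this is a fixed point equation z = G(x, y, eps, z) whose right-hand
   side is constant in z at eps = 0; hence it has, for (x, y, eps) near
   (x0, y0, 0), a solution depending smoothly on all three variables. For small
   eps this solution is minimizing, because the quadratic term |h'|^2 / 2 of the
   action of z + h dominates the eps-term, V having a quadratic upper
   expansion that is uniform along z (this uses that V is bounded above).
   Comparing with the action of neighbouring solutions gives the gradient of the
   cost:

     - d_x c = (y - x) + eps r0(x, y, eps),  d_y c = (y - x) + eps r1(x, y, eps)

   with r0, r1 smooth up to eps = 0. So c is a perturbation of |x - y|^2 / 2,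
   conditions A0-A2 are immediate, and the cross-curvature is eps times a
   function that is continuous up to eps = 0, where it is a positive multiple
   of the integral assumed to be bounded below. By compactness of the set of
   orthonormal pairs (u, w), the sign persists for (x, y, eps) near (x0, y0, 0),
   with y0 = x0 + v0 and (x0, v0) in U, and by homogeneity it extends to all
   orthogonal u, w. *)
From HB Require Import structures.
Require Import Defs.
From mathcomp Require Import all_boot all_order all_algebra.
From mathcomp Require Import all_classical all_reals all_analysis.
From mathcomp Require Import ring lra.

Set Implicit Arguments.
Unset Strict Implicit.
Unset Printing Implicit Defensive.

Import Order.TTheory GRing.Theory Num.Theory.
Import numFieldNormedType.Exports.

Local Open Scope classical_set_scope.
Local Open Scope ring_scope.

(** * Continuous differentiability through tangent maps *)

(** The cost is an infimum over smooth curves on the line, whereas the fixed point lives in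
    C([0, 1]). Since the calibration keeps track of both end points, it gives c(z') >= c(z) + linear
    - quadratic around each z. Two such inequalities with base points exchanged, and continuity of
    the linear part, make c differentiable.

    Tangent maps are used for smoothness because iterated directional derivatives fix the direction,
    while in the chain rule it moves with the point.

    The factor eps of the curvature is exact. For y the c-exponential of a + s w at x, the second
    t-derivative of c(g(t), y) is |u|^2 - eps <D_x r0 u, u> - <a + s w, g''(0)>, since the momentum
    at y is a + s w. Only the middle term survives the second s-derivative, which also removes the
    dependence on g beyond u. *)

Lemma differentiable_eps (R : realType) (V W : normedModType R) (f : V -> W)
    (x : V) (L : V -> W) :
  linear L -> continuous L ->
  (forall e : R, 0 < e ->
     \forall h \near (0 : V), `|f (h + x) - f x - L h| <= e * `|h|) ->
  differentiable f x /\ forall v, 'D_v f x = L v.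
Proof.
move=> Llin Lc He.
pose LM := GRing.isLinear.Build _ _ _ _ L Llin.
pose LL : {linear V -> W} := HB.pack L LM.
have Lc' : continuous LL by [].
have E : f \o shift x = cst (f x) + LL +o_ 0 id.
  apply/eqaddoP => _/posnumP[e].
  near=> h; rewrite !fctE/= opprD addrA; near: h; exact: He.
have dL : 'd f x = LL :> (V -> W) by exact: (@diff_unique _ _ _ f LL x Lc' E).
have df : differentiable f x.
  by apply/diff_locallyP; rewrite dL; split.
by split=> // v; rewrite deriveE// dL.
Unshelve. all: by end_near. Qed.

Lemma eps_differentiable (R : realType) (V W : normedModType R) (f : V -> W)
    (x : V) : differentiable f x ->
  forall e : R, 0 < e ->
     \forall h \near (0 : V), `|f (h + x) - f x - 'D_h f x| <= e * `|h|.
Proof.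
move=> df e e0; have /eqaddoP E := diff_locally df.
near=> h; rewrite deriveE//; have : `|(f \o shift x - (cst (f x) + 'd f x)) h| <= e * `|h|.
  by near: h; exact: E.
by rewrite !fctE/= opprD addrA.
Unshelve. all: by end_near. Qed.

Lemma derive_linear (R : realType) (V W : normedModType R) (f : V -> W)
    (x : V) : differentiable f x -> linear (fun v => 'D_v f x).
Proof. by move=> df a u v; rewrite !deriveE// linearP. Qed.

Lemma derive_continuous (R : realType) (V W : normedModType R) (f : V -> W)
    (x : V) : differentiable f x -> continuous (fun v => 'D_v f x).
Proof.
move=> df; have -> : (fun v => 'D_v f x) = 'd f x.
  by apply/funext => v; rewrite deriveE.
exact: diff_continuous.
Qed.

Lemma differentiable_near_eq (R : realType) (V W : normedModType R)
    (f g : V -> W) (x : V) : {near x, f =1 g} ->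
  differentiable f x -> differentiable g x.
Proof.
move=> fg df.
apply: (proj1 (@differentiable_eps _ _ _ g x (fun v => 'D_v f x) _ _ _)).
- exact: derive_linear.
- exact: derive_continuous.
move=> e e0; have fgh : \forall h \near (0 : V), f (h + x) = g (h + x).
  have := fg; rewrite (near_shift 0)/=; apply: filterS => h.
  by rewrite subr0.
near=> h; rewrite -(nbhs_singleton fg).
have <- : f (h + x) = g (h + x) by near: h.
by near: h; exact: eps_differentiable.
Unshelve. all: by end_near. Qed.

Lemma differentiable_linear (R : realType) (V W : normedModType R)
    (f : V -> W) (x : V) : linear f -> continuous f ->
  differentiable f x /\ forall v, 'D_v f x = f v.
Proof.
move=> fl fc; pose LM := GRing.isLinear.Build _ _ _ _ f fl.
pose LL : {linear V -> W} := HB.pack f LM.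
have fc' : continuous LL by [].
have df : differentiable LL x by exact: linear_differentiable.
by split=> // v; rewrite -[f]/(LL : V -> W) deriveE// (diff_lin _ fc').
Qed.

Lemma derive_comp (R : realType) (U V W : normedModType R)
    (f : U -> V) (g : V -> W) (x v : U) :
  differentiable f x -> differentiable g (f x) ->
  'D_v (g \o f) x = 'D_('D_v f x) g (f x).
Proof.
move=> df dg; rewrite !deriveE//; last exact: differentiable_comp.
by rewrite diff_comp.
Qed.

Lemma derive_pair (R : realType) (U V W : normedModType R)
    (f : U -> V) (g : U -> W) (x v : U) :
  differentiable f x -> differentiable g x ->
  'D_v (fun y => (f y, g y)) x = ('D_v f x, 'D_v g x).
Proof.
move=> df dg; rewrite !deriveE//; last exact: differentiable_pair.
by rewrite diff_pair.
Qed.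

(* C^k in terms of the tangent map (x, v) |-> Df(x) v. Unlike [Ck] this is
   stable under composition in arbitrary normed spaces. *)
Fixpoint TC (R : realType) (k : nat) :
    forall V W : normedModType R, set V -> (V -> W) -> Prop :=
  match k with
  | 0 => fun V W A f => forall x, A x -> {for x, continuous f}
  | k'.+1 => fun V W A f => (forall x, A x -> differentiable f x) /\
      @TC R k' (V * V)%type W (A `*` setT) (fun z => 'D_(z.2) f z.1)
  end.
Arguments TC {R} k {V W} A f.

Lemma open_prod (S T : topologicalType) (A : set S) (B : set T) :
  open A -> open B -> open (A `*` B).
Proof.
move=> Ao Bo; rewrite openE => -[x y] [/= Ax By].
by exists (A, B) => //=; split; exact: open_nbhs_nbhs.
Qed.

Section TC_basic.
Context {R : realType}.
Implicit Types (U V W : normedModType R) (k : nat).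

Lemma TC_sub k V W (A B : set V) (f : V -> W) :
  A `<=` B -> TC k B f -> TC k A f.
Proof.
elim: k V W A B f => [|k IH] V W A B f AB /=; first by move=> H x /AB /H.
move=> [df Tf]; split; first by move=> x /AB /df.
by apply: IH Tf => z [/AB ? _].
Qed.

Lemma TC_mono k V W (A : set V) (f : V -> W) : TC k.+1 A f -> TC k A f.
Proof.
elim: k V W A f => [|k IH] V W A f.
  by move=> [df _] x /df; exact: differentiable_continuous.
by move=> [df Tf]; split => //; exact: IH.
Qed.

Lemma TC_cont k V W (A : set V) (f : V -> W) : TC k A f ->
  forall x, A x -> {for x, continuous f}.
Proof.
elim: k V W A f => [//|k IH] V W A f [df _] x /df.
exact: differentiable_continuous.
Qed.

Lemma TC_ext k V W (A : set V) (f g : V -> W) : open A ->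
  (forall x, A x -> f x = g x) -> TC k A f -> TC k A g.
Proof.
elim: k V W A f g => [|k IH] V W A f g Ao fg.
  move=> cf x Ax.
  have nfg : \forall y \near x, f y = g y.
    by near=> y; apply: fg; near: y; exact: open_nbhs_nbhs.
  rewrite /prop_for /continuous_at -(fg _ Ax).
  by apply: cvg_trans (cf x Ax); exact: near_eq_cvg.
move=> [df Tf]; have nfg x : A x -> {near x, f =1 g}.
  by move=> Ax; near=> y; apply: fg; near: y; exact: open_nbhs_nbhs.
split; first by move=> x Ax; apply: differentiable_near_eq (df x Ax); exact: nfg.
apply: IH Tf; first by apply: open_prod => //; exact: openT.
move=> [x v] [/= Ax _]; exact/near_eq_derive/nfg.
Unshelve. all: by end_near. Qed.

Lemma TC_linear k V W (A : set V) (f : V -> W) :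
  linear f -> continuous f -> TC k A f.
Proof.
elim: k V W A f => [|k IH] V W A f fl fc; first by move=> x _; exact: fc.
split; first by move=> x _; have [] := @differentiable_linear _ _ _ f x fl fc.
have -> : (fun z : V * V => 'D_z.2 f z.1) = f \o snd.
  apply/funext => z /=.
  by have [_ ->] := @differentiable_linear _ _ _ f z.1 fl fc.
apply: IH; first by move=> a u v /=; rewrite fl.
by move=> z; apply: continuous_comp; [exact: cvg_snd|exact: fc].
Qed.

Lemma TC_cst k V W (A : set V) (w : W) : TC k A (fun _ : V => w).
Proof.
elim: k V W A w => [|k IH] V W A w; first by move=> x _; exact: cvg_cst.
split; first by move=> x _; exact: differentiable_cst.
have -> : (fun z : V * V => 'D_z.2 (fun _ : V => w) z.1) = fun _ => 0.
  by apply/funext => z /=; rewrite derive_cst.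
exact: IH.
Qed.

Lemma TC_pair k U V W (A : set U) (f : U -> V) (g : U -> W) : open A ->
  TC k A f -> TC k A g -> TC k A (fun x => (f x, g x)).
Proof.
elim: k U V W A f g => [|k IH] U V W A f g Ao.
  by move=> cf cg x Ax; apply: cvg_pair; [exact: cf|exact: cg].
move=> [df Tf] [dg Tg]; split.
  by move=> x Ax; apply: differentiable_pair; [exact: df|exact: dg].
have AoT : open (A `*` [set: U]) by apply: open_prod => //; exact: openT.
apply: TC_ext (IH _ _ _ _ _ _ AoT Tf Tg) => //.
by move=> [x v] [/= Ax _]; rewrite derive_pair//; [exact: df|exact: dg].
Qed.

(** Tangent maps compose by the chain rule: that of the composite is the tangent map of [g] after
    [F], which takes values in B x V. The induction hypothesis is applied to these two. *)
Lemma TC_comp k U V W (A : set U) (B : set V) (f : U -> V) (g : V -> W) :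
  open A -> (forall x, A x -> B (f x)) ->
  TC k A f -> TC k B g -> TC k A (fun x => g (f x)).
Proof.
elim: k U V W A B f g => [|k IH] U V W A B f g Ao AB.
  by move=> cf cg x Ax; apply: continuous_comp; [exact: cf|exact/cg/AB].
move=> Cf Cg; have [df Tf] := Cf; have [dg Tg] := Cg; split.
  by move=> x Ax; apply: differentiable_comp; [exact: df|exact/dg/AB].
have AoT : open (A `*` [set: U]) by apply: open_prod => //; exact: openT.
have C1 : TC k (A `*` [set: U]) (fun z : U * U => f z.1).
  apply: (IH _ _ _ _ A fst f AoT); first by move=> z [].
    by apply: TC_linear => // z; exact: cvg_fst.
  exact: TC_mono.
pose F (z : U * U) := (f z.1, 'D_(z.2) f z.1).
have C2 : TC k (A `*` [set: U]) F by exact: TC_pair.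
apply: (@TC_ext _ _ _ _ (fun z => 'D_((F z).2) g (F z).1)) => //.
  move=> [x v] [/= Ax _].
  by rewrite -[LHS]derive_comp//; [exact: df|exact/dg/AB].
apply: (IH _ _ _ _ (B `*` [set: V]) F (fun z : V * V => 'D_(z.2) g z.1) AoT) => //.
by move=> [x v] [/= Ax _]; split => //; exact: AB.
Qed.

Lemma TC_clin k U V W (A : set U) (f : U -> V) (L : V -> W) :
  open A -> linear L -> continuous L -> TC k A f -> TC k A (fun x => L (f x)).
Proof.
move=> Ao Ll Lc Cf; apply: (@TC_comp _ _ _ _ A setT f L) => //.
exact: TC_linear.
Qed.

Lemma TC_fst k U V W (A : set (U * V)) (B : set U) (f : U -> W) : open A ->
  (forall z, A z -> B z.1) -> TC k B f -> TC k A (fun z => f z.1).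
Proof.
move=> Ao AB; apply: (@TC_comp _ _ _ _ A B fst f Ao AB).
by apply: TC_linear => // z; exact: cvg_fst.
Qed.

Lemma TC_snd k U V W (A : set (U * V)) (B : set V) (f : V -> W) : open A ->
  (forall z, A z -> B z.2) -> TC k B f -> TC k A (fun z => f z.2).
Proof.
move=> Ao AB; apply: (@TC_comp _ _ _ _ A B snd f Ao AB).
by apply: TC_linear => // z; exact: cvg_snd.
Qed.

Lemma TC_id k U (A : set U) : TC k A (fun x => x).
Proof. by apply: TC_linear => // x; exact: cvg_id. Qed.

Lemma TC_add k U V (A : set U) (f g : U -> V) : open A ->
  TC k A f -> TC k A g -> TC k A (fun x => f x + g x).
Proof.
move=> Ao Cf Cg.
apply: (@TC_clin _ _ _ _ A (fun x => (f x, g x)) (fun z : V * V => z.1 + z.2)).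
- by [].
- by move=> a u v /=; rewrite scalerDr addrACA.
- by move=> z; exact: add_continuous.
- exact: TC_pair.
Qed.

Lemma TC_opp k U V (A : set U) (f : U -> V) : open A ->
  TC k A f -> TC k A (fun x => - f x).
Proof.
move=> Ao; apply: TC_clin => //.
- by move=> a u v /=; rewrite opprD scalerN.
- by move=> z; exact: opp_continuous.
Qed.

Lemma TC_subr k U V (A : set U) (f g : U -> V) : open A ->
  TC k A f -> TC k A g -> TC k A (fun x => f x - g x).
Proof. by move=> Ao Cf Cg; apply: TC_add => //; exact: TC_opp. Qed.

Lemma TC_sum k U V (A : set U) (I : Type) (r : seq I) (f : I -> U -> V) :
  open A -> (forall i, TC k A (f i)) -> TC k A (fun x => \sum_(i <- r) f i x).
Proof.
move=> Ao Cf; elim: r => [|i r IH].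
  by under eq_fun do rewrite big_nil; exact: TC_cst.
by under eq_fun do rewrite big_cons; exact: TC_add.
Qed.

(** The derivative of [b] is a sum of two values of [b] at linear projections of point and
    direction, so the class reproduces itself along the induction. *)
Lemma TC_bilin k U V W (A : set (U * V)) (b : {bilinear U -> V -> W}) :
  open A -> continuous (fun z => b z.1 z.2) -> TC k A (fun z => b z.1 z.2).
Proof.
move=> Ao bc; apply: (@TC_sub _ _ _ _ setT) => // {A Ao}.
elim: k => [|k IH]; first by move=> x _; exact: bc.
split; first by move=> x _; exact: differentiable_bilin.
have -> : (fun z : (U * V) * (U * V) => 'D_z.2 (fun z => b z.1 z.2) z.1) =
    fun z => b z.1.1 z.2.2 + b z.2.1 z.1.2.
  apply/funext => -[x v] /=; rewrite deriveE ?diff_bilin//.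
  exact: differentiable_bilin.
have AT : open ([set: U * V] `*` [set: U * V]) by apply: open_prod; exact: openT.
have C11 : TC k setT (@fst U V) by apply: TC_linear => // z; exact: cvg_fst.
have C12 : TC k setT (@snd U V) by apply: TC_linear => // z; exact: cvg_snd.
apply: TC_add => //.
- apply: (@TC_comp _ _ _ _ _ setT (fun z : (U * V) * (U * V) => (z.1.1, z.2.2))
    (fun z => b z.1 z.2)) => //.
  by apply: TC_pair => //; [exact: TC_fst C11|exact: TC_snd C12].
- apply: (@TC_comp _ _ _ _ _ setT (fun z : (U * V) * (U * V) => (z.2.1, z.1.2))
    (fun z => b z.1 z.2)) => //.
  by apply: TC_pair => //; [exact: TC_snd C11|exact: TC_fst C12].
Qed.

Lemma Ck_of_TC k V W (A : set V) (f : V -> W) : open A -> TC k A f -> Ck k A f.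
Proof.
elim: k V W A f => [//|k IH] V W A f Ao [df Tf]; split=> // v.
apply: IH => //.
apply: (@TC_comp _ _ _ _ A _ (fun x => (x, v)) _ _ _ _ Tf) => //.
by apply: TC_pair => //; [exact: TC_id|exact: TC_cst].
Qed.

Lemma Ck_ext k V W (A : set V) (f g : V -> W) : open A ->
  (forall x, A x -> f x = g x) -> Ck k A f -> Ck k A g.
Proof.
elim: k V W A f g => [|k IH] V W A f g Ao fg.
  exact: (@TC_ext 0).
move=> [df Tf]; have nfg x : A x -> {near x, f =1 g}.
  by move=> Ax; near=> y; apply: fg; near: y; exact: open_nbhs_nbhs.
split; first by move=> x Ax; apply: differentiable_near_eq (df x Ax); exact: nfg.
move=> v; apply: IH (Tf v) => //.
by move=> x Ax; exact/near_eq_derive/nfg.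
Unshelve. all: by end_near. Qed.

End TC_basic.

(** * Products, coordinates and the passage from partial derivatives to tangent maps *)

Section TC_finite_dimension.
Context {R : realType}.
Implicit Types (U V W : normedModType R) (k : nat).

Lemma scale_is_bilinear W : bilinear_for
  (GRing.Scale.Law.clone _ _ *:%R _) (GRing.Scale.Law.clone _ _ *:%R _)
  (fun (r : R) (w : W) => r *: w).
Proof.
split=> [w a x y|r a x y] /=; first by rewrite scalerDl scalerA.
by rewrite scalerDr !scalerA mulrC.
Qed.

Lemma TC_scale k U W (A : set U) (f : U -> R) (g : U -> W) : open A ->
  TC k A f -> TC k A g -> TC k A (fun x => f x *: g x).
Proof.
move=> Ao Cf Cg.
pose bM := bilinear_isBilinear.Build R R W W _ _ _ (scale_is_bilinear W).
pose b : {bilinear R -> W -> W} := HB.pack (fun (r : R) (w : W) => r *: w) bM.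
apply: (@TC_comp _ _ _ _ _ A setT (fun x => (f x, g x)) (fun z => b z.1 z.2)).
- by [].
- by [].
- exact: TC_pair.
- by apply: TC_bilin; [exact: openT|exact: scale_continuous].
Qed.

Lemma TC_mul k U (A : set U) (f g : U -> R) : open A ->
  TC k A f -> TC k A g -> TC k A (fun x => f x * g x).
Proof. exact: TC_scale. Qed.

Lemma TC_coord k U n (A : set U) (f : U -> 'rV[R]_n) (i : 'I_n) : open A ->
  TC k A f -> TC k A (fun x => f x 0 i).
Proof.
move=> Ao; apply: (@TC_clin _ _ _ _ _ _ f (fun v : 'rV[R]_n => v 0 i)) => //.
- by move=> a u v; rewrite !mxE.
- exact: coord_continuous.
Qed.

Lemma TC_row k U n (A : set U) (f : 'I_n -> U -> R) : open A ->
  (forall i, TC k A (f i)) -> TC k A (fun x => \row_i f i x).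
Proof.
move=> Ao Cf; have -> : (fun x => \row_i f i x) =
    (fun x => \sum_(i <- index_enum 'I_n) f i x *: (delta_mx 0 i : 'rV[R]_n)).
  by apply/funext => x; rewrite {1}[LHS]row_sum_delta; apply: eq_bigr => i _;
    rewrite mxE.
by apply: TC_sum => // i; apply: TC_scale => //; exact: TC_cst.
Qed.

Lemma TC_dot k U n (A : set U) (f g : U -> 'rV[R]_n) : open A ->
  TC k A f -> TC k A g -> TC k A (fun x => dot (f x) (g x)).
Proof.
by move=> Ao Cf Cg; apply: TC_sum => // i; apply: TC_mul => //; exact: TC_coord.
Qed.

Lemma derive_coord n W (f : 'rV[R]_n -> W) (x v : 'rV[R]_n) :
  differentiable f x ->
  'D_v f x = \sum_(i < n) v 0 i *: 'D_(delta_mx 0 i) f x.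
Proof.
move=> df; rewrite [in LHS](row_sum_delta v) deriveE// linear_sum.
by apply: eq_bigr => i _; rewrite linearZ deriveE.
Qed.

(** In coordinates the tangent map is a finite sum of coordinates of the direction times partial
    derivatives, and these are C^k. *)
Lemma TC_of_Ck k n W (A : set 'rV[R]_n) (f : 'rV[R]_n -> W) : open A ->
  Ck k A f -> TC k A f.
Proof.
move=> Ao; elim: k f => [//|k IH] f [df Cf]; split=> //.
have AT : open (A `*` [set: 'rV[R]_n]) by apply: open_prod => //; exact: openT.
apply: (@TC_ext _ _ _ _ _ (fun z : 'rV[R]_n * 'rV[R]_n =>
    \sum_(i <- index_enum 'I_n) z.2 0 i *: 'D_(delta_mx 0 i) f z.1)) => //.
  by move=> [x v] [/= Ax _]; rewrite [RHS]derive_coord//; exact: df.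
apply: TC_sum => // i; apply: TC_scale => //.
  by apply: TC_coord => //; apply: TC_linear => // z; exact: cvg_snd.
apply: (@TC_fst _ _ _ _ _ _ A ('D_(delta_mx 0 i) f)) => //.
  by move=> z [].
exact: IH (Cf _).
Qed.

End TC_finite_dimension.

(** * Mean value inequality and local Lipschitz bounds *)

Section mean_value.
Context {R : realType}.
Implicit Types V W : normedModType R.

(** Continuous induction. The local estimate to the left of the supremum [c] of the good times shows
    that [c] is good; if c < 1, the estimate to its right produces a later good time. *)
Lemma local_lipschitz_global W (f : R -> W) (L : R) : 0 <= L ->
  (forall c, 0 <= c <= 1 -> exists2 d, 0 < d &
     forall s, 0 <= s <= 1 -> `|s - c| < d -> `|f s - f c| <= L * `|s - c|) ->
  `|f 1 - f 0| <= L.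
Proof.
move=> L0 loc.
pose S := [set t : R | 0 <= t <= 1 /\ `|f t - f 0| <= L * t].
have S0 : S 0 by split; [rewrite lexx ler01|rewrite subrr normr0 mulr0].
have Sub : ubound S 1 by move=> t [/andP[_]].
have Ssup : has_sup S by split; [exists 0|exists 1].
pose c := sup S.
have c0 : 0 <= c by apply: ub_le_sup => //; exists 1.
have c1 : c <= 1 by apply: ge_sup => //; exists 0.
have c01 : 0 <= c <= 1 by rewrite c0.
have [d d0 Hd] := loc c c01.
have [s Ss sc] := sup_adherent d0 Ssup.
have [/andP[s0 s1] fs] := Ss.
have sc' : s <= c by apply: ub_le_sup => //; exists 1.
have Sc : `|f c - f 0| <= L * c.
  have : 0 <= s <= 1 by rewrite s0.
  move=> /Hd; have nsc : `|s - c| = c - s by rewrite distrC ger0_norm// subr_ge0.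
  rewrite nsc; have sd : c - s < d by rewrite -/c in sc; lra.
  move=> /(_ sd) H; rewrite -(subrK (f s) (f c)) -addrA.
  apply: (le_trans (ler_normD _ _)); rewrite distrC.
  by apply: (le_trans (lerD H fs)); rewrite -mulrDr subrK.
have [c_lt1|] := ltP c 1; last first.
  by move=> c1'; move: Sc; rewrite (_ : c = 1) ?mulr1//; exact/le_anti/andP.
pose s' := Num.min 1 (c + d / 2).
have s'c : c < s' by rewrite lt_min c_lt1/= ltrDl divr_gt0.
have s'1 : 0 <= s' <= 1 by rewrite ge_min lexx/= andbT; exact: ltW (le_lt_trans c0 s'c).
have s'd : s' - c < d.
  have : s' <= c + d / 2 by rewrite ge_min lexx orbT.
  lra.
have nsc : `|s' - c| = s' - c by rewrite ger0_norm// subr_ge0 ltW.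
have := Hd s' s'1; rewrite nsc => /(_ s'd) H.
suff Ss' : S s'.
  have : s' <= c by apply: ub_le_sup => //; exists 1.
  by rewrite leNgt s'c.
split=> //; rewrite -(subrK (f c) (f s')) -addrA.
apply: (le_trans (ler_normD _ _)).
by apply: (le_trans (lerD H Sc)); rewrite -mulrDr subrK.
Qed.

Lemma mean_value_ineq V W (f : V -> W) (x y : V) (K : R) : 0 <= K ->
  (forall t, 0 <= t <= 1 -> differentiable f (x + t *: (y - x)) /\
     forall v, `|'D_v f (x + t *: (y - x))| <= K * `|v|) ->
  `|f y - f x| <= K * `|y - x|.
Proof.
move=> K0 H; set w := y - x.
have -> : f y - f x = f (x + 1 *: w) - f (x + 0 *: w).
  by rewrite scale1r scale0r addr0 (_ : x + w = y)// /w addrC subrK.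
apply/ler_addgt0Pr => e e0.
pose g (t : R) := f (x + t *: w).
(* The summand 1 covers the case x = y. *)
pose e' := e / (`|w| + 1).
have w1 : 0 < `|w| + 1 by rewrite ltr_wpDl.
have e'0 : 0 < e' by rewrite divr_gt0.
apply: (@local_lipschitz_global W g); first by rewrite addr_ge0// ?mulr_ge0// ltW.
move=> c c01; have [df Kf] := H c c01.
have /nbhs_norm0P[d /= d0 Hd] := eps_differentiable df e'0.
exists (d / (`|w| + 1)); first by rewrite divr_gt0.
move=> s s01 sc; have := Hd ((s - c) *: w).
have -> : (s - c) *: w + (x + c *: w) = x + s *: w.
  by rewrite addrCA -scalerDl subrK.
rewrite /= normrZ -/w.
have lt_d : `|s - c| * `|w| < d.
  apply: (@le_lt_trans _ _ (`|s - c| * (`|w| + 1))).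
    by rewrite ler_wpM2l// lerDl.
  by rewrite -ltr_pdivlMr.
move=> /(_ lt_d) H1; rewrite /g -/w.
have H2 := Kf ((s - c) *: w); rewrite -/w normrZ in H2.
rewrite -(subrK ('D_((s - c) *: w) f (x + c *: w)) (f (x + s *: w) - _)).
apply: (le_trans (ler_normD _ _)); apply: (le_trans (lerD H1 H2)).
have : e' * `|w| <= e.
  by rewrite /e' mulrAC ler_pdivrMr// ler_wpM2l ?lerDl// ltW.
move=> ew; have := @ler_wpM2l _ `|s - c| (normr_ge0 _) _ _ ew.
by move: (`|s - c| : R) (`|w| : R) => a b; lra.
Qed.

Lemma ball_segment V (c x y : V) (d t : R) : 0 <= t <= 1 ->
  `|x - c| < d -> `|y - c| < d -> `|x + t *: (y - x) - c| < d.
Proof.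
move=> /andP[t0 t1] xd yd.
have -> : x + t *: (y - x) - c = (1 - t) *: (x - c) + t *: (y - c).
  rewrite scalerBl scale1r -[in RHS]addrA -scalerN -scalerDr addrAC; congr (_ + _ *: _).
  by rewrite [RHS]addrC opprB addrA subrK.
apply: (le_lt_trans (ler_normD _ _)); rewrite !normrZ.
rewrite (ger0_norm t0) ger0_norm ?subr_ge0//.
have [->|tn0] := eqVneq t 0; first by rewrite mul0r subr0 mul1r addr0.
have tp : 0 < t by rewrite lt_neqAle eq_sym tn0.
have H1 : (1 - t) * `|x - c| <= (1 - t) * d by rewrite ler_wpM2l ?subr_ge0// ltW.
have H2 : t * `|y - c| < t * d by rewrite ltr_pM2l.
by move: H1 H2; move: (`|x - c|) (`|y - c|) => a b; nra.
Qed.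

(** Continuity of the tangent map at the single point (x, 0) suffices: for y near x and |v| < d the
    derivative has norm below 1, and scaling v to length d / 2 gives the operator bound 2 / d. *)
Lemma TC1_derive_bound V W (A : set V) (f : V -> W) (x : V) : open A -> A x ->
  TC 1 A f -> exists2 d : R, 0 < d & exists2 K : R, 0 <= K &
    forall y, `|y - x| < d -> A y /\ forall v, `|'D_v f y| <= K * `|v|.
Proof.
move=> Ao Ax [df Tf].
have := Tf (x, 0) (conj Ax I); rewrite /= /prop_for /continuous_at /= derive0.
move=> /cvgrPdist_lt /(_ 1 ltr01) /nbhs_normP[d /= d0 Hd].
have := open_nbhs_nbhs (conj Ao Ax) => /nbhs_normP[d' /= d'0 Hd'].
exists (Num.min d d'); first by rewrite lt_min d0.
exists (2 / d); first by rewrite divr_ge0// ltW.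
move=> y; rewrite lt_min => /andP[yd yd'].
have Ay : A y by apply: Hd'; rewrite /= distrC.
split=> // v; have [->|vn0] := eqVneq v 0; first by rewrite derive0 !normr0 mulr0.
have nv : 0 < `|v| by rewrite normr_gt0.
pose r := d / 2 / `|v|.
have r0 : 0 < r by rewrite !divr_gt0.
have := Hd (y, r *: v); rewrite /= prod_normE/= gt_max.
rewrite sub0r normrN normrZ (gtr0_norm r0) distrC yd/=.
have -> : r * `|v| = d / 2 by rewrite /r -mulrA mulVf ?mulr1// gt_eqF.
have -> : d / 2 < d by lra.
move=> /(_ isT); rewrite sub0r normrN.
rewrite (deriveE _ (df _ Ay)) linearZ/= -(deriveE _ (df _ Ay)) normrZ (gtr0_norm r0).
move=> /ltW H; rewrite -(ler_pM2l r0) (le_trans H)//.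
have -> : r * (2 / d * `|v|) = 1 by rewrite /r; field; rewrite !gt_eqF.
by [].
Qed.

Lemma TC1_lipschitz V W (A : set V) (f : V -> W) (x : V) : open A -> A x ->
  TC 1 A f -> exists2 d : R, 0 < d & exists2 K : R, 0 <= K &
    forall y z, `|y - x| < d -> `|z - x| < d ->
      [/\ A y, A z & `|f y - f z| <= K * `|y - z|].
Proof.
move=> Ao Ax Cf; have [d d0 [K K0 H]] := TC1_derive_bound Ao Ax Cf.
exists d => //; exists K => // y z yd zd; have [Ay _] := H y yd.
have [Az _] := H z zd; split => //; apply: mean_value_ineq => // t t01.
have [Aw Kw] := H _ (ball_segment t01 zd yd).
by split=> //; case: Cf => df _; exact: df.
Qed.

End mean_value.

(** * Smooth dependence of fixed points on parameters *)

Section fixed_points.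
Context {R : realType}.

(** Completeness is kept as a proposition and packed into a structure only where Banach's theorem is
    called; all spaces stay plain normed modules. *)
Definition cauchy_complete (Y : normedModType R) :=
  forall F : set_system Y, ProperFilter F -> cauchy F -> cvg F.

Lemma contraction_fixpoint (Y : normedModType R) (U : set Y)
    (f : Y -> Y) : cauchy_complete Y ->
  closed U -> U !=set0 -> (forall y, U y -> U (f y)) ->
  (forall y z, U y -> U z -> `|f y - f z| <= 2^-1 * `|y - z|) ->
  exists2 y, U y & f y = y.
Proof.
move=> Yc Uc U0 fU fl.
pose YM := Uniform_isComplete.Build Y Yc.
pose YC : completeNormedModType R := HB.pack Y YM.
pose fM := isFun.Build YC YC U U f fU.
pose F : {fun U >-> U} := HB.pack f fM.
have h0 : 0 <= 2^-1 :> R by rewrite invr_ge0.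
have ctr : is_contraction F.
  exists (NngNum h0); split => /=; first by rewrite invf_lt1// ltr1n.
  by move=> [y z] [/= Uy Uz]; exact: fl.
by have [y Uy yE] := @banach_fixed_point R YC U F ctr Uc U0; exists y.
Qed.

(** A posteriori error bound. Uniqueness, continuous dependence and the norm bound for linear fixed
    points all come from it. *)
Lemma fixpoint_dist (Y : normedModType R) (f : Y -> Y) (y z : Y) :
  f y = y -> `|f y - f z| <= 2^-1 * `|y - z| -> `|y - z| <= 2 * `|f z - z|.
Proof.
move=> fy H; have : `|y - z| <= `|f y - f z| + `|f z - z|.
  by rewrite -{1}fy; exact: ler_distD.
by move: H; move: (`|y - z| : R) (`|f y - f z| : R) (`|f z - z| : R) => a b c; lra.
Qed.

Lemma local_fixpoint (P : normedModType R) (Y : normedModType R)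
    (G : P * Y -> Y) (p0 : P) (y0 : Y) (d : R) : cauchy_complete Y ->
  0 < d -> G (p0, y0) = y0 ->
  (forall p y z, `|p - p0| < d -> `|y - y0| < d -> `|z - y0| < d ->
     `|G (p, y) - G (p, z)| <= 2^-1 * `|y - z|) ->
  {for (p0, y0), continuous G} ->
  exists2 d' : R, 0 < d' & exists X : P -> Y, forall p, `|p - p0| < d' ->
    [/\ `|p - p0| < d, `|X p - y0| < d & G (p, X p) = X p].
Proof.
move=> Yc d0 G0 Gl Gc.
(* On the closed ball of radius d / 2 the contraction contributes at most d / 4; if G(p, y0) moves
   by less than d / 4, the ball is mapped to itself. *)
have d4 : 0 < d / 4 by rewrite divr_gt0.
have := Gc; rewrite /prop_for /continuous_at G0 => /cvgrPdist_lt /(_ _ d4).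
move=> /nbhs_normP[d1 /= d10 Hd1].
(* The implication makes the statement total in [p], as choice requires; far from [p0] the value
   [y0] is a dummy. *)
have H p : exists y, `|p - p0| < Num.min d d1 ->
    [/\ `|p - p0| < d, `|y - y0| < d & G (p, y) = y].
  have [|npd] := pselect (`|p - p0| < Num.min d d1); last by exists y0.
  rewrite lt_min => /andP[pd pd1].
  have Gy0 : `|G (p, y0) - y0| < d / 4.
    have := Hd1 (p, y0); rewrite /= prod_normE/= gt_max subrr normr0 d10.
    by rewrite distrC pd1 => /(_ isT); rewrite distrC.
  pose U := closed_ball y0 (d / 2).
  have d2 : 0 < d / 2 by rewrite divr_gt0.
  have UE y : U y -> `|y - y0| <= d / 2.
    by rewrite /U closed_ballE// /closed_ball_/= distrC.
  have EU y : `|y - y0| <= d / 2 -> U y.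
    by rewrite /U closed_ballE// /closed_ball_/= distrC.
  have Ud y : U y -> `|y - y0| < d.
    by move=> /UE /le_lt_trans; apply; rewrite ltr_pdivrMr// mulr2n mulrDr mulr1 ltrDl.
  have [y Uy yE] : exists2 y, U y & G (p, y) = y.
    apply: (@contraction_fixpoint Y U (fun y => G (p, y)) Yc).
    - exact: closed_ball_closed.
    - by exists y0; apply: EU; rewrite subrr normr0 ltW.
    - move=> y Uy; apply: EU; apply: (le_trans (ler_distD (G (p, y0)) _ _)).
      have := Gl p y y0 pd (Ud _ Uy); rewrite subrr normr0 => /(_ d0).
      move: (UE _ Uy) Gy0.
      move: (`|y - y0| : R) (`|G (p, y0) - y0| : R) (`|G (p, y) - G (p, y0)| : R).
      by move=> a b c; lra.
    - by move=> y z Uy Uz; apply: Gl => //; exact: Ud.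
  by exists y => _; split=> //; exact: Ud.
exists (Num.min d d1); first by rewrite lt_min d0.
have [X HX] := choice H; exists X => p pd; exact: HX.
Qed.

(** By [fixpoint_dist], |X q - X p| <= 2 |G(q, X p) - X p|, where the second argument of G is
    frozen; continuity of G concludes. *)
Lemma fixpoint_continuous (P Y : normedModType R) (A : set P) (B : set (P * Y))
    (G : P * Y -> Y) (X : P -> Y) : open B ->
  (forall p, A p -> B (p, X p)) -> (forall p, A p -> G (p, X p) = X p) ->
  (forall p y z, A p -> B (p, y) -> B (p, z) ->
      `|G (p, y) - G (p, z)| <= 2^-1 * `|y - z|) ->
  (forall z, B z -> {for z, continuous G}) -> open A ->
  forall p, A p -> {for p, continuous X}.
Proof.
move=> Bo AB GX Gl Gc Ao p Ap.
apply/cvgrPdist_lt => e e0.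
have Bp := AB p Ap.
have /= := Gc _ Bp; rewrite /prop_for /continuous_at GX// => /cvgrPdist_lt.
have e2 : 0 < e / 2 by rewrite divr_gt0.
move=> /(_ _ e2) /nbhs_normP[d1 /= d10 Hd1].
have := open_nbhs_nbhs (conj Bo Bp) => /nbhs_normP[d2 /= d20 Hd2].
near=> q.
have qd : `|p - q| < Num.min d1 d2.
  by near: q; apply: (@cvgr_dist_lt _ _ _ (nbhs p)) => //; rewrite lt_min d10.
have Aq : A q by near: q; exact: open_nbhs_nbhs.
move: qd; rewrite lt_min => /andP[qd1 qd2].
have GqX : `|X p - G (q, X p)| < e / 2.
  by apply: (Hd1 (q, X p)); rewrite /= prod_normE/= gt_max subrr normr0 d10 qd1.
have BqX : B (q, X p).
  by apply: (Hd2 (q, X p)); rewrite /= prod_normE/= gt_max subrr normr0 d20 qd2.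
rewrite distrC; apply: (le_lt_trans (@fixpoint_dist _ (fun y => G (q, y)) _ _ _ _)).
- exact: GX.
- by apply: Gl => //; exact: AB.
- by rewrite distrC -ltr_pdivlMl// mulrC.
Unshelve. all: by end_near. Qed.

(** Supplies the differential of an implicit solution, (1 - L(0, .))^-1 L(h, 0), without inverting
    an operator: existence is by contraction, linearity by uniqueness. *)
Lemma linear_fixpoint (P : normedModType R) (Y : normedModType R)
    (L : P * Y -> Y) : cauchy_complete Y -> linear L -> continuous L ->
  (forall y, `|L (0, y)| <= 2^-1 * `|y|) ->
  exists l : P -> Y, [/\ linear l, continuous l,
    (forall h, L (h, l h) = l h) &
    exists2 M : R, 0 <= M & forall h, `|L (h, 0)| <= M * `|h|].
Proof.
move=> Yc Ll Lc L2.
have LB u v : L (u - v) = L u - L v.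
  by rewrite addrC -scaleN1r Ll scaleN1r addrC.
have Llip h y z : `|L (h, y) - L (h, z)| <= 2^-1 * `|y - z|.
  by rewrite -LB (_ : (h, y) - (h, z) = (0, y - z))//; congr pair; rewrite subrr.
have H h : exists y, L (h, y) = y.
  have [|||y _ yE] := @contraction_fixpoint Y setT (fun y => L (h, y)) Yc closedT.
  - by exists 0.
  - by [].
  - by move=> y z _ _; exact: Llip.
  - by exists y.
have [l lE] := choice H.
have luniq h y : L (h, y) = y -> l h = y.
  move=> yE; apply/eqP; rewrite -subr_eq0 -normr_le0.
  have := @fixpoint_dist _ (fun y => L (h, y)) (l h) y (lE h) (Llip h _ _).
  by rewrite yE subrr normr0 mulr0.
have ll : linear l.
  by move=> a u v; apply: luniq; rewrite -{2}(lE u) -{2}(lE v) -Ll.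
have [M M0 HM] : exists2 M : R, 0 < M & forall x, `|L x| <= M * `|x|.
  pose LM := GRing.isLinear.Build _ _ _ _ L Ll.
  by pose LL : {linear (P * Y)%type -> Y} := HB.pack L LM; exact: (@linear_lipschitz _ _ _ LL).
have HM' h : `|L (h, 0)| <= M * `|h|.
  by have := HM (h, 0); rewrite prod_normE/= normr0 (max_idPl _).
exists l; split=> //; last by exists M => //; exact: ltW.
have lb h : `|l h| <= 2 * M * `|h|.
  have := @fixpoint_dist _ (fun y => L (h, y)) (l h) 0 (lE h) (Llip h _ _).
  by rewrite !subr0 => /le_trans; apply; rewrite -mulrA ler_wpM2l.
pose lM := GRing.isLinear.Build _ _ _ _ l ll.
pose lL : {linear P -> Y} := HB.pack l lM.
apply: (@bounded_linear_continuous _ _ _ lL).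
apply/linear_boundedP; near=> r => x; apply: (le_trans (lb x)).
by rewrite ler_wpM2r//; near: r; exact: nbhs_pinfty_ge.
Unshelve. all: by end_near. Qed.

(** Difference quotients in the second variable are bounded by 1/2, hence so is their limit. This
    makes the linearised equation a contraction with the same constant. *)
Lemma derive_lipschitz_bound (P Y : normedModType R) (B : set (P * Y))
    (G : P * Y -> Y) (p : P) (y : Y) : open B -> B (p, y) ->
  (forall z, B (p, z) -> `|G (p, z) - G (p, y)| <= 2^-1 * `|z - y|) ->
  differentiable G (p, y) ->
  forall v, `|'D_(0, v) G (p, y)| <= 2^-1 * `|v|.
Proof.
move=> Bo Bp Gl dG v.
have [->|vn0] := eqVneq v 0; first by rewrite derive0 !normr0 mulr0.
have nv : 0 < `|v| by rewrite normr_gt0.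
apply/ler_addgt0Pr => e e0.
pose e' := e / `|v|; have e'0 : 0 < e' by rewrite divr_gt0.
have /nbhs_norm0P[d1 /= d10 Hd1] := eps_differentiable dG e'0.
have := open_nbhs_nbhs (conj Bo Bp) => /nbhs_normP[d2 /= d20 Hd2].
pose d := Num.min d1 d2.
have dp : 0 < d by rewrite lt_min d10.
pose r := d / 2 / `|v|.
have r0 : 0 < r by rewrite !divr_gt0.
have rv : `|r *: v| < d.
  rewrite normrZ gtr0_norm// /r divfK ?gt_eqF//.
  by rewrite ltr_pdivrMr// mulr2n mulrDr mulr1 ltrDl.
have := rv; rewrite lt_min => /andP[rv1 rv2].
have n0 : `|(0, r *: v) : P * Y| = `|r *: v|.
  by rewrite prod_normE/= normr0; apply/max_idPr.
have := Hd1 (0, r *: v); rewrite /= n0 => /(_ rv1).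
have -> : (0, r *: v) + (p, y) = (p, r *: v + y) by congr pair; rewrite add0r.
have Brv : B (p, r *: v + y).
  apply: Hd2; rewrite /= prod_normE/= subrr normr0 gt_max d20/=.
  by rewrite opprD addrCA subrr addr0 normrN.
have := Gl _ Brv; rewrite addrK => H1 H2.
have E : 'D_(0, r *: v) G (p, y) = r *: 'D_(0, v) G (p, y).
  rewrite deriveE// (_ : (0, r *: v) = r *: ((0, v) : P * Y)).
    by rewrite linearZ/= deriveE.
  by congr pair; rewrite scaler0.
have H3 : `|r *: 'D_(0, v) G (p, y)| <= 2^-1 * `|r *: v| + e' * `|r *: v|.
  rewrite -E; rewrite -[X in `|X|](subKr (G (p, r *: v + y) - G (p, y))).
  by apply: (le_trans (ler_normB _ _)); exact: lerD.
rewrite -(ler_pM2l r0); move: H3.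
have nr (w : Y) : `|r *: w| = r * `|w| by rewrite normrZ gtr0_norm.
rewrite !nr.
by move=> /le_trans; apply; rewrite mulrDr mulrCA lerD2l /e' mulrCA divfK ?gt_eqF.
Qed.

Lemma fixpoint_differentiable (P : normedModType R)
    (Y : normedModType R) (A : set P) (B : set (P * Y))
    (G : P * Y -> Y) (X : P -> Y) : cauchy_complete Y -> open A -> open B ->
  (forall p, A p -> B (p, X p)) -> (forall p, A p -> G (p, X p) = X p) ->
  (forall p y z, A p -> B (p, y) -> B (p, z) ->
      `|G (p, y) - G (p, z)| <= 2^-1 * `|y - z|) ->
  (forall z, B z -> differentiable G z) ->
  forall p, A p -> differentiable X p /\
    forall h, 'D_(h, 'D_h X p) G (p, X p) = 'D_h X p.
Proof.
move=> Yc Ao Bo AB GX Gl dG p Ap.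
have Bp := AB p Ap; have dGp := dG _ Bp.
pose L z := 'D_z G (p, X p).
have Ll : linear L by exact: derive_linear.
have Lc : continuous L by exact: derive_continuous.
have L2 y : `|L (0, y)| <= 2^-1 * `|y|.
  by apply: (derive_lipschitz_bound Bo) => // z Bz; exact: Gl.
have [l [ll lc lE [M M0 LM]]] := linear_fixpoint Yc Ll Lc L2.
have Xc : {for p, continuous X}.
  apply: (fixpoint_continuous Bo AB GX Gl _ Ao) => // z Bz.
  exact: differentiable_continuous (dG z Bz).
suff [dX DX] : differentiable X p /\ forall v, 'D_v X p = l v.
  by split=> // h; rewrite DX; exact: lE.
have LD u v : L (u + v) = L u + L v by rewrite -[u]scale1r Ll !scale1r.
have LB u v : L (u - v) = L u - L v.
  by rewrite addrC -scaleN1r Ll scaleN1r addrC.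
apply: differentiable_eps => // e e0.
(* With e1 <= 1/4, the bound |D| <= e1 (|h| + |D|) + M |h| + |D| / 2 can be solved for |D| and gives
   |D| <= K |h|. The final error is at most 2 e1 (1 + K) |h|, whence the second term of the
   minimum. *)
pose K := 4 * (M + 1).
have K0 : 0 < K by rewrite mulr_gt0// ltr_wpDl.
pose e1 := Num.min (4^-1) (e / (2 * (K + 1))).
have e10 : 0 < e1 by rewrite lt_min invr_gt0/= divr_gt0 ?ltr0n// mulr_gt0// addr_gt0.
have e14 : e1 <= 4^-1 by rewrite ge_min lexx.
have e1e : e1 * (2 * (K + 1)) <= e.
  by rewrite -ler_pdivlMr ?ge_min ?lexx ?orbT// mulr_gt0// addr_gt0.
have /nbhs_norm0P[d /= d0 Hd] := eps_differentiable dGp e10.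
have /nbhs_normP[d' /= d'0 Hd'] : \forall q \near p, A q /\ `|X q - X p| < d.
  near=> q; split; first by near: q; exact: open_nbhs_nbhs.
  by rewrite distrC; near: q; move/cvgrPdist_lt : Xc; exact.
apply/nbhs_norm0P; exists (Num.min d d'); first by rewrite /= lt_min d0.
move=> h; rewrite /= lt_min => /andP[hd hd'].
have [Aq Xq] : A (h + p) /\ `|X (h + p) - X p| < d.
  by apply: Hd'; rewrite /= opprD addrCA subrr addr0 normrN.
set D := X (h + p) - X p.
have nD : `|(h, D) : P * Y| < d by rewrite prod_normE/= gt_max hd.
have := Hd (h, D) nD.
have -> : (h, D) + (p, X p) = (h + p, X (h + p)) by congr pair; rewrite /D subrK.
rewrite !GX// -/D -/(L _) => H1.
have nle : `|(h, D) : P * Y| <= `|h| + `|D|.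
  by rewrite prod_normE/= ge_max lerDl lerDr !normr_ge0.
have H2 : `|D - L (h, D)| <= e1 * (`|h| + `|D|).
  by apply: (le_trans H1); rewrite ler_wpM2l// ltW.
have LhD : `|L (h, D)| <= M * `|h| + 2^-1 * `|D|.
  rewrite (_ : (h, D) = (h, 0) + (0, D)); last by congr pair; rewrite ?addr0 ?add0r.
  by rewrite LD; apply: (le_trans (ler_normD _ _)); exact: lerD.
have DK : `|D| <= K * `|h|.
  have : `|D| <= `|D - L (h, D)| + `|L (h, D)|.
    by rewrite -{1}(subrK (L (h, D)) D) ler_normD.
  have : e1 * (`|h| + `|D|) <= 4^-1 * (`|h| + `|D|).
    by rewrite ler_wpM2r// addr_ge0.
  have := normr_ge0 h; move: H2 LhD; rewrite /K.
  move: (`|D| : R) (`|h| : R) (`|D - L (h, D)| : R) (`|L (h, D)| : R) => a b c f.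
  by nra.
have H3 : `|D - l h| <= 2 * `|D - L (h, D)|.
  have : `|D - l h| <= `|D - L (h, D)| + `|L (h, D) - L (h, l h)|.
    by rewrite lE; exact: ler_distD.
  have : `|L (h, D) - L (h, l h)| <= 2^-1 * `|D - l h|.
    rewrite -LB (_ : (h, D) - (h, l h) = (0, D - l h))//.
    by congr pair; rewrite subrr.
  move: (`|D - l h| : R) (`|L (h, D) - L (h, l h)| : R) (`|D - L (h, D)| : R).
  by move=> a b c; lra.
apply: (le_trans H3); apply: (@le_trans _ _ (e1 * (2 * (K + 1)) * `|h|)).
  apply: (le_trans (ler_wpM2l _ H2)) => //.
  have : e1 * `|D| <= e1 * (K * `|h|) by rewrite ler_wpM2l// ltW.
  by move: (`|D| : R) (`|h| : R) => a b; lra.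
by rewrite ler_wpM2r.
Unshelve. all: by end_near. Qed.

(* The tangent map of a fixed point is again a fixed point, namely of the
   tangent map of [G]; smoothness follows by induction. *)
Lemma fixpoint_TC k (P : normedModType R)
    (Y : normedModType R) (A : set P) (B : set (P * Y))
    (G : P * Y -> Y) (X : P -> Y) : cauchy_complete Y -> open A -> open B ->
  (forall p, A p -> B (p, X p)) -> (forall p, A p -> G (p, X p) = X p) ->
  (forall p y z, A p -> B (p, y) -> B (p, z) ->
      `|G (p, y) - G (p, z)| <= 2^-1 * `|y - z|) ->
  TC k B G -> TC k A X.
Proof.
move=> Yc; elim: k P A B G X => [|k IH] P A B G X Ao Bo AB GX Gl CG.
  exact: (fixpoint_continuous Bo AB GX Gl).
have CX : TC k A X by apply: (IH P A B G X) => //; exact: TC_mono.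
case: CG => dG TG.
have dX := fixpoint_differentiable Yc Ao Bo AB GX Gl dG.
split; first by move=> p /dX[].
(* [G'] contains [X], so [CX], its regularity of order [k], is established first. Being affine in
   the last variable, [G'] contracts on all of [Y]. *)
pose G' (z : (P * P) * Y) := 'D_(z.1.2, z.2) G (z.1.1, X z.1.1).
have AT : open (A `*` [set: P]) by apply: open_prod => //; exact: openT.
have ATT : open ((A `*` [set: P]) `*` [set: Y]) by apply: open_prod => //; exact: openT.
apply: (IH (P * P)%type (A `*` setT) ((A `*` setT) `*` setT) G') => //.
- by move=> [p h] [/= Ap _]; rewrite /G'/=; have [_ ->] := dX p Ap.
- move=> [p h] y z [/= Ap _] _ _; rewrite /G'/=.
  have dGp := dG _ (AB p Ap).
  rewrite !deriveE// -linearB/= -deriveE//.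
  rewrite (_ : (h, y) - (h, z) = (0, y - z)); last by congr pair; rewrite subrr.
  apply: (derive_lipschitz_bound Bo (AB p Ap)) => // x Bx.
  by apply: Gl => //; exact: AB.
- rewrite /G'; apply: (@TC_comp _ _ _ _ _ _ (B `*` setT)
    (fun z : (P * P) * Y => ((z.1.1, X z.1.1), (z.1.2, z.2)))
    (fun z => 'D_z.2 G z.1)) => //.
    by move=> [[p h] y] [[/= Ap _] _]; split => //; exact: AB.
  apply: TC_pair => //; apply: TC_pair => //.
  + by apply: TC_linear => // z; apply: continuous_comp; [exact: cvg_fst|exact: cvg_fst].
  + apply: (@TC_fst _ _ _ _ _ _ (A `*` setT) (fun z => X z.1)) => //; first by move=> z [].
    by apply: (@TC_fst _ _ _ _ _ _ A X) => // z [].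
  + by apply: TC_linear => // z; apply: continuous_comp; [exact: cvg_fst|exact: cvg_snd].
  + by apply: TC_linear => // z; exact: cvg_snd.
Qed.

End fixed_points.

(** * The space C([0, 1], W) *)

Section clamp.
Context {R : realType}.

Definition clamp (t : R) : R := Num.max 0 (Num.min 1 t).

Lemma clamp_itv t : 0 <= clamp t <= 1.
Proof. by rewrite /clamp le_max lexx ge_max ler01 ge_min lexx. Qed.

Lemma clamp_id t : 0 <= t <= 1 -> clamp t = t.
Proof. by move=> /andP[t0 t1]; rewrite /clamp (min_idPr _)// (max_idPr _). Qed.

Lemma clampK t : clamp (clamp t) = clamp t.
Proof. exact/clamp_id/clamp_itv. Qed.

Lemma clamp_continuous : continuous clamp.
Proof.
move=> t; apply: (@continuous_max _ _ (cst 0 : R -> R^o) (fun t => Num.min 1 t : R^o)).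
  exact: cvg_cst.
apply: (@continuous_min _ _ (cst 1 : R -> R^o) (id : R -> R^o)).
  exact: cvg_cst.
exact: cvg_id.
Qed.

End clamp.

(* C([0, 1], W), a curve being represented by its extension to the real line
   that is constant on both sides of [0, 1]. *)
Section C01_def.
Context {R : realType} (W : normedModType R).

Definition C01_pred : {pred R -> W} :=
  mem [set f : R -> W | continuous f /\ forall t, f (clamp t) = f t].

Record C01 := MkC01 { c01_fun :> R -> W ; _ : c01_fun \in C01_pred }.

HB.instance Definition _ := [isSub of C01 for c01_fun].
HB.instance Definition _ := [Choice of C01 by <:].

Lemma C01_predP (f : R -> W) :
  f \in C01_pred <-> continuous f /\ forall t, f (clamp t) = f t.
Proof. by split=> [|?]; rewrite inE. Qed.

Lemma C01_submod_closed : submod_closed C01_pred.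
Proof.
split=> [|a f g /C01_predP[fc fE] /C01_predP[gc gE]]; apply/C01_predP.
  by split=> // t; exact: cvg_cst.
split=> t; last by rewrite !fctE fE gE.
by apply: cvgD; [apply: cvgZr; exact: fc|exact: gc].
Qed.
HB.instance Definition _ := GRing.isSubmodClosed.Build R (R -> W) C01_pred
  C01_submod_closed.
HB.instance Definition _ := [SubChoice_isSubLmodule of C01 by <:].

Lemma c01_continuous (f : C01) : continuous f.
Proof. by have /C01_predP[] := valP f. Qed.

Lemma c01_clamp (f : C01) t : f (clamp t) = f t.
Proof. by have /C01_predP[] := valP f. Qed.

Lemma c01P (f g : C01) : (forall t, 0 <= t <= 1 -> f t = g t) -> f = g.
Proof.
move=> fg; apply/val_inj/funext => t.
by rewrite /= -c01_clamp -[RHS]c01_clamp fg// clamp_itv.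
Qed.

Lemma c01D (f g : C01) t : (f + g) t = f t + g t. Proof. by []. Qed.
Lemma c01B (f g : C01) t : (f - g) t = f t - g t. Proof. by []. Qed.
Lemma c01Z a (f : C01) t : (a *: f) t = a *: f t. Proof. by []. Qed.

Definition c01_norm (f : C01) : R := sup [set `|f t| | t in `[0, 1]].

Lemma c01_has_sup (f : C01) : has_sup [set `|f t| | t in `[0, 1]].
Proof.
split; first by exists `|f 0|, 0 => //; rewrite /= in_itv/= lexx ler01.
have [c _ H] : exists2 c, c \in `[0, 1]%R &
    forall t, t \in `[0, 1]%R -> `|f t| <= `|f c|.
  apply: (@EVT_max _ (fun t => `|f t|)); first exact: ler01.
  apply: continuous_subspaceT => t.
  by apply: continuous_comp; [exact: c01_continuous|exact: norm_continuous].
by exists `|f c| => _ [t t01 <-]; exact: H.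
Qed.

Lemma le_c01_norm (f : C01) t : `|f t| <= c01_norm f.
Proof.
rewrite -c01_clamp; apply: ub_le_sup; first by have [] := c01_has_sup f.
by exists (clamp t) => //; rewrite /= in_itv/= clamp_itv.
Qed.

Lemma c01_norm_le (f : C01) (M : R) : (forall t, 0 <= t <= 1 -> `|f t| <= M) ->
  c01_norm f <= M.
Proof.
move=> fM; apply: ge_sup; first by have [] := c01_has_sup f.
by move=> _ [t t01 <-]; apply: fM; move: t01; rewrite /= in_itv.
Qed.

Lemma c01_normD (f g : C01) : c01_norm (f + g) <= c01_norm f + c01_norm g.
Proof.
apply: c01_norm_le => t _; rewrite c01D; apply: (le_trans (ler_normD _ _)).
by apply: lerD; exact: le_c01_norm.
Qed.

Lemma c01_norm0_eq0 (f : C01) : c01_norm f = 0 -> f = 0.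
Proof.
move=> f0; apply: c01P => t _; apply/eqP; rewrite -normr_le0 -f0.
exact: le_c01_norm.
Qed.

Lemma c01_normZ (a : R) (f : C01) : c01_norm (a *: f) = `|a| * c01_norm f.
Proof.
apply/le_anti/andP; split.
  apply: c01_norm_le => t _; rewrite c01Z normrZ ler_wpM2l//.
  exact: le_c01_norm.
have [->|a0] := eqVneq a 0.
  by rewrite normr0 mul0r; apply: le_trans (le_c01_norm _ 0).
have na : 0 < `|a| by rewrite normr_gt0.
rewrite mulrC -ler_pdivlMr//; apply: c01_norm_le => t _.
by rewrite ler_pdivlMr// mulrC -normrZ -c01Z le_c01_norm.
Qed.

HB.instance Definition _ := @Lmodule_isNormed.Build R C01 c01_norm
  c01_normD c01_normZ c01_norm0_eq0.

Lemma ler_c01 (f : C01) t : `|f t| <= `|f|.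
Proof. exact: le_c01_norm. Qed.

Lemma c01_ler (f : C01) (M : R) : (forall t, 0 <= t <= 1 -> `|f t| <= M) ->
  `|f| <= M.
Proof. exact: c01_norm_le. Qed.

Lemma toC01_subproof (f : R -> W) (fc : continuous f) :
  (fun t => f (clamp t)) \in C01_pred.
Proof.
apply/C01_predP; split=> t; last by rewrite clampK.
by apply: continuous_comp; [exact: clamp_continuous|exact: fc].
Qed.

Definition toC01 (f : R -> W) (fc : continuous f) : C01 :=
  MkC01 (toC01_subproof fc).

Lemma toC01E f fc t : 0 <= t <= 1 -> @toC01 f fc t = f t.
Proof. by move=> t01; rewrite /= clamp_id. Qed.

Lemma c01_ev_linear t : linear (fun f : C01 => f t).
Proof. by []. Qed.

End C01_def.

Lemma bounded_linear_continuous' (R : realType) (V W : normedModType R)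
    (f : V -> W) (M : R) : linear f -> (forall x, `|f x| <= M * `|x|) ->
  continuous f.
Proof.
move=> fl fM; pose lM := GRing.isLinear.Build _ _ _ _ f fl.
pose lL : {linear V -> W} := HB.pack f lM.
apply: (@bounded_linear_continuous _ _ _ lL).
apply/linear_boundedP; near=> r => x; apply: (le_trans (fM x)).
by rewrite ler_wpM2r//; near: r; exact: nbhs_pinfty_ge.
Unshelve. all: by end_near. Qed.

Lemma c01_ev_continuous (R : realType) (W : normedModType R) t :
  continuous (fun f : C01 W => f t).
Proof.
apply: (@bounded_linear_continuous' _ _ _ _ 1).
  exact: c01_ev_linear.
by move=> f; rewrite mul1r ler_c01.
Qed.

Section C01_complete.
Context {R : realType} (W : normedModType R).

Lemma c01_complete : cauchy_complete W -> cauchy_complete (C01 W).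
Proof.
move=> Wc F FF /cauchyP Fc.
have FcE (e : R) : 0 < e -> exists f : C01 W, F (ball f e).
  by move=> e0; exact: Fc.
have ct t : cvg ((fun f : C01 W => f t) @ F).
  apply: Wc; apply/cauchy_exP => e e0.
  have [f Ff] := FcE e e0; exists (f t).
  suff H : F (fun g : C01 W => ball (f t) e (g t)) by exact: H.
  apply: filterS Ff => g; rewrite -!ball_normE/= => fg.
  by apply: le_lt_trans fg; exact: (ler_c01 (f - g) t).
pose g t := lim ((fun f : C01 W => f t) @ F).
have gE (e : R) (f : C01 W) : F (ball f e) -> forall t, `|f t - g t| <= e.
  move=> Ff t; apply/ler_addgt0Pr => d d0.
  have /cvgrPdist_lt /(_ d d0) Hd : (fun f : C01 W => f t) @ F --> g t by exact: ct.
  have [h [fh hg]] := @filter_ex _ F _ _ (filterI Ff Hd).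
  apply: (le_trans (ler_distD (h t) _ _)); apply: lerD.
    apply: (le_trans (ler_c01 (f - h) t)).
    by apply: ltW; move: fh; rewrite -ball_normE.
  by rewrite distrC ltW.
have gc : continuous g.
  move=> t; apply/cvgrPdist_lt => e e0.
  have e3 : 0 < e / 3 by rewrite divr_gt0.
  have [f Ff] := FcE _ e3.
  have := @c01_continuous _ _ f t => /cvgrPdist_lt /(_ _ e3).
  apply: filterS => s fs; have := gE _ _ Ff s; have := gE _ _ Ff t.
  rewrite distrC => H1 H2.
  apply: (le_lt_trans (ler_distD (f t) _ _)).
  apply: (le_lt_trans (lerD H1 (ler_distD (f s) _ _))).
  by move: fs H2; move: (`|f t - f s| : R) (`|f s - g s| : R) => a b; lra.
have gcl t : g (clamp t) = g t.
  by rewrite /g; congr (lim (_ @ F)); apply/funext => f; exact: c01_clamp.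
have gP : g \in @C01_pred R W by apply/C01_predP.
apply/cvg_ex; exists (MkC01 gP); apply/cvgrPdist_le => e e0.
have e2 : 0 < e / 2 by rewrite divr_gt0.
have [f Ff] := FcE _ e2; have FB := Ff; apply: filterS FB => h fh.
apply: c01_ler => t _; rewrite c01B /=.
apply: (le_trans (ler_distD (f t) _ _)); rewrite [e]splitr; apply: lerD.
  by rewrite distrC; exact: gE.
apply: (le_trans (ler_c01 (f - h) t)).
by apply: ltW; move: fh; rewrite -ball_normE.
Qed.

End C01_complete.

Lemma rV_complete (R : realType) n : cauchy_complete 'rV[R]_n.
Proof. by move=> F FF Fc; exact: cauchy_cvg. Qed.

(** The mean value inequality is applied to F minus its differential frozen at w. The derivative is
    Lipschitz in the base point because the tangent map is Lipschitz near (w0, 0), up to rescaling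
    the direction. The constant does not depend on w near w0. *)
Lemma taylor2_local (R : realType) (V W : normedModType R) (A : set V)
    (F : V -> W) (w0 : V) : open A -> A w0 -> TC 2 A F ->
  exists2 d : R, 0 < d & exists2 K : R, 0 <= K &
    forall w h, `|w - w0| < d -> `|w + h - w0| < d ->
      `|F (w + h) - F w - 'D_h F w| <= K * `|h| ^+ 2.
Proof.
move=> Ao Aw CF; have [dF TF] := CF.
have AT : open (A `*` [set: V]) by apply: open_prod => //; exact: openT.
have AT0 : (A `*` [set: V]) (w0, 0) by split.
have [d d0 [K K0 H]] := TC1_lipschitz AT AT0 TF.
have HA w : `|w - w0| < d -> A w.
  move=> wd; have := H (w, 0) (w, 0).
  by rewrite /= prod_normE/= subrr normr0 gt_max wd d0 => -[]// [].
have HK v z z' : `|z - w0| < d -> `|z' - w0| < d ->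
    `|'D_v F z - 'D_v F z'| <= (2 * K / d) * `|v| * `|z - z'|.
  move=> zd zd'; have [->|vn0] := eqVneq v 0.
    by rewrite !derive0 subrr !normr0 mulr0 mul0r.
  have nv : 0 < `|v| by rewrite normr_gt0.
  pose r := d / 2 / `|v|.
  have r0 : 0 < r by rewrite !divr_gt0.
  have nr (W' : normedModType R) (w : W') : `|r *: w| = r * `|w|.
    by rewrite normrZ gtr0_norm.
  have rv : `|r *: v| < d.
    by rewrite nr divfK ?gt_eqF// ltr_pdivrMr// mulr2n mulrDr mulr1 ltrDl.
  have := H (z, r *: v) (z', r *: v).
  rewrite /= !prod_normE/= !subr0 !subrr !normr0 !gt_max zd zd' rv/=.
  move=> [//|//|_ _]; rewrite (max_idPl _)//.
  have dz := dF _ (HA _ zd); have dz' := dF _ (HA _ zd').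
  have Dr y : differentiable F y -> 'D_(r *: v) F y = r *: 'D_v F y.
    by move=> dy; rewrite !deriveE// linearZ.
  rewrite !Dr// -scalerBr nr -ler_pdivlMl// => /le_trans; apply.
  rewrite le_eqVlt; apply/orP; left; apply/eqP.
  by rewrite /r; field; rewrite !gt_eqF.
exists d => //; exists (2 * K / d); first by rewrite divr_ge0 ?mulr_ge0// ltW.
move=> w h wd whd; set K' := 2 * K / d.
have K'0 : 0 <= K' by rewrite divr_ge0 ?mulr_ge0// ltW.
have dw : differentiable F w by exact/dF/HA.
pose L z := 'D_z F w.
have Ll : linear L by exact: derive_linear.
have Lc : continuous L by exact: derive_continuous.
have LB u v : L (u - v) = L u - L v.
  by rewrite addrC -scaleN1r Ll scaleN1r addrC.
have dL z := @differentiable_linear _ _ _ L z Ll Lc.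
have -> : F (w + h) - F w - 'D_h F w = (F (w + h) - L (w + h)) - (F w - L w).
  have -> : 'D_h F w = L (w + h) - L w by rewrite -LB addrAC subrr add0r.
  by rewrite !opprD !opprK addrACA.
have wh : w + h - w = h by rewrite addrAC subrr add0r.
have -> : K' * `|h| ^+ 2 = K' * `|h| * `|w + h - w| by rewrite wh -mulrA.
apply: (@mean_value_ineq _ _ _ (fun z => F z - L z)); first by rewrite mulr_ge0.
move=> t t01; have := ball_segment t01 wd whd.
rewrite wh => xd.
have dx : differentiable F (w + t *: h) by exact/dF/HA.
have [dLx DLx] := dL (w + t *: h).
split; first exact: differentiableB.
move=> v; rewrite deriveB; [|exact: diff_derivable|exact: diff_derivable].
rewrite DLx /L; apply: (le_trans (HK _ _ _ xd wd)).
rewrite (addrAC w) subrr add0r normrZ -/K'.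
have -> : K' * `|v| * (`|t| * `|h|) = (K' * `|h| * `|v|) * `|t| by ring.
case/andP: t01 => t0 t1; have nt : `|t| <= 1 by rewrite ger0_norm.
rewrite ler_piMr// mulr_ge0//.
exact: mulr_ge0.
Qed.

(** Monotonicity in the constant lets local constants be merged: on a compact set the property holds
    for all large [M] at once. *)
Lemma compact_uniform_bound (R : realType) (T : topologicalType) (K : set T)
    (P : R -> T -> Prop) : compact K ->
  (forall t M M', P M t -> M <= M' -> P M' t) ->
  (forall t, K t -> exists M, \forall s \near t, P M s) ->
  exists2 M, 0 < M & forall t, K t -> P M t.
Proof.
move=> /compact_near_coveringP cK mono loc.
have H : \forall M \near +oo, K `<=` P M.
  apply: cK => t Kt; have [M HM] := loc t Kt.
  exists (P M, [set M' | M <= M']) => /=.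
    by split; [exact: HM|exact/nbhs_pinfty_ge/num_real].
  by move=> [s M'] [/= Ps MM']; exact: mono MM'.
have [M [M0 HM]] : exists M : R, 0 < M /\ K `<=` P M.
  near (pinfty_nbhs R) => M; exists M; split; first by near: M; exact: nbhs_pinfty_gt.
  by near: M.
by exists M.
Unshelve. all: by end_near. Qed.

(** * Composition operators on C([0, 1], W) *)

Section nemytskii.
Context {R : realType}.
Implicit Types W : normedModType R.

Lemma nem_subproof W W' (F : W -> W') (Fc : continuous F) (x : C01 W) :
  continuous (fun t => F (x t)).
Proof. by move=> t; apply: continuous_comp; [exact: c01_continuous|exact: Fc]. Qed.

Definition nem W W' (F : W -> W') (Fc : continuous F) (x : C01 W) : C01 W' :=
  toC01 (@nem_subproof _ _ F Fc x).

Lemma nemE W W' (F : W -> W') Fc (x : C01 W) t : nem (F:=F) Fc x t = F (x t).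
Proof. by rewrite /= c01_clamp. Qed.

Lemma c01_pair_subproof W W' (x : C01 W) (y : C01 W') :
  continuous (fun t => (x t, y t)).
Proof. by move=> t; apply: cvg_pair; exact: c01_continuous. Qed.

Definition c01_pair W W' (x : C01 W) (y : C01 W') : C01 (W * W')%type :=
  toC01 (@c01_pair_subproof _ _ x y).

Lemma c01_pairE W W' (x : C01 W) (y : C01 W') t : c01_pair x y t = (x t, y t).
Proof. by rewrite /= !c01_clamp. Qed.

Lemma c01_pair_linear W W' :
  linear (fun z : C01 W * C01 W' => c01_pair z.1 z.2).
Proof.
move=> a u v; apply: c01P => t _.
by rewrite c01D c01Z !c01_pairE.
Qed.

Lemma c01_pair_continuous W W' :
  continuous (fun z : C01 W * C01 W' => c01_pair z.1 z.2).
Proof.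
apply: (@bounded_linear_continuous' _ _ _ _ 1); first exact: c01_pair_linear.
move=> [x y]; rewrite mul1r; apply: c01_ler => t _; rewrite c01_pairE.
by rewrite !prod_normE/= ge_max !le_max !ler_c01 orbT.
Qed.

Lemma compact01 : compact ([set t : R | 0 <= t <= 1]).
Proof.
by rewrite (_ : mkset _ = `[0, 1]%classic) ?set_itvcc//; exact: segment_compact.
Qed.

Lemma TC_tangent_continuous k W W' (F : W -> W') : TC k.+1 setT F ->
  continuous (fun z : W * W => 'D_z.2 F z.1).
Proof. by move=> [_ /TC_cont TF] z; exact: TF. Qed.

Lemma nem_differentiable W W' (F : W -> W') (Fc : continuous F)
    (TF : TC 2 setT F) (x : C01 W) :
  differentiable (nem Fc) x /\
  forall y, 'D_y (nem Fc) x = nem (TC_tangent_continuous TF) (c01_pair x y).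
Proof.
have [dF _] := TF; set Fc' := TC_tangent_continuous TF.
have LE y t : nem Fc' (c01_pair x y) t = 'D_(y t) F (x t).
  by rewrite nemE c01_pairE.
have Ll : linear (fun y => nem Fc' (c01_pair x y)).
  move=> a u v; apply: c01P => t _; rewrite LE.
  transitivity (a *: nem Fc' (c01_pair x u) t + nem Fc' (c01_pair x v) t) => //.
  by rewrite !LE; apply: (derive_linear (dF (x t) I)).
have [||M1 M10 HM1] := @compact_uniform_bound R R [set t : R | 0 <= t <= 1]
    (fun M t => forall v, `|'D_v F (x t)| <= M * `|v|) compact01.
  - by move=> t M M' HM MM' v; rewrite (le_trans (HM v))// ler_wpM2r.
  - move=> t _; have [d d0 [K K0 H]] := @TC1_derive_bound R _ _ setT F (x t) openT I (TC_mono TF).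
    exists K; have := @c01_continuous _ _ x t => /cvgrPdist_lt /(_ d d0).
    by apply: filterS => s xs; have [|_] := H (x s); rewrite 1?distrC.
have Lc : continuous (fun y => nem Fc' (c01_pair x y)).
  apply: (@bounded_linear_continuous' _ _ _ _ M1) => // y.
  apply: c01_ler => t t01; rewrite LE; apply: (le_trans (HM1 _ t01 _)).
  by rewrite ler_wpM2l ?ler_c01// ltW.
apply: differentiable_eps => // e e0.
(* One number [M] is both the remainder constant and, through |h| M < 1, the inverse of the radius
   of validity. This makes the property monotone in [M]. *)
have [||M M0 HM] := @compact_uniform_bound R R [set t : R | 0 <= t <= 1]
    (fun M t => forall h, `|h| * M < 1 ->
      `|F (h + x t) - F (x t) - 'D_h F (x t)| <= M * `|h| ^+ 2) compact01.
  - move=> t M M' HM MM' h hM; apply: (le_trans (HM h _)).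
      by apply: le_lt_trans hM; rewrite ler_wpM2l.
    by rewrite ler_wpM2r// exprn_ge0.
  - move=> t _; have [d d0 [K K0 H]] := @taylor2_local R _ _ setT F (x t) openT I TF.
    exists (Num.max K (2 / d)).
    have d2 : 0 < d / 2 by rewrite divr_gt0.
    have := @c01_continuous _ _ x t => /cvgrPdist_lt /(_ _ d2).
    apply: filterS => s xs h hM.
    have hd : `|h| < d / 2.
      have : `|h| * (2 / d) < 1.
        by apply: le_lt_trans hM; rewrite ler_wpM2l// le_max lexx orbT.
      by rewrite mulrA ltr_pdivrMr// mul1r ltr_pdivlMr.
    have dd : d / 2 < d by rewrite ltr_pdivrMr// mulr2n mulrDr mulr1 ltrDl.
    rewrite (addrC h); apply: (le_trans (H (x s) h _ _)).
    + by rewrite distrC; exact: lt_trans dd.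
    + rewrite addrAC [d]splitr; apply: (le_lt_trans (ler_normD _ _)).
      by rewrite ltrD// distrC.
    + by rewrite ler_wpM2r ?exprn_ge0// le_max lexx.
apply/nbhs_norm0P; exists (Num.min M^-1 (e / M)).
  by rewrite /= lt_min invr_gt0 M0 divr_gt0.
move=> h; rewrite /= lt_min => /andP[hM he].
apply: c01_ler => t t01; rewrite !c01B LE !nemE c01D.
have ht : `|h t| <= `|h| by exact: ler_c01.
apply: (le_trans (HM t t01 (h t) _)).
  by apply: (le_lt_trans (ler_wpM2r (ltW M0) ht)); rewrite -ltr_pdivlMr// div1r.
apply: (@le_trans _ _ (M * (`|h| * `|h|))).
  by rewrite ler_wpM2l ?(ltW M0)// expr2 ler_pM.
rewrite mulrA ler_wpM2r//; move: he; rewrite ltr_pdivlMr// mulrC; exact: ltW.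
Qed.

(** The two extra derivatives pay for the uniform quadratic remainder. The induction closes because
    the tangent map of [nem Fc] is the operator of the tangent map of [F], after the linear
    pairing. *)
Lemma nem_TC k W W' (F : W -> W') (Fc : continuous F) :
  TC k.+2 setT F -> TC k setT (nem Fc).
Proof.
elim: k W W' F Fc => [|k IH] W W' F Fc TF.
  move=> x _; apply: differentiable_continuous.
  by have [] := nem_differentiable Fc TF x.
have TF2 : TC 2 setT F by elim: k TF {IH} => [/TC_mono//|k IH /TC_mono].
split; first by move=> x _; have [] := nem_differentiable Fc TF2 x.
have -> : (fun z => 'D_z.2 (nem Fc) z.1) = (fun z : C01 W * C01 W =>
    nem (TC_tangent_continuous TF2) (c01_pair z.1 z.2)).
  apply/funext => -[x y] /=.
  by have [_ ->] := nem_differentiable Fc TF2 x.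
apply: (@TC_comp _ _ _ _ _ _ setT (fun z : C01 W * C01 W => c01_pair z.1 z.2)
   (nem (TC_tangent_continuous TF2))) => //.
- by apply: open_prod; exact: openT.
- by apply: TC_linear; [exact: c01_pair_linear|exact: c01_pair_continuous].
- apply: IH; have [_ H] := TF.
  by apply: (@TC_sub _ k.+2 _ _ setT (setT `*` setT) _ _ H) => z.
Qed.

End nemytskii.

(** * Integration *)

Section antiderivative.
Context {R : realType}.
Local Notation mu := lebesgue_measure.
Implicit Types W : normedModType R.

(** Vector-valued curves are integrated through primitives on the whole line; the Lebesgue integral
    is taken of real functions only. *)
Definition is_prim W (f H : R -> W) :=
  forall t : R, is_derive t (1 : R) H (f t).

Lemma is_prim_continuous W (f H : R -> W) : is_prim f H -> continuous H.
Proof.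
move=> fH t; apply: differentiable_continuous; apply/derivable1_diffP.
by have [] := fH t.
Qed.

Lemma derive_dir W (H : R -> W) (t v : R) : derivable H t 1 ->
  'D_v H t = v *: 'D_1 H t.
Proof.
move=> /derivable1_diffP dH.
by rewrite !deriveE// -[X in 'd H t X](mulr1 v) -linearZ.
Qed.

Lemma derive_const_segment W (H K : R -> W) (a b : R) :
  (forall s, 0 <= s <= 1 -> exists w, is_derive (a + s * (b - a)) 1 H w /\
     is_derive (a + s * (b - a)) 1 K w) -> H b - H a = K b - K a.
Proof.
move=> HK; apply/eqP; rewrite -subr_eq0 opprB addrACA -opprB -addrA.
rewrite (_ : _ + _ = (H b - K b) - (H a - K a)); last first.
  by rewrite opprB opprB !addrA addrAC [X in X - _]addrAC.
rewrite -normr_le0 -(mul0r `|b - a|).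
apply: (@mean_value_ineq _ _ _ (fun t => H t - K t)) => // s s01.
have [w [dH dK]] := HK s s01.
have dHK : is_derive (a + s * (b - a)) 1 (H \- K) (w - w) by exact: is_deriveB.
split; first by apply/derivable1_diffP; case: dHK.
move=> v; rewrite mul0r normr_le0 derive_dir; last by case: dHK.
by case: dHK => _ ->; rewrite subrr scaler0.
Qed.

Lemma is_prim_unique W (f H K : R -> W) : is_prim f H -> is_prim f K ->
  H 0 = K 0 -> H = K.
Proof.
move=> fH fK HK0; apply/funext => t.
have := @derive_const_segment _ H K 0 t => /(_ _)/eqP.
rewrite HK0 subr_eq subrK => H1; apply/eqP/H1 => s _.
by exists (f (0 + s * (t - 0))); split; [exact: fH|exact: fK].
Qed.

Lemma continuous_integrable (f : R -> R) (a b : R) : continuous f ->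
  mu.-integrable `[a, b] (EFin \o f).
Proof.
move=> fc; apply: continuous_compact_integrable; first exact: segment_compact.
exact: continuous_subspaceT.
Qed.

(** The fundamental theorem applies to the right of a fixed lower end [a]. The functions [G a],
    normalised at 0, agree where several are valid, and are glued. *)
Lemma ex_is_prim_real (f : R -> R) : continuous f ->
  exists H, H 0 = 0 /\ is_prim f H.
Proof.
move=> fc.
pose G (a t : R) : R := (\int[mu]_(s in `[a, t]) f s) - (\int[mu]_(s in `[a, 0]) f s).
have dG (a t : R) : a < t -> is_derive t (1 : R) (G a) (f t).
  move=> at_.
  have := @continuous_FTC1_closed R f a t (t + 1).
  rewrite ltrDl ltr01 => /(_ isT (continuous_integrable _ _ fc) at_ (fc t)) [dF Ff].
  have dF' : is_derive t 1 (fun t => \int[mu]_(s in `[a, t]) f s)%R (f t).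
    by apply: DeriveDef; [exact: dF|rewrite -derive1E; exact: Ff].
  pose I0 : R := \int[mu]_(s in `[a, 0]) f s.
  have := is_deriveB dF' (is_derive_cst I0 t (1 : R)); rewrite subr0; exact.
have G0 (a : R) : G a 0 = 0 by rewrite /G subrr.
(* The lower end moves with [t] so that both 0 and [t] lie to its right. *)
pose H (t : R) := G (Num.min 0 t - 1) t.
exists H; split; first by rewrite /H G0.
(* This [a] lies below every lower end used at distance less than 1 from [t0]. *)
move=> t0; pose a := Num.min 0 t0 - 2.
have HG : \forall t \near t0, G a t = H t.
  near=> t.
  have tt0 : `|t0 - t| < 1 by near: t; apply/nbhs_normP; exists 1 => /=.
  have : t0 - t < 1 by apply: le_lt_trans tt0; exact: ler_norm.
  move=> tt; set b := Num.min 0 t - 1.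
  have ab : a <= b.
    rewrite /a /b; case: (leP 0 t0); case: (leP 0 t) => *; lra.
  have [b0 bt] : b < 0 /\ b < t by rewrite /b; case: (leP 0 t) => *; lra.
  have := @derive_const_segment _ (G a) (G b) 0 t.
  rewrite !G0 !subr0 => -> // s /andP[s0 s1]; exists (f (0 + s * t)).
  have bs : b < 0 + s * t.
    rewrite add0r; have [t0'|t0'] := leP 0 t.
      by apply: (lt_le_trans b0); exact: mulr_ge0.
    by apply: (lt_le_trans bt); rewrite -[leLHS]mul1r ler_wnM2r// ltW.
  by split; apply: dG => //; exact: le_lt_trans bs.
apply: near_eq_is_derive HG _; apply: dG.
rewrite /a; case: (leP 0 t0) => *; lra.
Unshelve. all: by end_near. Qed.

Lemma ex_is_prim n (f : R -> 'rV[R]_n) : continuous f ->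
  exists H, H 0 = 0 /\ is_prim f H.
Proof.
move=> fc.
have /choice[H HP] : forall i : 'I_n, exists H : R -> R, H 0 = 0 /\
    is_prim (fun t => f t 0 i) H.
  move=> i; apply: ex_is_prim_real => t.
  apply: (@continuous_comp _ _ _ f (fun v : 'rV_n => v 0 i)); first exact: fc.
  exact: coord_continuous.
exists (fun t => \row_i H i t); split.
  by apply/rowP => i; rewrite !mxE; have [] := HP i.
have HE i j : (fun s => (\row_k H k s : 'rV[R]_n) i j) = H j.
  by apply/funext => s; rewrite mxE.
move=> t; have dM : derivable (fun t => \row_i H i t) t 1.
  by apply/derivable_mxP => i j; rewrite HE; have [_ /(_ t) []] := HP j.
apply: DeriveDef => //; rewrite derive_mx//.
by apply/rowP => i; rewrite mxE HE; have [_ /(_ t) []] := HP i.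
Qed.

Definition prim W (f : R -> W) : R -> W :=
  get [set H | H 0 = 0 /\ is_prim f H].

Lemma primP n (f : R -> 'rV[R]_n) : continuous f ->
  prim f 0 = 0 /\ is_prim f (prim f).
Proof.
by move=> /ex_is_prim; exact: (@getPex _ [set H | H 0 = 0 /\ is_prim f H]).
Qed.

Lemma prim_unique n (f H : R -> 'rV[R]_n) : continuous f -> H 0 = 0 ->
  is_prim f H -> prim f = H.
Proof.
by move=> /primP[p0 pP] H0 HP; apply: is_prim_unique pP HP _; rewrite p0.
Qed.

Lemma is_prim_bound W (f H : R -> W) (M t : R) : is_prim f H -> H 0 = 0 ->
  (forall s, 0 <= s <= 1 -> `|f s| <= M) -> 0 <= t <= 1 -> `|H t| <= M.
Proof.
move=> fH H0 fM /andP[t0 t1].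
have M0 : 0 <= M by apply: le_trans (fM 0 _); rewrite ?lexx ?ler01.
rewrite -[H t]subr0 -H0; apply: (@le_trans _ _ (M * `|t - 0|)).
  apply: mean_value_ineq => // s /andP[s0 s1].
  have [dH DH] := fH (0 + s *: (t - 0)).
  split; first exact/derivable1_diffP.
  move=> v; rewrite derive_dir// DH normrZ mulrC ler_wpM2r//.
  apply: fM; rewrite add0r subr0 /GRing.scale/=; apply/andP; split.
    exact: mulr_ge0.
  exact: mulr_ile1.
by rewrite subr0 ger0_norm// ler_piMr.
Qed.

Lemma Rintegral_is_prim (f H : R -> R) (t : R) : continuous f -> is_prim f H ->
  0 <= t -> \int[mu]_(s in `[0, t]) f s = H t - H 0.
Proof.
move=> fc fH; rewrite le_eqVlt => /predU1P[<-|t0].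
  by rewrite set_itv1 Rintegral_set1 subrr.
rewrite /Rintegral (@continuous_FTC2 _ f H)//.
- exact: continuous_subspaceT.
- have Hc := is_prim_continuous fH; split.
  + by move=> s _; have [] := fH s.
  + exact/cvg_at_right_filter/Hc.
  + exact/cvg_at_left_filter/Hc.
- by move=> s _; rewrite derive1E; have [] := fH s.
Qed.

End antiderivative.

Section integration_operator.
Context {R : realType} {n : nat}.
Local Notation E := 'rV[R]_n.
Local Notation Y := (C01 E).

Lemma prim_continuous (f : R -> E) : continuous f -> continuous (prim f).
Proof. by move=> /primP[_]; exact: is_prim_continuous. Qed.

(** The Volterra operator: integration from 0. *)
Definition J (f : Y) : Y := toC01 (prim_continuous (@c01_continuous _ _ f)).

Lemma JE (f : Y) t : 0 <= t <= 1 -> J f t = prim f t.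
Proof. by move=> t01; rewrite toC01E. Qed.

Lemma J_linear : linear J.
Proof.
move=> a f g; apply: c01P => t t01; rewrite c01D c01Z !JE//.
have [f0 fP] := primP (@c01_continuous _ _ f).
have [g0 gP] := primP (@c01_continuous _ _ g).
suff -> : prim (a *: f + g : Y) = a *: prim f + prim g by [].
apply: prim_unique; first exact: c01_continuous.
  by rewrite !fctE f0 g0 scaler0 addr0.
by move=> s; apply: is_deriveD; [apply: is_deriveZ; exact: fP|exact: gP].
Qed.

Lemma J_le (f : Y) : `|J f| <= `|f|.
Proof.
have [f0 fP] := primP (@c01_continuous _ _ f).
apply: c01_ler => t t01; rewrite JE//.
by apply: (is_prim_bound fP) => // s _; exact: ler_c01.
Qed.

Lemma J_continuous : continuous J.
Proof.
apply: (@bounded_linear_continuous' _ _ _ _ 1); first exact: J_linear.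
by move=> f; rewrite mul1r J_le.
Qed.

End integration_operator.

(** * The potential and its gradient *)

Section gradient.
Context {R : realType} {n : nat}.
Local Notation E := 'rV[R]_n.

Lemma dotDl (u v w : E) : dot (u + v) w = dot u w + dot v w.
Proof. by rewrite -big_split; apply: eq_bigr => i _; rewrite mxE mulrDl. Qed.

Lemma dotC (u v : E) : dot u v = dot v u.
Proof. by apply: eq_bigr => i _; rewrite mulrC. Qed.

Lemma dotZl a (u v : E) : dot (a *: u) v = a * dot u v.
Proof. by rewrite mulr_sumr; apply: eq_bigr => i _; rewrite mxE mulrA. Qed.

Lemma dotDr (u v w : E) : dot u (v + w) = dot u v + dot u w.
Proof. by rewrite dotC dotDl !(dotC u). Qed.

Lemma dotZr a (u v : E) : dot u (a *: v) = a * dot u v.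
Proof. by rewrite dotC dotZl dotC. Qed.

Lemma dotNl (u v : E) : dot (- u) v = - dot u v.
Proof. by rewrite -scaleN1r dotZl mulN1r. Qed.

Lemma dotNr (u v : E) : dot u (- v) = - dot u v.
Proof. by rewrite dotC dotNl dotC. Qed.

Lemma dot0l (u : E) : dot 0 u = 0.
Proof. by rewrite -(scale0r 0) dotZl mul0r. Qed.

Lemma dot_ge0 (u : E) : 0 <= dot u u.
Proof. by apply: sumr_ge0 => i _; rewrite -expr2 sqr_ge0. Qed.

Lemma norm_coord_le (u : E) i : `|u 0 i| <= `|u|.
Proof.
rewrite [leRHS]/Num.Def.normr/= mx_normrE.
exact: (@le_bigmax _ _ _ 0 (fun ij : 'I_1 * 'I_n => `|u ij.1 ij.2|) (0, i)).
Qed.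

Lemma norm_le_coord (u : E) (M : R) : 0 <= M -> (forall i, `|u 0 i| <= M) ->
  `|u| <= M.
Proof.
move=> M0 H; rewrite [leLHS]/Num.Def.normr/= mx_normrE.
by apply: bigmax_le => // -[i j] _ /=; rewrite ord1.
Qed.

Lemma sqr_norm_le_dot (u : E) : `|u| ^+ 2 <= dot u u.
Proof.
rewrite -[leRHS]sqr_sqrtr ?dot_ge0// ler_sqr ?nnegrE ?sqrtr_ge0//.
apply: norm_le_coord => [|i]; first exact: sqrtr_ge0.
rewrite -(ler_sqr (normr_ge0 _) (sqrtr_ge0 _)) sqr_sqrtr ?dot_ge0//.
rewrite real_normK ?num_real// /dot (bigD1 i)//= -expr2 lerDl.
by apply: sumr_ge0 => j _; rewrite -expr2 sqr_ge0.
Qed.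

Lemma dot_le_norm (u v : E) : `|dot u v| <= n%:R * (`|u| * `|v|).
Proof.
rewrite -[X in X%:R]card_ord -sumr_const mulr_suml.
apply: (le_trans (ler_norm_sum _ _ _)); apply: ler_sum => i _.
by rewrite mul1r normrM ler_pM// norm_coord_le.
Qed.

Lemma sqr_enorm (u : E) : enorm u ^+ 2 = dot u u.
Proof. by rewrite sqr_sqrtr// dot_ge0. Qed.

Lemma derive_grad (f : E -> R) (x v : E) : differentiable f x ->
  'D_v f x = dot (grad f x) v.
Proof.
move=> df; rewrite derive_coord//; apply: eq_bigr => i _.
by rewrite mxE mulrC.
Qed.

Lemma grad_eq_dot (f : E -> R) (x g : E) :
  (forall v, 'D_v f x = dot g v) -> grad f x = g.
Proof.
move=> H; apply/rowP => i; rewrite mxE H /dot (bigD1 i)//= mxE !eqxx mulr1.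
rewrite big1 ?addr0// => j ji; rewrite mxE eqxx/= (negPf ji)/=.
by rewrite mulr0.
Qed.

End gradient.

(* An upper quadratic expansion of [V] that is uniform for base points in a
   compact set and, [V] being bounded above, valid for arbitrary increments. *)
Lemma global_upper_taylor (R : realType) n (V : 'rV[R]_n -> R) (B : R)
    (K : set 'rV[R]_n) : compact K -> TC 2 setT V -> (forall x, V x <= B) ->
  exists2 M, 0 < M & forall p q, K p ->
    V q <= V p + 'D_(q - p) V p + M * `|q - p| ^+ 2.
Proof.
move=> cK CV VB; have [dV _] := CV.
suff [M M0 HM] : exists2 M, 0 < M & forall p, K p ->
    forall q, V q <= V p + 'D_(q - p) V p + M * `|q - p| ^+ 2.
  by exists M => // p q Kp; exact: HM.
apply: (@compact_uniform_bound _ _ K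
  (fun M p => forall q, V q <= V p + 'D_(q - p) V p + M * `|q - p| ^+ 2)) => //.
  move=> p M M' HM MM' q; apply: (le_trans (HM q)).
  by rewrite lerD2l ler_wpM2r// exprn_ge0.
move=> p _.
have [d d0 [K2 K20 HK2]] := @taylor2_local R _ _ setT V p openT I CV.
have [d1 d10 [K1 K10 HK1]] := @TC1_derive_bound R _ _ setT V p openT I (TC_mono CV).
have Vc : {for p, continuous V} by exact: differentiable_continuous (dV p I).
have := Vc => /cvgrPdist_lt /(_ 1 ltr01) /nbhs_normP[d2 /= d20 HV].
pose r := d / 2; have r0 : 0 < r by rewrite divr_gt0.
pose C := `|B - V p + 1|.
(* [K2] is the Taylor constant for |h| < r. For |h| >= r, V q <= B <= V s + (B - V p + 1); the
   constant [C] and the linear term, at most K1 |h|, are absorbed by |h|^2 at the cost of 1 / r^2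
   and 1 / r. *)
exists (K2 + C / r ^+ 2 + K1 / r).
have N : nbhs (p : 'rV[R]_n) [set s | `|p - s| < Num.min r (Num.min d1 d2)].
  apply/(@nbhs_ballP R 'rV[R]_n); exists (Num.min r (Num.min d1 d2)).
    by rewrite /= !lt_min r0 d10.
  by move=> s; rewrite -ball_normE.
apply: filterS N => s sd q; rewrite /= distrC in sd.
move: sd; rewrite !lt_min => /and3P[sr sd1 sd2].
set h := q - s.
have Cr : 0 <= C / r ^+ 2.
  by apply: divr_ge0; [exact: normr_ge0|exact/exprn_ge0/ltW].
have Kr : 0 <= K1 / r by apply: divr_ge0 => //; exact: ltW.
have [hr|hr] := ltP `|h| r.
  have := HK2 s h; have -> : s + h = q by rewrite /h addrC subrK.
  have sd : `|s - p| < d by apply: (lt_trans sr); rewrite /r; lra.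
  have qd : `|q - p| < d.
    apply: (le_lt_trans (ler_distD s _ _)); rewrite -/h /r in hr sr *; lra.
  move=> /(_ sd qd); rewrite ler_norml => /andP[_].
  have : K2 * `|h| ^+ 2 <= (K2 + C / r ^+ 2 + K1 / r) * `|h| ^+ 2.
    by rewrite ler_wpM2r ?exprn_ge0// -addrA lerDl addr_ge0.
  move: (K2 * _) ((_ + _) * `|h| ^+ 2) ('D_h V s) => a b c.
  by move: (V q) (V s) => vq vs; lra.
have [_ Hs1] := HK1 s sd1; have := Hs1 h; rewrite ler_norml => /andP[D1 _].
have := HV s; rewrite /= distrC => /(_ sd2); rewrite ltr_norml => /andP[_ Vs].
apply: (le_trans (VB q)).
have h1 : 1 <= `|h| / r by rewrite ler_pdivlMr// mul1r.
have hh : `|h| / r <= (`|h| / r) ^+ 2 by rewrite expr2 ler_peMl// (le_trans ler01).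
have E1 : C / r ^+ 2 * `|h| ^+ 2 = C * (`|h| / r) ^+ 2.
  by field; rewrite gt_eqF.
have E2 : K1 / r * `|h| ^+ 2 = K1 * `|h| * (`|h| / r) by field; rewrite gt_eqF.
rewrite 2!mulrDl E1 E2.
have I1 : B - V p + 1 <= C * (`|h| / r) ^+ 2.
  apply: (le_trans (ler_norm _)); rewrite -/C.
  by apply: ler_peMr; [exact: normr_ge0|exact: (le_trans h1 hh)].
have I2 : K1 * `|h| <= K1 * `|h| * (`|h| / r) by apply: ler_peMr => //; exact: mulr_ge0.
have I3 : 0 <= K2 * `|h| ^+ 2 by apply: mulr_ge0 => //; exact: exprn_ge0.
move: I1 I2 I3 D1 Vs; move: (C * (`|h| / r) ^+ 2) (K1 * `|h| * (`|h| / r)) (K2 * `|h| ^+ 2).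
move: (K1 * `|h|).
by move=> a b c f; move: ('D_h V s) => D; lra.
Qed.

Section smooth_potential.
Context {R : realType} {n : nat} (V : 'rV[R]_n -> R).
Local Notation E := 'rV[R]_n.
Hypothesis V_smooth : smooth V.

Lemma TC_potential k : TC k setT V.
Proof. by apply: TC_of_Ck; [exact: openT|exact: V_smooth]. Qed.

Lemma TC_grad k : TC k setT (grad V).
Proof.
apply: TC_row; first exact: openT.
move=> i; apply: TC_of_Ck; first exact: openT.
by have [_] := V_smooth k.+1; apply.
Qed.

Lemma grad_continuous : continuous (grad V).
Proof. by move=> x; apply: (TC_cont (TC_grad 0)). Qed.

End smooth_potential.

(** * The boundary value problem *)

Section boundary_value_problem.
Context {R : realType} {n : nat} (V : 'rV[R]_n -> R).
Local Notation E := 'rV[R]_n.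
Local Notation Y := (C01 E).
Local Notation P := (E * E * R)%type.
Hypothesis V_smooth : smooth V.
Implicit Types U : normedModType R.

Lemma cst01_subproof (v : E) : continuous (fun _ : R => v).
Proof. by move=> t; exact: cvg_cst. Qed.
Definition cst01 (v : E) : Y := toC01 (@cst01_subproof v).

Lemma ramp01_subproof (v : E) : continuous (fun t : R => t *: v).
Proof. by move=> t; apply: cvgZr_tmp; exact: cvg_id. Qed.
Definition ramp01 (v : E) : Y := toC01 (@ramp01_subproof v).

Lemma cst01E v t : cst01 v t = v. Proof. by []. Qed.
Lemma ramp01E v t : 0 <= t <= 1 -> ramp01 v t = t *: v.
Proof. by move=> t01; rewrite toC01E. Qed.

Lemma cst01_linear : linear cst01.
Proof. by move=> a u v; apply: c01P => t _. Qed.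
Lemma ramp01_linear : linear ramp01.
Proof.
move=> a u v; apply: c01P => t t01; rewrite c01D c01Z !ramp01E//.
by rewrite scalerDr !scalerA mulrC.
Qed.
Lemma cst01_continuous : continuous cst01.
Proof.
apply: (@bounded_linear_continuous' _ _ _ _ 1); first exact: cst01_linear.
by move=> v; rewrite mul1r; apply: c01_ler.
Qed.
Lemma ramp01_continuous : continuous ramp01.
Proof.
apply: (@bounded_linear_continuous' _ _ _ _ 1); first exact: ramp01_linear.
move=> v; rewrite mul1r; apply: c01_ler => t t01; rewrite ramp01E// normrZ.
by case/andP: t01 => t0 t1; rewrite ger0_norm// ler_piMl.
Qed.

Lemma TC_cst01 k U (A : set U) (f : U -> E) : open A ->
  TC k A f -> TC k A (fun x => cst01 (f x)).
Proof. by move=> Ao; apply: TC_clin => //; [exact: cst01_linear|exact: cst01_continuous]. Qed.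
Lemma TC_ramp01 k U (A : set U) (f : U -> E) : open A ->
  TC k A f -> TC k A (fun x => ramp01 (f x)).
Proof. by move=> Ao; apply: TC_clin => //; [exact: ramp01_linear|exact: ramp01_continuous]. Qed.
Lemma TC_J k U (A : set U) (f : U -> Y) : open A ->
  TC k A f -> TC k A (fun x => J (f x)).
Proof. by move=> Ao; apply: TC_clin => //; [exact: J_linear|exact: J_continuous]. Qed.
Lemma TC_ev k U (A : set U) (W : normedModType R) (f : U -> C01 W) (t : R) :
  open A -> TC k A f -> TC k A (fun x => f x t).
Proof.
move=> Ao; apply: (@TC_clin _ k _ _ _ A f (fun y : C01 W => y t)) => //.
exact: c01_ev_continuous.
Qed.

Definition force : Y -> Y := nem (grad_continuous V_smooth).

Lemma TC_force k (U : normedModType R) (A : set U) (f : U -> Y) : open A ->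
  TC k A f -> TC k A (fun x => force (f x)).
Proof.
move=> Ao Cf; apply: (@TC_comp _ _ _ _ _ A setT f force) => //.
by apply: nem_TC; exact: TC_grad.
Qed.

Definition line (z : E * E) : Y := cst01 z.1 + ramp01 (z.2 - z.1).

Lemma lineE z t : 0 <= t <= 1 -> line z t = z.1 + t *: (z.2 - z.1).
Proof. by move=> t01; rewrite /line c01D cst01E ramp01E. Qed.

(* [green f] is the solution of [h'' = - f] vanishing at [0] and [1]. *)
Definition green (f : Y) : Y := ramp01 (J (J f) 1) - J (J f).

Definition bvp (z : P * Y) : Y := line z.1.1 + z.1.2 *: green (force z.2).

(** The time derivative of [bvp z], given by a formula that does not differentiate the path [z.2],
    so it makes sense for a merely continuous one. *)
Definition bvp_velocity (z : P * Y) : Y :=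
  cst01 (z.1.1.2 - z.1.1.1) +
  z.1.2 *: (cst01 (J (J (force z.2)) 1) - J (force z.2)).

Lemma TC_fstf k (U V' W : normedModType R) (A : set U) (f : U -> V' * W) :
  open A -> TC k A f -> TC k A (fun x => (f x).1).
Proof.
move=> Ao; apply: (@TC_clin _ k _ _ _ A f fst) => //.
by move=> z; exact: cvg_fst.
Qed.

Lemma TC_sndf k (U V' W : normedModType R) (A : set U) (f : U -> V' * W) :
  open A -> TC k A f -> TC k A (fun x => (f x).2).
Proof.
move=> Ao; apply: (@TC_clin _ k _ _ _ A f snd) => //.
by move=> z; exact: cvg_snd.
Qed.

Lemma TC_line k U (A : set U) (f : U -> E * E) : open A ->
  TC k A f -> TC k A (fun x => line (f x)).
Proof.
move=> Ao Cf; apply: TC_add => //.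
  by apply: TC_cst01 => //; exact: TC_fstf.
by apply: TC_ramp01 => //; apply: TC_subr => //; [exact: TC_sndf|exact: TC_fstf].
Qed.

Lemma TC_green k U (A : set U) (f : U -> Y) : open A ->
  TC k A f -> TC k A (fun x => green (f x)).
Proof.
move=> Ao Cf; apply: TC_subr => //; last by do 2!apply: TC_J => //.
by apply: TC_ramp01 => //; apply: TC_ev => //; do 2!apply: TC_J => //.
Qed.

Lemma TC_bvp k U (A : set U) (f : U -> P * Y) : open A ->
  TC k A f -> TC k A (fun x => bvp (f x)).
Proof.
move=> Ao Cf; have C1 : TC k A (fun x => (f x).1) by exact: TC_fstf.
have CF : TC k A (fun x => force (f x).2) by apply: TC_force => //; exact: TC_sndf.
apply: TC_add => //; first by apply: TC_line => //; exact: TC_fstf.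
by apply: TC_scale => //; [exact: TC_sndf|exact: TC_green].
Qed.

Lemma TC_bvp_velocity k U (A : set U) (f : U -> P * Y) : open A ->
  TC k A f -> TC k A (fun x => bvp_velocity (f x)).
Proof.
move=> Ao Cf; have C1 : TC k A (fun x => (f x).1) by exact: TC_fstf.
have C2 : TC k A (fun x => (f x).1.1) by exact: TC_fstf.
have CF : TC k A (fun x => force (f x).2) by apply: TC_force => //; exact: TC_sndf.
apply: TC_add => //.
  by apply: TC_cst01 => //; apply: TC_subr => //; [exact: TC_sndf|exact: TC_fstf].
apply: TC_scale => //; first exact: TC_sndf.
apply: TC_subr => //; last by apply: TC_J.
by apply: TC_cst01 => //; apply: TC_ev => //; do 2!apply: TC_J => //.
Qed.

Lemma bvp0 z y : bvp ((z, 0), y) = line z.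
Proof. by rewrite /bvp/= scale0r addr0. Qed.

(** The path enters only through the term with the factor eps, and |eps| <= 1 / (2 (K + 1)) turns
    the local Lipschitz constant [K] into 1/2. *)
Lemma bvp_lipschitz (z0 : E * E) : exists2 d : R, 0 < d &
  forall p y y', `|p - (z0, 0)| < d -> `|y - line z0| < d ->
    `|y' - line z0| < d -> `|bvp (p, y) - bvp (p, y')| <= 2^-1 * `|y - y'|.
Proof.
have CG k : TC k setT (fun y => green (force y)).
  have oT : open [set: Y] by exact: openT.
  by apply: TC_green => //; apply: TC_force => //; exact: TC_id.
have [d d0 [K K0 HK]] := TC1_lipschitz openT (I : setT (line z0)) (CG 1%N).
have K1 : 0 < 2 * (K + 1) by rewrite mulr_gt0// ltr_wpDl.
exists (Num.min d (2 * (K + 1))^-1); first by rewrite lt_min d0 invr_gt0.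
set m := Num.min _ _; have md : m <= d by rewrite ge_min lexx.
have mK : m <= (2 * (K + 1))^-1 by rewrite ge_min lexx orbT.
move=> p y y' pm ym y'm.
have [_ _ HH] := HK y y' (lt_le_trans ym md) (lt_le_trans y'm md).
have pK := lt_le_trans pm mK.
rewrite /bvp/= opprD addrACA subrr add0r -scalerBr normrZ.
have pe : `|p.2| <= (2 * (K + 1))^-1.
  apply: le_trans (ltW pK); rewrite prod_normE/= le_max; apply/orP; right.
  by rewrite subr0.
apply: (le_trans (ler_pM _ _ pe HH)) => //; rewrite mulrA ler_wpM2r//.
by rewrite invfM -mulrA ler_piMr// mulrC ler_pdivrMr ?mul1r ?lerDl// ltr_wpDl.
Qed.

(** The thirds leave room for the Picard iterates started at [line p.1]: they stay within 2 d / 3 of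
    the solution, hence in the ball where [bvp] contracts. *)
Lemma bvp_local_solution (z0 : E * E) : exists d : R, exists X : P -> Y,
  [/\ 0 < d,
   forall p y y', `|p - (z0, 0)| < d -> `|y - line z0| < d ->
    `|y' - line z0| < d -> `|bvp (p, y) - bvp (p, y')| <= 2^-1 * `|y - y'|,
   exists2 d' : R, 0 < d' & forall p, `|p - (z0, 0)| < d' ->
     [/\ `|p - (z0, 0)| < d, `|X p - line z0| < d / 3,
         `|line p.1 - line z0| < d / 3 & bvp (p, X p) = X p] &
   exists2 d' : R, 0 < d' &
     forall k, TC k [set p | `|p - (z0, 0)| < d'] X].
Proof.
have Yc : cauchy_complete Y by apply: c01_complete; exact: rV_complete.
have [d d0 Hl] := bvp_lipschitz z0.
have oT : open [set: P * Y] by exact: openT.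
have CB k : TC k setT bvp by apply: TC_bvp => //; exact: TC_id.
have Bc : continuous bvp by move=> z; apply: (TC_cont (CB 0)).
have [d1 d10 [X HX]] := @local_fixpoint R P Y bvp (z0, 0) (line z0) d
  Yc d0 (bvp0 z0 (line z0)) Hl (Bc _).
pose p0 : P := (z0, 0).
pose A := [set p : P | `|p - p0| < d1].
have Aball : A = ball p0 d1.
  by apply/seteqP; split => p; rewrite -ball_normE/= distrC.
have Ao : open A by rewrite Aball; exact: ball_open.
pose B := [set z : P * Y | `|z.1 - p0| < d /\ `|z.2 - line z0| < d].
have Bo : open B.
  have -> : B = ball p0 d `*` ball (line z0) d.
    by apply/seteqP; split => -[p y]; rewrite /B -!ball_normE/= !(distrC p0) !(distrC (line z0)).
  by apply: open_prod; exact: ball_open.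
have CX k : TC k A X.
  apply: (@fixpoint_TC _ k P Y A B bvp X Yc Ao Bo).
  - by move=> p /HX[].
  - by move=> p /HX[].
  - by move=> p y z _ [pd yd] [_ zd]; exact: (Hl p y z pd yd zd).
  - exact: (@TC_sub R k _ _ B setT bvp (@subsetT _ B) (CB k)).
have A0 : A p0 by rewrite /A/= subrr normr0.
have X0 : X p0 = line z0 by have [_ _ <-] := HX p0 A0; rewrite bvp0.
have d3 : 0 < d / 3 by rewrite divr_gt0.
have Xc : {for p0, continuous X} by exact: (TC_cont (CX 0)).
have lc : {for p0, continuous (fun p : P => line p.1)}.
  have Cl : TC 0 setT (fun p : P => line p.1).
    by apply: TC_line; [exact: openT|apply: TC_fstf; [exact: openT|exact: TC_id]].
  exact: (TC_cont Cl).
have := Xc => /cvgrPdist_lt /(_ _ d3) /nbhs_normP[d2 /= d20 H2].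
have := lc => /cvgrPdist_lt /(_ _ d3) /nbhs_normP[d4 /= d40 H4].
exists d, X; split=> //; last by exists d1.
exists (Num.min d1 (Num.min d2 d4)); first by rewrite !lt_min d10 d20.
set m := Num.min d1 _; have m1 : m <= d1 by rewrite ge_min lexx.
have m2 : m <= d2 by rewrite !ge_min lexx orbT.
have m4 : m <= d4 by rewrite !ge_min lexx !orbT.
move=> p pm; have pd1 := lt_le_trans pm m1.
have pd2 := lt_le_trans pm m2; have pd4 := lt_le_trans pm m4.
have [pd _ XE] := HX p pd1; split=> //.
- by rewrite distrC -X0; apply: H2; rewrite /= distrC.
- by rewrite distrC; apply: (H4 p); rewrite /= distrC.
Qed.

End boundary_value_problem.

(** * Minimality of the solutions *)

Section action_lower_bound.
Context {R : realType} {n : nat}.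
Local Notation E := 'rV[R]_n.
Local Notation Y := (C01 E).
Local Notation P := (E * E * R)%type.
Local Notation mu := lebesgue_measure.

Lemma is_derive_clin (W W' : normedModType R) (L : W -> W') (u : R -> W)
    (t : R) (du : W) : linear L -> continuous L ->
  is_derive t (1 : R) u du -> is_derive t (1 : R) (fun s => L (u s)) (L du).
Proof.
move=> Ll Lc [dU DU]; have [dL DL] := @differentiable_linear _ _ _ L (u t) Ll Lc.
have du' : differentiable u t by exact/derivable1_diffP.
apply: DeriveDef; last by rewrite (derive_comp _ du' dL) DL DU.
by apply: diff_derivable; exact: differentiable_comp.
Qed.

Lemma is_derive_coord (u : R -> E) (t : R) (du : E) (i : 'I_n) :
  is_derive t (1 : R) u du -> is_derive t (1 : R) (fun s => u s 0 i) (du 0 i).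
Proof.
apply: (@is_derive_clin _ _ (fun v : E => v 0 i)).
  by move=> a v w; rewrite !mxE.
exact: coord_continuous.
Qed.

Lemma is_derive_dot (u v : R -> E) (t : R) (du dv : E) :
  is_derive t (1 : R) u du -> is_derive t (1 : R) v dv ->
  is_derive t (1 : R) (fun s => dot (u s) (v s)) (dot du (v t) + dot (u t) dv).
Proof.
move=> Hu Hv.
have H i : is_derive t (1 : R) (fun s => u s 0 i * v s 0 i)
    (du 0 i * v t 0 i + u t 0 i * dv 0 i).
  have := is_deriveM (is_derive_coord i Hu) (is_derive_coord i Hv).
  move=> h; apply: is_derive_eq h _.
  by rewrite /GRing.scale/= addrC mulrC.
have := is_derive_sum H.
rewrite (_ : \sum_(i < n) _ = fun s => dot (u s) (v s)); last first.
  by apply/funext => s; rewrite fct_sumE.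
by move=> h; apply: is_derive_eq h _; rewrite big_split.
Qed.

Lemma prim_eq01 (f g : R -> E) : continuous f -> continuous g ->
  (forall t, 0 <= t <= 1 -> f t = g t) ->
  forall t, 0 <= t <= 1 -> prim f t = prim g t.
Proof.
move=> /primP[f0 fP] /primP[g0 gP] fg t /andP[t0 t1].
have := @derive_const_segment _ _ (prim f) (prim g) 0 t.
rewrite f0 g0 !subr0; apply => s /andP[s0 s1].
exists (f (0 + s * t)); split; first exact: fP.
rewrite fg; first exact: gP.
by rewrite add0r mulr_ge0//= mulr_ile1.
Qed.

Lemma J_prim (f : R -> E) (u : Y) : continuous f ->
  (forall t, 0 <= t <= 1 -> u t = f t) ->
  forall t, 0 <= t <= 1 -> J u t = prim f t.
Proof.
move=> fc uf t t01; rewrite JE//; apply: prim_eq01 => //.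
exact: c01_continuous.
Qed.

(* The solution of [z'' = - e f] with [z 0 = x] and [z 1 = y], on the whole
   line. *)
Definition curve (p : P) (f : R -> E) (t : R) : E :=
  p.1.1 + t *: (p.1.2 - p.1.1) + p.2 *: (t *: prim (prim f) 1 - prim (prim f) t).

Definition curve_velocity (p : P) (f : R -> E) (t : R) : E :=
  (p.1.2 - p.1.1) + p.2 *: (prim (prim f) 1 - prim f t).

Lemma is_derive_scale (v : E) (t : R) :
  is_derive t (1 : R) (fun s : R => s *: v) v.
Proof.
rewrite -[X in is_derive _ _ _ X]scale1r.
apply: (@is_derive_clin _ _ (fun s : R => s *: v) id).
- by move=> a u w; rewrite scalerDl scalerA.
- by move=> s; apply: cvgZr_tmp; exact: cvg_id.
Qed.

Lemma curve_is_prim p f : continuous f -> is_prim (curve_velocity p f) (curve p f).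
Proof.
move=> fc t; have pc := prim_continuous fc.
have [_ /(_ t) H2] := primP pc.
have D1 := is_derive_scale (p.1.2 - p.1.1) t.
have D2 := is_derive_scale (prim (prim f) 1) t.
have D3 := is_deriveZ p.2 (is_deriveB D2 H2).
have D4 := is_deriveD (is_deriveD (is_derive_cst p.1.1 t (1 : R)) D1) D3.
by apply: is_derive_eq D4 _; rewrite add0r.
Qed.

Lemma curve_velocity_is_prim p f : continuous f ->
  is_prim (fun t => - (p.2 *: f t)) (curve_velocity p f).
Proof.
move=> fc t; have [_ /(_ t) H1] := primP fc.
have D3 := is_deriveZ p.2 (is_deriveB (is_derive_cst (prim (prim f) 1) t (1 : R)) H1).
have D4 := is_deriveD (is_derive_cst (p.1.2 - p.1.1) t (1 : R)) D3.
by apply: is_derive_eq D4 _; rewrite add0r sub0r scalerN.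
Qed.

Lemma curve0 p f : continuous f -> curve p f 0 = p.1.1.
Proof.
move=> fc; have [H0 _] := primP (prim_continuous fc).
by rewrite /curve !scale0r H0 subrr scaler0 !addr0.
Qed.

Lemma curve1 p f : curve p f 1 = p.1.2.
Proof. by rewrite /curve !scale1r subrr scaler0 addr0 addrC subrK. Qed.

Variable V : E -> R.
Hypothesis V_smooth : smooth V.

(** Links the space of the fixed points to the curves on the whole line over which the cost is an
    infimum; [w] may be any continuous curve that agrees with [u] on [0, 1]. *)
Lemma bvp_curve (p : P) (w : R -> E) (u : Y) : continuous w ->
  (forall t, 0 <= t <= 1 -> u t = w t) -> forall t, 0 <= t <= 1 ->
  bvp V_smooth (p, u) t = curve p (fun s => grad V (w s)) t.
Proof.
move=> wc uw t t01.
have fc : continuous (fun s => grad V (w s)).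
  by move=> s; apply: continuous_comp; [exact: wc|exact: grad_continuous].
have uf s : 0 <= s <= 1 -> force V_smooth u s = grad V (w s).
  by move=> s01; rewrite nemE uw.
have H1 := J_prim fc uf; have H2 := J_prim (prim_continuous fc) H1.
have one01 : 0 <= (1 : R) <= 1 by rewrite ler01 lexx.
rewrite /bvp c01D c01Z lineE// /green c01B ramp01E//.
by rewrite /curve (H2 1 one01) (H2 t t01).
Qed.

Lemma bvp_velocity_curve (p : P) (w : R -> E) (u : Y) : continuous w ->
  (forall t, 0 <= t <= 1 -> u t = w t) -> forall t, 0 <= t <= 1 ->
  bvp_velocity V_smooth (p, u) t = curve_velocity p (fun s => grad V (w s)) t.
Proof.
move=> wc uw t t01.
have fc : continuous (fun s => grad V (w s)).
  by move=> s; apply: continuous_comp; [exact: wc|exact: grad_continuous].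
have uf s : 0 <= s <= 1 -> force V_smooth u s = grad V (w s).
  by move=> s01; rewrite nemE uw.
have H1 := J_prim fc uf; have H2 := J_prim (prim_continuous fc) H1.
have one01 : 0 <= (1 : R) <= 1 by rewrite ler01 lexx.
rewrite /bvp_velocity c01D c01Z c01B !cst01E.
by rewrite /curve_velocity (H2 1 one01) (H1 t t01).
Qed.

Lemma TC_lagrangian k (U : normedModType R) (A : set U) (e : R)
    (f g : U -> E) : open A ->
  TC k A f -> TC k A g -> TC k A (fun x => lagrangian V e (f x) (g x)).
Proof.
move=> Ao Cf Cg; rewrite /lagrangian; apply: TC_subr => //.
  apply: TC_mul => //; first exact: TC_cst.
  by under eq_fun do rewrite sqr_enorm; exact: TC_dot.
apply: TC_mul => //; first exact: TC_cst.
by apply: (@TC_comp _ _ _ _ _ A setT f V) => //; exact: TC_potential.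
Qed.

Lemma lagrangian_continuous (e : R) (f g : R -> E) : continuous f ->
  continuous g -> continuous (fun t => lagrangian V e (f t) (g t)).
Proof.
move=> fc gc t; apply: (@TC_lagrangian 0 _ setT e f g openT _ _ t I).
  by move=> s _; exact: fc.
by move=> s _; exact: gc.
Qed.

Definition action (e : R) (u v : R -> E) : R :=
  \int[mu]_(t in `[0, 1]) lagrangian V e (u t) (v t).

Lemma eq_action e (u v u' v' : R -> E) :
  (forall t, 0 <= t <= 1 -> u t = u' t) -> (forall t, 0 <= t <= 1 -> v t = v' t) ->
  action e u v = action e u' v'.
Proof.
move=> uu vv; apply: eq_Rintegral => t; rewrite inE/= in_itv/= => t01.
by rewrite uu// vv.
Qed.

(* Calibration: [S t = <z', h> + (1/2 - t) |h|^2 / 2] with [h = g - z] satisfies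
   [L (g, g') >= L (z, z') + S'] pointwise. *)
Lemma action_lower_bound (p : P) (f g g' : R -> E) (M : R) : continuous f ->
  continuous g' -> is_prim g' g -> 0 <= p.2 -> p.2 * M <= 4^-1 ->
  (forall t q, 0 <= t <= 1 -> V q <= V (curve p f t) +
     dot (f t) (q - curve p f t) + M * dot (q - curve p f t) (q - curve p f t)) ->
  action p.2 (curve p f) (curve_velocity p f) +
    dot (curve_velocity p f 1) (g 1 - p.1.2) -
    dot (curve_velocity p f 0) (g 0 - p.1.1) -
    4^-1 * (dot (g 1 - p.1.2) (g 1 - p.1.2) + dot (g 0 - p.1.1) (g 0 - p.1.1))
  <= action p.2 g g'.
Proof.
move=> fc g'c gP e0 eM VM.
set z := curve p f; set z' := curve_velocity p f; set e := p.2.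
have zP : is_prim z' z by exact: curve_is_prim.
have z'P : is_prim (fun t => - (e *: f t)) z' by exact: curve_velocity_is_prim.
have zc := is_prim_continuous zP; have z'c := is_prim_continuous z'P.
have gc := is_prim_continuous gP.
pose h t := g t - z t; pose h' t := g' t - z' t.
have hP : is_prim h' h by move=> t; exact: is_deriveB.
(* The slope of the weight contributes -|h|^2 / 2 to [S']. This pays for the eps-term, at most |h|^2
   / 4, and with |h'|^2 / 2 for the cross term, at most (|h|^2 + |h'|^2) / 4. The end values 1/4 and
   -1/4 of the weight are the source of the constant in the conclusion. *)
pose S t : R := dot (z' t) (h t) + (4^-1 - 2^-1 * t) * dot (h t) (h t).
pose S' t : R := dot (- (e *: f t)) (h t) + dot (z' t) (h' t) +
  ((4^-1 - 2^-1 * t) * (dot (h' t) (h t) + dot (h t) (h' t))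
   - 2^-1 * dot (h t) (h t)).
have SP : is_prim S' S.
  move=> t; have D1 := is_derive_dot (z'P t) (hP t).
  have D2 := is_derive_dot (hP t) (hP t).
  have D3 : is_derive t (1 : R) (fun t : R => 4^-1 - 2^-1 * t) (- 2^-1 : R).
    have := is_deriveB (is_derive_cst (4^-1 : R) t (1 : R))
      (is_deriveZ (2^-1 : R) (is_derive_id t (1 : R))).
    by move=> H; apply: is_derive_eq H _; rewrite sub0r /GRing.scale/= mulr1.
  apply: is_derive_eq (is_deriveD D1 (is_deriveM D3 D2)) _.
  by rewrite /S' /GRing.scale/= mulrN [X in _ - X]mulrC.
have h'c : continuous h' by move=> t; apply: cvgB; [exact: g'c|exact: z'c].
have hc := is_prim_continuous hP.
have dotc (u v : R -> E) : continuous u -> continuous v ->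
    continuous (fun t => dot (u t) (v t)).
  move=> uc vc t; apply: (@TC_dot _ 0 _ _ setT u v openT _ _ t I).
    by move=> s _; exact: uc.
  by move=> s _; exact: vc.
have S'c : continuous S'.
  have cD (u v : R -> R) : continuous u -> continuous v ->
      continuous (fun t => u t + v t).
    by move=> uc vc t; apply: cvgD; [exact: uc|exact: vc].
  have cM (u v : R -> R) : continuous u -> continuous v ->
      continuous (fun t => u t * v t).
    by move=> uc vc t; apply: cvgM; [exact: uc|exact: vc].
  have cN (u : R -> R) : continuous u -> continuous (fun t => - u t).
    by move=> uc t; apply: cvgN; exact: uc.
  have cc (a : R) : continuous (fun _ : R => a) by move=> t; exact: cvg_cst.
  have ci : continuous (fun t : R => t) by move=> t; exact: cvg_id.
  have efc : continuous (fun t => - (e *: f t)).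
    by move=> s; apply: cvgN; apply: cvgZr; exact: fc.
  have A1 := dotc _ _ efc hc; have A2 := dotc _ _ z'c h'c.
  have A3 := dotc _ _ h'c hc; have A4 := dotc _ _ hc h'c.
  have A5 := dotc _ _ hc hc.
  have c1 := cD _ _ (cc 4^-1) (cN _ (cM _ _ (cc 2^-1) ci)).
  exact: (cD _ _ (cD _ _ A1 A2) (cD _ _ (cM _ _ c1 (cD _ _ A3 A4))
    (cN _ (cM _ _ (cc 2^-1) A5)))).
have Kc := lagrangian_continuous (e := e) zc z'c.
have Gc := lagrangian_continuous (e := e) gc g'c.

have key t : 0 <= t <= 1 ->
    lagrangian V e (z t) (z' t) + S' t <= lagrangian V e (g t) (g' t).
  move=> t01; have := VM t (g t) t01; rewrite -/(h t) -/z.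
  have := ler_wpM2r (dot_ge0 (h t)) eM.
  rewrite /lagrangian !sqr_enorm /S'.
  have gE : g t = z t + h t by rewrite /h addrC subrK.
  have g'E : g' t = z' t + h' t by rewrite /h' addrC subrK.
  have -> : dot (g' t) (g' t) = dot (z' t) (z' t) + 2 * dot (z' t) (h' t) +
      dot (h' t) (h' t).
    have gg (a b : E) : dot (a + b) (a + b) = dot a a + 2 * dot a b + dot b b.
      by rewrite !dotDl !dotDr (dotC b a); ring.
    by rewrite {1 2}g'E gg.
  rewrite dotNl dotZl (dotC (h' t) (h t)).
  have hh : (4^-1 - 2^-1 * t) * (dot (h t) (h' t) + dot (h t) (h' t)) <=
      4^-1 * (dot (h t) (h t) + dot (h' t) (h' t)).
    rewrite /dot -!big_split/= !mulr_sumr; apply: ler_sum => i _.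
    move: (h t 0 i) (h' t 0 i) => a b; case/andP: t01 => t0 t1.
    have : 0 <= (a - b) ^+ 2 by exact: sqr_ge0.
    have : 0 <= (a + b) ^+ 2 by exact: sqr_ge0.
    by nra.
  move=> I1 I2; have := ler_wpM2l e0 I2; rewrite -/e.
  have := dot_ge0 (h' t).
  move: hh I1; rewrite -/e !mulrDr.
  move: (V (z t)) (V (g t)) (dot (f t) (h t)) (dot (h t) (h t)) => v1 v2 a b.
  move: (dot (h' t) (h' t)) (dot (z' t) (z' t)) (dot (z' t) (h' t)) => c d k.
  by move: (dot (h t) (h' t)) => l; nra.
have : \int[mu]_(t in `[0, 1]) (lagrangian V e (z t) (z' t) + S' t) <=
    action e g g'.
  apply: le_Rintegral => //.
  - apply: continuous_integrable => t; apply: cvgD; [exact: Kc|exact: S'c].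
  - exact: continuous_integrable.
rewrite RintegralD//; [|exact: continuous_integrable|exact: continuous_integrable].
rewrite (Rintegral_is_prim S'c SP)// -/(action e z z') => H.
apply: le_trans H; rewrite /S /h /z curve1 curve0//.
rewrite mulr0 subr0 mulr1 le_eqVlt; apply/orP; left; apply/eqP.
by field.
Qed.

End action_lower_bound.

Section cost_of_solution.
Context {R : realType} {n : nat}.
Local Notation E := 'rV[R]_n.
Local Notation Y := (C01 E).
Local Notation P := (E * E * R)%type.
Local Notation mu := lebesgue_measure.

Lemma is_prim_TC (W : normedModType R) (f H : R -> W) :
  (forall k, TC k setT f) -> is_prim f H -> forall k, TC k setT H.
Proof.
move=> Cf fH; elim=> [|k IH].
  by move=> t _; exact: (is_prim_continuous fH).
split; first by move=> t _; apply/derivable1_diffP; have [] := fH t.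
have -> : (fun z : R * R => 'D_z.2 H z.1) = (fun z => z.2 *: f z.1).
  by apply/funext => -[t v] /=; have [dH DH] := fH t; rewrite derive_dir// DH.
have oT : open ([set: R] `*` [set: R]) by apply: open_prod; exact: openT.
apply: TC_scale => //.
  by apply: TC_linear => // z; exact: cvg_snd.
by apply: (@TC_fst _ _ _ _ _ _ setT f).
Qed.

Lemma smooth_is_prim (g : R -> E) : smooth g ->
  is_prim (derive1 g) g /\ continuous (derive1 g).
Proof.
move=> gs; have [dg Dg] := gs 1%N; split.
  move=> t; apply: DeriveDef; last by rewrite derive1E.
  exact: diff_derivable (dg t I).
have -> : derive1 g = (fun t => 'D_1 g t) by apply/funext => t; rewrite derive1E.
by move=> t; exact: (Dg 1 t I).
Qed.

Lemma Rintegral_c01_le (f g : C01 R) :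
  \int[mu]_(t in `[0, 1]) f t <= \int[mu]_(t in `[0, 1]) g t + `|f - g|.
Proof.
have fi := continuous_integrable 0 1 (@c01_continuous _ _ f).
have gi := continuous_integrable 0 1 (@c01_continuous _ _ g).
pose c : R := `|f - g|.
have -> : `|f - g| = \int[mu]_(t in `[0%R, 1%R]) c :> R.
  rewrite Rintegral_cst//.
  have := @lebesgue_measure_itv R `[0, 1]; rewrite /= lte_fin ltr01 => ->.
  by rewrite -EFinB subr0 mulr1.
have H : \int[mu]_(t in `[0, 1]) f t <= \int[mu]_(t in `[0, 1]) (g t + c).
  apply: le_Rintegral => //.
    apply: continuous_integrable => t.
    by apply: cvgD; [exact: c01_continuous|exact: cvg_cst].
  move=> t _; rewrite -lerBlDl; apply: le_trans (ler_norm _) _.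
  exact: (ler_c01 (f - g) t).
apply: (le_trans H); rewrite RintegralD//.
by apply: continuous_integrable => t; exact: cvg_cst.
Qed.

Variable V : E -> R.
Hypothesis V_smooth : smooth V.
Local Notation bvp := (bvp V_smooth).
Local Notation bvp_velocity := (bvp_velocity V_smooth).

Lemma TC_grad_comp (w : R -> E) : (forall k, TC k setT w) ->
  forall k, TC k setT (fun t => grad V (w t)).
Proof.
move=> Cw k; apply: (@TC_comp _ _ _ _ _ setT setT w (grad V)) => //.
  exact: openT.
exact: TC_grad.
Qed.

Lemma TC_continuous (U W : normedModType R) (f : U -> W) :
  (forall k, TC k setT f) -> continuous f.
Proof. by move=> Cf x; exact: (Cf 0%N x I). Qed.

Lemma TC_curve p (f : R -> E) : (forall k, TC k setT f) ->
  forall k, TC k setT (curve p f).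
Proof.
move=> Cf; have fc := TC_continuous Cf.
apply: is_prim_TC (curve_is_prim p fc).
apply: is_prim_TC (curve_velocity_is_prim p fc) => k.
apply: TC_opp; first exact: openT.
by apply: TC_scale => //; [exact: openT|exact: TC_cst].
Qed.

Lemma TC_affine (x v : E) k : TC k setT (fun t : R => x + t *: v).
Proof.
have oT := @openT R.
apply: TC_add => //; first exact: TC_cst.
by apply: TC_scale => //; [exact: TC_id|exact: TC_cst].
Qed.

Lemma smooth_of_TC (g : R -> E) : (forall k, TC k setT g) -> smooth g.
Proof. by move=> Cg k; apply: Ck_of_TC => //; exact: openT. Qed.

Lemma ltr_third (d : R) : 0 < d -> d / 3 < d.
Proof. by lra. Qed.

Lemma ltr_two_thirds (d x y z : R) :
  x < d / 3 -> y < d / 3 -> z <= x + y -> z < 2 * (d / 3).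
Proof. by lra. Qed.

Lemma ltr_three_thirds (d a b c D D' : R) :
  c < d / 3 -> b <= D' -> D' <= D -> D < 2 * (d / 3) -> a <= b + c -> a < d.
Proof. by lra. Qed.

(* The Picard iterates started at the segment are smooth on the whole line. *)
Lemma picard_approximation (p : P) (y0 y : Y) (d e : R) : 0 < e ->
  (forall u v, `|u - y0| < d -> `|v - y0| < d ->
     `|bvp (p, u) - bvp (p, v)| <= 2^-1 * `|u - v|) ->
  `|y - y0| < d / 3 -> `|line p.1 - y0| < d / 3 -> bvp (p, y) = y ->
  exists w : R -> E, exists u : Y, [/\ forall k, TC k setT w,
    forall t, 0 <= t <= 1 -> u t = w t & `|u - y| < e].
Proof.
move=> e0 Hl yd ld yE.
have [l0 l0E] : exists l0, l0 = line p.1 by exists (line p.1).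
rewrite -l0E in ld.
have d0 : 0 < d by have := le_lt_trans (normr_ge0 _) yd; rewrite pmulr_lgt0.
pose D := `|l0 - y|.
have Dd : D < 2 * (d / 3).
  have yd2 : `|y0 - y| < d / 3 by rewrite distrC; exact: yd.
  exact: (ltr_two_thirds ld yd2 (ler_distD y0 l0 y)).
have yd' : `|y - y0| < d := lt_trans yd (ltr_third d0).
have H N : exists w : R -> E, exists u : Y, [/\ forall k, TC k setT w,
    forall t, 0 <= t <= 1 -> u t = w t & `|u - y| <= 2^-1 ^+ N * D].
  elim: N => [|N [w [u [Cw uw uD]]]].
    exists (fun t => p.1.1 + t *: (p.1.2 - p.1.1)), l0; split.
    - by move=> k; exact: TC_affine.
    - by move=> t t01; rewrite l0E lineE.
    - by rewrite expr0 mul1r.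
  have ud : `|u - y0| < d.
    have h1 : 2^-1 ^+ N * D <= D.
      rewrite ler_piMl ?normr_ge0// exprn_ile1// ?invr_ge0//.
      by rewrite invf_le1// ler1n.
    exact: (ltr_three_thirds yd uD h1 Dd (ler_distD y u y0)).
  have wc := TC_continuous Cw.
  exists (curve p (fun t => grad V (w t))), (bvp (p, u)); split.
  - exact/TC_curve/TC_grad_comp.
  - by move=> t t01; rewrite (bvp_curve V_smooth _ wc uw).
  - rewrite -yE; apply: (le_trans (Hl u y ud yd')).
    by rewrite exprS -mulrA ler_wpM2l.
have [N HN] : exists N, 2^-1 ^+ N * D < e.
  have c0 : (fun N => 2^-1 ^+ N : R) @ \oo --> 0.
    by apply: cvg_expr; rewrite ger0_norm// invf_lt1// ltr1n.
  have D1 : 0 < e / (D + 1) by rewrite divr_gt0// ltr_wpDl// normr_ge0.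
  have := c0 => /cvgrPdist_lt /(_ _ D1) [N _ /(_ N (leqnn N))].
  rewrite sub0r normrN /= ger0_norm ?exprn_ge0// ltr_pdivlMr ?ltr_wpDl ?normr_ge0//.
  move=> H1; exists N; apply: le_lt_trans H1.
  by rewrite ler_wpM2l ?exprn_ge0// lerDl.
have [w [u [Cw uw uD]]] := H N.
by exists w, u; split => //; exact: le_lt_trans HN.
Qed.

(** The action is taken one iteration after [u], where the velocity is [bvp_velocity (p, u)]. It is
    therefore continuous in [u] for the sup norm, although an action involves derivatives. *)
Definition bvp_action (p : P) (u : Y) : R :=
  action V p.2 (bvp (p, u)) (bvp_velocity (p, u)).

Lemma bvp_action_continuous (p : P) (y : Y) (e : R) : 0 < e ->
  exists2 d : R, 0 < d & forall u, `|u - y| < d ->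
    bvp_action p u <= bvp_action p y + e.
Proof.
move=> e0.
have oE : open [set: E * E] by exact: openT.
have oY : open [set: Y] by exact: openT.
have CL k : TC k setT (fun z : E * E => lagrangian V p.2 z.1 z.2).
  apply: TC_lagrangian => //.
    by apply: TC_linear => // z; exact: cvg_fst.
  by apply: TC_linear => // z; exact: cvg_snd.
have Lc := TC_continuous CL.
pose L u := nem Lc (c01_pair (bvp (p, u)) (bvp_velocity (p, u))).
have LE u : bvp_action p u = \int[mu]_(t in `[0, 1]) L u t.
  by apply: eq_Rintegral => t _; rewrite nemE c01_pairE.
have Cpair k : TC k setT (fun u : Y => (p, u)).
  by apply: TC_pair => //; [exact: TC_cst|exact: TC_id].
have CLk k : TC k setT L.
  apply: (@TC_comp _ k _ _ _ setT setT (fun u => c01_pair (bvp (p, u))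
    (bvp_velocity (p, u))) (nem Lc)) => //; last exact: nem_TC.
  apply: (@TC_comp _ k _ _ _ setT setT (fun u => (bvp (p, u),
    bvp_velocity (p, u))) (fun z => c01_pair z.1 z.2)) => //.
    by apply: TC_pair => //; [exact: TC_bvp|exact: TC_bvp_velocity].
  by apply: TC_linear; [exact: c01_pair_linear|exact: c01_pair_continuous].
have := TC_continuous CLk (x := y) => /cvgrPdist_lt /(_ e e0).
move=> /nbhs_normP[d /= d0 Hd]; exists d => // u ud.
rewrite !LE; apply: (le_trans (Rintegral_c01_le (L u) (L y))).
rewrite lerD2l ltW// distrC; apply: (Hd u).
by change (`|y - u| < d); rewrite distrC.
Qed.

Definition admissible (e : R) (x y : E) : set R :=
  [set a : R | exists g : R -> E, [/\ smooth g, g 0 = x, g 1 = y &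
    a = action V e g (derive1 g)]].

Lemma admissible_nonempty e x y : admissible e x y !=set0.
Proof.
pose g (t : R) := x + t *: (y - x).
exists (action V e g (derive1 g)), g; split => //.
- by apply: smooth_of_TC => k; exact: TC_affine.
- by rewrite /g scale0r addr0.
- by rewrite /g scale1r addrC subrK.
Qed.

(** The calibration bounds every competitor from x' to y' below in terms of the action of the
    solution ([low]). The cost at [p] is at most that action ([up]), by approximation: the solution
    is known only in C([0, 1]), but the Picard iterates are smooth competitors. *)
Lemma cost_support (p : P) (y0 y : Y) (d M : R) :
  (forall u v, `|u - y0| < d -> `|v - y0| < d ->
     `|bvp (p, u) - bvp (p, v)| <= 2^-1 * `|u - v|) ->
  `|y - y0| < d / 3 -> `|line p.1 - y0| < d / 3 -> bvp (p, y) = y ->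
  0 <= p.2 -> p.2 * M <= 4^-1 ->
  (forall t q, 0 <= t <= 1 -> V q <= V (y t) +
     dot (grad V (y t)) (q - y t) + M * dot (q - y t) (q - y t)) ->
  forall x' y' : E,
  cost V p.2 p.1.1 p.1.2 +
    dot (bvp_velocity (p, y) 1) (y' - p.1.2) -
    dot (bvp_velocity (p, y) 0) (x' - p.1.1) -
    4^-1 * (dot (y' - p.1.2) (y' - p.1.2) + dot (x' - p.1.1) (x' - p.1.1))
  <= cost V p.2 x' y'.
Proof.
move=> Hl yd ld yE e0 eM VM.
have yc := @c01_continuous _ _ y.
pose f t := grad V (y t).
have fc : continuous f.
  by move=> s; apply: continuous_comp; [exact: yc|exact: grad_continuous].
have zE t : 0 <= t <= 1 -> y t = curve p f t.
  by move=> t01; rewrite -{1}yE (bvp_curve V_smooth _ yc).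
have vE t : 0 <= t <= 1 -> bvp_velocity (p, y) t = curve_velocity p f t.
  by move=> t01; rewrite (bvp_velocity_curve V_smooth _ yc).
have AE : bvp_action p y = action V p.2 (curve p f) (curve_velocity p f).
  by apply: eq_action => // t t01; rewrite yE zE.
have zero01 : 0 <= (0 : R) <= 1 by rewrite lexx ler01.
have one01 : 0 <= (1 : R) <= 1 by rewrite lexx ler01.
have low x' y' a : admissible p.2 x' y' a ->
    bvp_action p y + dot (bvp_velocity (p, y) 1) (y' - p.1.2) -
    dot (bvp_velocity (p, y) 0) (x' - p.1.1) -
    4^-1 * (dot (y' - p.1.2) (y' - p.1.2) + dot (x' - p.1.1) (x' - p.1.1)) <= a.
  move=> [g [gs g0 g1 ->]]; have [gP gc] := smooth_is_prim gs.
  rewrite AE (vE 1 one01) (vE 0 zero01) -g0 -g1.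
  apply: (action_lower_bound V_smooth fc gc gP e0 eM).
  by move=> t q t01; rewrite -(zE t t01); exact: (VM t q t01).
have up : cost V p.2 p.1.1 p.1.2 <= bvp_action p y.
  apply/ler_addgt0Pr => e e_gt0.
  have [d1 d10 Hd1] := bvp_action_continuous p y e_gt0.
  have [w [u [Cw uw uy]]] := picard_approximation d10 Hl yd ld yE.
  apply: le_trans (Hd1 u uy).
  have wc := TC_continuous Cw.
  pose g := fun t => grad V (w t).
  have Cg := TC_grad_comp Cw; have gc := TC_continuous Cg.
  (* The lower bound that [ge_inf] asks for is [low] at the end points themselves, where all
     correction terms vanish. *)
  apply: ge_inf.
    exists (bvp_action p y) => a /low.
    have dot0r (v : E) : dot v 0 = 0 by rewrite dotC dot0l.
    by rewrite !subrr !dot0r !addr0 mulr0 !subr0.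
  exists (curve p g); split.
  - by apply: smooth_of_TC; exact: TC_curve.
  - exact: curve0.
  - exact: curve1.
  - have -> : bvp_action p u = action V p.2 (curve p g) (curve_velocity p g).
      apply: eq_action => t t01; first by rewrite (bvp_curve V_smooth _ wc uw).
      by rewrite (bvp_velocity_curve V_smooth _ wc uw).
    have DE : derive1 (curve p g) = curve_velocity p g.
      apply/funext => t; rewrite derive1E; have [_ E1] := curve_is_prim p gc t.
      exact: E1.
    rewrite DE; reflexivity.
move=> x' y'; apply: lb_le_inf; first exact: admissible_nonempty.
move=> a /low; apply: le_trans.
exact: (lerB (lerB (lerD up (lexx _)) (lexx _)) (lexx _)).
Qed.

End cost_of_solution.

(** * The gradient of the cost *)

Section differentiability_from_support.
Context {R : realType} {n : nat}.
Local Notation E := 'rV[R]_n.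

Lemma pair_linear_dot (a b : E) :
  linear (fun h : E * E => dot b h.2 - dot a h.1).
Proof.
move=> k u v /=; rewrite !dotDr !dotZr /GRing.scale/=; ring.
Qed.

Lemma dot_continuous (b : E) : continuous (fun v : E => dot b v).
Proof.
have oT := @openT E.
move=> v; apply: (@TC_dot _ 0 _ _ setT (fun _ => b) (fun v => v) oT _ _ v I).
  exact: TC_cst.
exact: TC_id.
Qed.

(** The inequality from z to z + h bounds c(z + h) - c(z) below; the one from z + h back to z bounds
    it above, with [a] and [b] taken at z + h. Continuity of [a] and [b] closes the gap to
    o(|h|). *)
Lemma support_differentiable (c : E * E -> R) (a b : E * E -> E)
    (O : set (E * E)) : open O ->
  (forall z, O z -> {for z, continuous a}) ->
  (forall z, O z -> {for z, continuous b}) ->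
  (forall z z', O z ->
     c z + dot (b z) (z'.2 - z.2) - dot (a z) (z'.1 - z.1) -
     4^-1 * (dot (z'.2 - z.2) (z'.2 - z.2) + dot (z'.1 - z.1) (z'.1 - z.1))
     <= c z') ->
  forall z, O z -> differentiable c z /\
    forall h, 'D_h c z = dot (b z) h.2 - dot (a z) h.1.
Proof.
move=> Oo ac bc Hc z Oz.
apply: differentiable_eps; first exact: pair_linear_dot.
  move=> h; apply: cvgB.
    apply: (@continuous_comp _ _ _ snd (fun v => dot (b z) v)).
      exact: cvg_snd.
    exact: dot_continuous.
  apply: (@continuous_comp _ _ _ fst (fun v => dot (a z) v)).
    exact: cvg_fst.
  exact: dot_continuous.
move=> e e0.
(* The error is made of two oscillation terms of [a] and [b] and two quadratic ones, each at most n
   e1 |h|; four of these stay below e |h|. The summand 1 covers n = 0. *)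
pose N : R := 4 * (n%:R + 1).
have N0 : 0 < N by rewrite mulr_gt0// ltr_wpDl.
pose e1 := e / N; have e10 : 0 < e1 by rewrite divr_gt0.
have Oz' : \forall z' \near z, O z' by exact: open_nbhs_nbhs.
have /cvgrPdist_lt /(_ e1 e10) az := ac z Oz.
have /cvgrPdist_lt /(_ e1 e10) bz := bc z Oz.
have NN : \forall z' \near z, O z' /\
    (`|a z - a z'| < e1 /\ `|b z - b z'| < e1).
  exact: (filterI Oz' (filterI az bz)).
move: NN => /nbhs_normP[d /= d0 Hd].
apply/nbhs_norm0P; exists (Num.min d e1); first by rewrite /= lt_min d0.
move=> h; rewrite /= lt_min => /andP[hd he1].
have [Oh [ah bh]] : O (h + z) /\ (`|a z - a (h + z)| < e1 /\ `|b z - b (h + z)| < e1).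
  by apply: Hd; rewrite /= opprD addrCA subrr addr0 normrN.
have := Hc z (h + z) Oz; have := Hc (h + z) z Oh.
have E1 : (h + z).1 - z.1 = h.1 by rewrite /= addrK.
have E2 : (h + z).2 - z.2 = h.2 by rewrite /= addrK.
have E3 : z.1 - (h + z).1 = - h.1 by rewrite -E1 opprB.
have E4 : z.2 - (h + z).2 = - h.2 by rewrite -E2 opprB.
rewrite E1 E2 E3 E4 !dotNr !dotNl !opprK.
have h1 : `|h.1| <= `|h| by rewrite prod_normE le_max lexx.
have h2 : `|h.2| <= `|h| by rewrite prod_normE le_max lexx orbT.
have q1 : `|dot h.1 h.1| <= n%:R * (e1 * `|h|).
  apply: (le_trans (dot_le_norm _ _)); rewrite ler_wpM2l//.
  by rewrite ler_pM//; apply: (le_trans h1); exact: ltW.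
have q2 : `|dot h.2 h.2| <= n%:R * (e1 * `|h|).
  apply: (le_trans (dot_le_norm _ _)); rewrite ler_wpM2l//.
  by rewrite ler_pM//; apply: (le_trans h2); exact: ltW.
have q3 : `|dot (a z - a (h + z)) h.1| <= n%:R * (e1 * `|h|).
  by apply: (le_trans (dot_le_norm _ _)); rewrite ler_wpM2l// ler_pM// ltW.
have q4 : `|dot (b z - b (h + z)) h.2| <= n%:R * (e1 * `|h|).
  by apply: (le_trans (dot_le_norm _ _)); rewrite ler_wpM2l// ler_pM// ltW.
have qe : 4 * (n%:R * (e1 * `|h|)) <= e * `|h|.
  rewrite 2!mulrA ler_wpM2r// /e1 mulrCA mulrA ler_pdivrMr// ler_wpM2l//.
    exact: ltW.
  by rewrite /N ler_wpM2l// lerDl.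
move: q3 q4; rewrite !dotDl !dotNl.
have := normr_ge0 h; have n0 : 0 <= n%:R :> R by [].
move: q1 q2 qe; rewrite !ler_norml.
set k := n%:R * (e1 * `|h|); set k' := e * `|h|.
move: (c z) (c (h + z)) (dot (a z) h.1) (dot (b z) h.2) => c1 c2 a1 b1.
move: (dot (a (h + z)) h.1) (dot (b (h + z)) h.2) => a2 b2.
move: (dot h.1 h.1) (dot h.2 h.2) => d1 d2; move: k k'.
clear; move=> k k' /andP[? ?] /andP[? ?] ? _ /andP[? ?] /andP[? ?] ? ?.
by apply/andP; split; lra.
Qed.

End differentiability_from_support.

(** * Second derivatives along lines *)

Section second_derivative_along_lines.
Context {R : realType}.
Implicit Types V W : normedModType R.

Lemma is_derive_line V W (f : V -> W) (z h : V) (s : R) :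
  differentiable f (z + s *: h) ->
  is_derive s (1 : R) (fun s : R => f (z + s *: h)) ('D_h f (z + s *: h)).
Proof.
move=> df.
have dl : is_derive s (1 : R) (fun s : R => z + s *: h) h.
  have D1 : is_derive s (1 : R) (fun s : R => s *: h) h.
    rewrite -[X in is_derive _ _ _ X]scale1r.
    apply: (@is_derive_clin _ _ _ (fun s : R => s *: h) id).
    - by move=> a u w; rewrite scalerDl scalerA.
    - by move=> t; apply: cvgZr_tmp; exact: cvg_id.
  have D2 := is_deriveD (is_derive_cst z s (1 : R)) D1.
  by apply: is_derive_eq D2 _; rewrite add0r.
have dl' : differentiable (fun s : R => z + s *: h) s.
  by apply/derivable1_diffP; have [] := dl.
apply: DeriveDef.
  by apply: diff_derivable; exact: (differentiable_comp dl' df).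
by rewrite -[LHS]/('D_1 (f \o (fun s : R => z + s *: h)) s) derive_comp//; have [_ ->] := dl.
Qed.

Lemma derive1_near_eq W (f g : R -> W) (t : R) :
  (\forall s \near t, f s = g s) -> derive1 f t = derive1 g t.
Proof. by move=> fg; rewrite !derive1E; exact: near_eq_derive. Qed.

Lemma derive1n2_near_eq W (f g : R -> W) (t : R) :
  (\forall s \near t, f s = g s) -> derive1n 2 f t = derive1n 2 g t.
Proof.
move=> fg; apply: derive1_near_eq.
have := nbhs_interior fg; apply: filterS => s sfg.
by apply: derive1_near_eq; exact: sfg.
Qed.

Lemma line_near V (D : set V) (z h : V) : open D -> D z ->
  \forall s \near (0 : R), D (z + s *: h).
Proof.
move=> Do Dz.
have lc : {for (0 : R), continuous (fun s : R => z + s *: h)}.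
  by apply: cvgD; [exact: cvg_cst|apply: cvgZr_tmp; exact: cvg_id].
apply: lc; rewrite scale0r addr0; exact: open_nbhs_nbhs.
Qed.

Lemma derive1n2_line V W (D : set V) (f : V -> W) (z h : V) : open D -> D z ->
  TC 2 D f ->
  derive1n 2 (fun s : R => f (z + s *: h)) 0 =
  'D_((h, 0) : V * V) (fun w : V * V => 'D_(w.2) f w.1) (z, h).
Proof.
move=> Do Dz [df [dTf _]].
have -> : derive1n 2 (fun s : R => f (z + s *: h)) 0 =
    derive1 (fun s : R => (fun w : V * V => 'D_(w.2) f w.1) ((z, h) + s *: (h, 0))) 0.
  apply: derive1_near_eq; have := line_near h Do Dz.
  apply: filterS => s Ds; rewrite derive1E.
  have [_ ->] := is_derive_line (df _ Ds).
  by rewrite /= scaler0 addr0.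
have E0 : (z, h) + (0 : R) *: ((h, 0) : V * V) = (z, h).
  by rewrite scale0r addr0.
have dT : differentiable (fun w : V * V => 'D_(w.2) f w.1) ((z, h) + (0 : R) *: ((h, 0) : V * V)).
  by rewrite E0; apply: dTf; split.
by rewrite derive1E; have [_ ->] := is_derive_line dT; rewrite E0.
Qed.

Lemma derive1n2_linear W W' (L : W -> W') (g : R -> W) (t : R) :
  linear L -> continuous L -> TC 2 setT g ->
  derive1n 2 (fun s => L (g s)) t = L (derive1n 2 g t).
Proof.
move=> Ll Lc [dg [dTg _]].
have H (u : R -> W) s : differentiable u s -> derive1 (fun s => L (u s)) s = L (derive1 u s).
  move=> du; rewrite !derive1E.
  have Du : is_derive s (1 : R) u ('D_1 u s) by apply: DeriveDef => //; exact: diff_derivable.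
  by have [_ ->] := is_derive_clin Ll Lc Du.
rewrite /derive1n/=.
have -> : derive1 (fun s => L (g s)) = fun s => L (derive1 g s).
  by apply/funext => s; apply: H; exact: dg.
apply: H.
have -> : derive1 g = (fun w : R * R => 'D_(w.2) g w.1) \o (fun s => (s, 1)).
  by apply/funext => s; rewrite derive1E.
apply: differentiable_comp; last exact: dTg.
by apply: differentiable_pair; [exact: ex_diff|exact: differentiable_cst].
Qed.

End second_derivative_along_lines.

Lemma open_norm_ball (R : realType) (W : normedModType R) (w : W) (d : R) :
  open [set x : W | `|x - w| < d].
Proof.
rewrite (_ : mkset _ = ball w d); first exact: ball_open.
by apply/seteqP; split => x; rewrite -ball_normE/= distrC.
Qed.

Section local_gradient.
Context {R : realType} {n : nat}.
Local Notation E := 'rV[R]_n.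
Local Notation Y := (C01 E).
Local Notation P := (E * E * R)%type.
Variable V : E -> R.
Hypothesis V_smooth : smooth V.

Lemma J0 (f : Y) : J f 0 = 0.
Proof.
rewrite JE; last by rewrite lexx ler01.
by have [] := primP (@c01_continuous _ _ f).
Qed.

(** The integral over [0, 1] of (1 - t) grad V(y(t)); [rem1] is that of - t grad V(y(t)). They are
    the order-eps parts of the initial and final velocities. *)
Definition rem0 (y : Y) : E := J (J (force V_smooth y)) 1.
Definition rem1 (y : Y) : E :=
  J (J (force V_smooth y)) 1 - J (force V_smooth y) 1.

Lemma TC_rem0 k (U : normedModType R) (A : set U) (f : U -> Y) : open A ->
  TC k A f -> TC k A (fun x => rem0 (f x)).
Proof.
move=> Ao Cf; apply: TC_ev => //; apply: TC_J => //; apply: TC_J => //.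
exact: TC_force.
Qed.

Lemma TC_rem1 k (U : normedModType R) (A : set U) (f : U -> Y) : open A ->
  TC k A f -> TC k A (fun x => rem1 (f x)).
Proof.
move=> Ao Cf; apply: TC_subr => //; first exact: TC_rem0.
by apply: TC_ev => //; apply: TC_J => //; exact: TC_force.
Qed.

Lemma bvp_velocity0 (p : P) (y : Y) :
  bvp_velocity V_smooth (p, y) 0 = (p.1.2 - p.1.1) + p.2 *: rem0 y.
Proof. by rewrite /bvp_velocity c01D c01Z c01B !cst01E J0 subr0. Qed.

Lemma bvp_velocity1 (p : P) (y : Y) :
  bvp_velocity V_smooth (p, y) 1 = (p.1.2 - p.1.1) + p.2 *: rem1 y.
Proof. by rewrite /bvp_velocity c01D c01Z c01B !cst01E. Qed.

Lemma solution_in_ball (z : E * E) (y : Y) (d : R) : `|y - line z| < d / 3 ->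
  0 < d -> forall t, `|y t| <= `|line z| + d.
Proof.
move=> yd d0 t; apply: (le_trans (ler_c01 y t)).
rewrite -(subrK (line z) y) addrC; apply: (le_trans (ler_normD _ _)).
rewrite lerD2l; apply: ltW; apply: (lt_trans yd); exact: ltr_third.
Qed.

Lemma compact_norm_ball (r : R) : compact [set x : E | `|x| <= r].
Proof.
apply: bounded_closed_compact.
  exists r; split; first exact: num_real.
  by move=> M' rM x /= /le_trans; apply; exact: ltW.
apply: (@closed_comp _ _ (fun x : E => `|x|) [set t : R | t <= r]).
  by move=> x _; exact: norm_continuous.
exact: closed_le.
Qed.

(** [A] contains parameters eps <= 0, so [r0] and [r1] are smooth across eps = 0 on an open set; the
    cost is described for eps > 0 only. At eps = 0 the solution is the segment, which determines
    [r0] there. *)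
Lemma local_cost_gradient (B : R) (z0 : E * E) : (forall x, V x <= B) ->
  exists d : R, exists r0 : P -> E, exists r1 : P -> E,
  let A := [set p : P | `|p - (z0, 0)| < d] in
  [/\ 0 < d, forall k, TC k A r0, forall k, TC k A r1,
    (forall p, A p -> 0 < p.2 ->
      differentiable (fun z => cost V p.2 z.1 z.2) p.1 /\
      forall h, 'D_h (fun z => cost V p.2 z.1 z.2) p.1 =
        dot ((p.1.2 - p.1.1) + p.2 *: r1 p) h.2 -
        dot ((p.1.2 - p.1.1) + p.2 *: r0 p) h.1) &
    forall z, A (z, 0) -> r0 (z, 0) = rem0 (line z)].
Proof.
move=> VB.
have [d [X [d0 Hl [d1 d10 HX] [d2 d20 CX]]]] := bvp_local_solution V_smooth z0.
have [M M0 HM] := global_upper_taylor (@compact_norm_ball (`|line z0| + d))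
  (TC_potential V_smooth 2) VB.
have M4 : 0 < (4 * M)^-1 by rewrite invr_gt0 mulr_gt0.
pose dd := Num.min (Num.min d1 d2) (4 * M)^-1.
have dd0 : 0 < dd by rewrite !lt_min d10 d20 M4.
have dd1 : dd <= d1 by rewrite !ge_min lexx.
have dd2 : dd <= d2 by rewrite !ge_min lexx orbT.
have dd4 : dd <= (4 * M)^-1 by rewrite !ge_min lexx orbT.
pose A := [set p : P | `|p - (z0, 0)| < dd].
have Ao : open A by exact: open_norm_ball.
have CXA k : TC k A X.
  apply: TC_sub (CX k) => p pA; exact: (lt_le_trans pA dd2).
exists dd, (fun p => rem0 (X p)), (fun p => rem1 (X p)); split.
- exact: dd0.
- by move=> k; apply: TC_rem0.
- by move=> k; apply: TC_rem1.
- move=> [z e] pA e0.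
  pose O := [set z : E * E | A (z, e)].
  have ic (z' : E * E) : {for z', continuous (fun z : E * E => (z, e))}.
    have CI k : TC k setT (fun z : E * E => (z, e)).
      by apply: TC_pair; [exact: openT|exact: TC_id|exact: TC_cst].
    exact: (CI 0%N z' I).
  have Oo : open O.
    by apply: (@open_comp _ _ (fun z : E * E => (z, e)) A) => // z' _; exact: ic.
  have Ca k : TC k A (fun p : P => (p.1.2 - p.1.1) + p.2 *: rem0 (X p)).
    have Cid : TC k A (fun p : P => p) by exact: TC_id.
    have C1 : TC k A (fun p : P => p.1) by exact: TC_fstf.
    apply: TC_add => //.
      by apply: TC_subr => //; [exact: TC_sndf|exact: TC_fstf].
    by apply: TC_scale => //; [exact: TC_sndf|exact: TC_rem0].
  have Cb k : TC k A (fun p : P => (p.1.2 - p.1.1) + p.2 *: rem1 (X p)).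
    have Cid : TC k A (fun p : P => p) by exact: TC_id.
    have C1 : TC k A (fun p : P => p.1) by exact: TC_fstf.
    apply: TC_add => //.
      by apply: TC_subr => //; [exact: TC_sndf|exact: TC_fstf].
    by apply: TC_scale => //; [exact: TC_sndf|exact: TC_rem1].
  apply: (@support_differentiable _ _ (fun z : E * E => cost V e z.1 z.2)
    (fun z => (z.2 - z.1) + e *: rem0 (X (z, e)))
    (fun z => (z.2 - z.1) + e *: rem1 (X (z, e))) O Oo).
  + move=> z' Oz'; have := TC_cont (Ca 0%N) Oz'.
    by apply: (@continuous_comp _ _ _ (fun z : E * E => (z, e))); exact: ic.
  + move=> z' Oz'; have := TC_cont (Cb 0%N) Oz'.
    by apply: (@continuous_comp _ _ _ (fun z : E * E => (z, e))); exact: ic.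
  + move=> z1 z2 Oz1; have [_ Xd ld XE] := HX (z1, e) (lt_le_trans Oz1 dd1).
    have pd : `|(z1, e) - (z0, 0)| < d by have [] := HX (z1, e) (lt_le_trans Oz1 dd1).
    have eM : e * M <= 4^-1.
      have : `|e| < (4 * M)^-1.
        apply: le_lt_trans (lt_le_trans Oz1 dd4).
        by rewrite prod_normE/= subr0 le_max lexx orbT.
      rewrite gtr0_norm// => /ltW H; rewrite -ler_pdivlMr//.
      by rewrite -invfM in H *.
    have := @cost_support _ _ V V_smooth (z1, e) (line z0) (X (z1, e)) d M
      (fun u v => Hl (z1, e) u v pd) Xd ld XE (ltW e0) eM.
    rewrite bvp_velocity0 bvp_velocity1; apply.
    move=> t q t01; have yK := solution_in_ball Xd d0 t.
    have dV := (TC_potential V_smooth 1).1 (X (z1, e) t) I.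
    have := HM (X (z1, e) t) q yK; rewrite (derive_grad _ dV) => /le_trans; apply.
    by rewrite lerD2l ler_wpM2l ?(ltW M0)// sqr_norm_le_dot.
  + exact: pA.
- move=> z pA; have [pd Xd ld XE] := HX (z, 0) (lt_le_trans pA dd1).
  by rewrite -{1}XE bvp0.
Qed.

End local_gradient.

(** * The cross-curvature near eps = 0 *)

Section second_tangent.
Context {R : realType}.
Implicit Types V W : normedModType R.

Definition tangent V W (f : V -> W) (w : V * V) : W := 'D_(w.2) f w.1.

(** This is D^2 f(z)(h, h): the direction (h, 0) moves the base point and keeps the vector. Unlike
    an iterated derivative along a line, it is visibly smooth in (z, h). *)
Definition second_derivative V W (f : V -> W) (z h : V) : W :=
  'D_((h, 0) : V * V) (tangent f) (z, h).

Lemma second_derivative_line V W (D : set V) (f : V -> W) (z h : V) :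
  open D -> D z -> TC 2 D f ->
  derive1n 2 (fun s : R => f (z + s *: h)) 0 = second_derivative f z h.
Proof. exact: derive1n2_line. Qed.

Lemma TC_second_derivative V W (D : set V) (f : V -> W) : open D ->
  (forall k, TC k D f) ->
  forall k, TC k (D `*` setT) (fun zh : V * V => second_derivative f zh.1 zh.2).
Proof.
move=> Do Cf k; have [_ [_ C2]] := Cf k.+2.
have DT : open (D `*` [set: V]) by apply: open_prod => //; exact: openT.
have Cid : TC k (D `*` [set: V]) (fun w : V * V => w) by exact: TC_id.
apply: (@TC_comp _ k _ _ _ _ _ (fun w : V * V => (w, ((w.2, 0) : V * V))) _ DT _ _ C2).
  by move=> w [].
apply: TC_pair => //; apply: TC_pair => //; last exact: TC_cst.
exact: TC_sndf.
Qed.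

(** One factor b is linearity of the outer derivative in its direction. The other is linearity of
    the tangent map in its vector; it holds at points of [D], and is used through germs at s = 0. *)
Lemma second_derivativeZ V W (D : set V) (f : V -> W) (z h : V) (b : R) :
  open D -> D z -> TC 2 D f ->
  second_derivative f z (b *: h) = b ^+ 2 *: second_derivative f z h.
Proof.
move=> Do Dz Cf; have [df [dT _]] := Cf.
have dTz k : differentiable (tangent f) (z, k) by apply: dT; split.
rewrite /second_derivative.
have -> : (b *: h, 0) = b *: ((h, 0) : V * V) by congr pair; rewrite scaler0.
rewrite (deriveE _ (dTz _)) linearZ/= -(deriveE _ (dTz _)) expr2 -scalerA.
congr (_ *: _).
have T0 (u : V * V) : u = u + (0 : R) *: ((h, 0) : V * V).
  by rewrite scale0r addr0.
have DD (k : V) : is_derive (0 : R) (1 : R)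
    (fun s : R => 'D_k f (z + s *: h)) ('D_((h, 0) : V * V) (tangent f) (z, k)).
  have dk : differentiable (tangent f) ((z, k) + (0 : R) *: ((h, 0) : V * V)).
    by rewrite -T0; exact: dTz.
  have Ef : (fun s : R => tangent f ((z, k) + s *: ((h, 0) : V * V))) =
      (fun s : R => 'D_k f (z + s *: h)).
    by apply/funext => s; rewrite /tangent/= scaler0 addr0.
  by have := is_derive_line dk; rewrite -T0 Ef; exact.
have E1 : derive1 (fun s : R => 'D_(b *: h) f (z + s *: h)) 0 =
    derive1 (fun s : R => b *: 'D_h f (z + s *: h)) 0.
  apply: derive1_near_eq; have := line_near h Do Dz; apply: filterS => s Ds.
  by rewrite !(deriveE _ (df _ Ds)) linearZ.
have [_ <-] := DD (b *: h); rewrite -derive1E E1 derive1E.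
have [dh <-] := DD h; exact: deriveZ.
Qed.

End second_tangent.

Section mtw_of_expansion.
Context {R : realType} {n : nat}.
Local Notation E := 'rV[R]_n.
Local Notation P := (E * E * R)%type.
Variables (r0 r1 : P -> E) (x0 y0 : E) (d0 : R).
Let p0 : P := ((x0, y0), 0).
Let A := [set p : P | `|p - p0| < d0].
Hypothesis d0_gt0 : 0 < d0.
Hypothesis Cr0 : forall k, TC k A r0.
Hypothesis Cr1 : forall k, TC k A r1.

Let Ao : open A. Proof. exact: open_norm_ball. Qed.
Let Ap0 : A p0. Proof. by rewrite /A/= subrr normr0. Qed.

Lemma norm_triple_lt (x x' y y' : E) (e e' d : R) :
  (`|((x, y), e) - ((x', y'), e') : P| < d) =
  [&& `|x - x'| < d, `|y - y'| < d & `|e - e'| < d].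
Proof. by rewrite prod_normE/= gt_max prod_normE/= gt_max andbA. Qed.

(* The momentum at [x] of the minimizer from [x] to [y]. *)
Definition momentum (p : P) : E := (p.1.2 - p.1.1) + p.2 *: r0 p.

Lemma TC_momentum k : TC k A momentum.
Proof.
have Cid : TC k A (fun p : P => p) by exact: TC_id.
have C1 : TC k A (fun p : P => p.1) by exact: TC_fstf.
apply: TC_add => //; first by apply: TC_subr => //; [exact: TC_sndf|exact: TC_fstf].
by apply: TC_scale => //; exact: TC_sndf.
Qed.

(** As eps will be below d, the product condition gives both eps K <= 1/2, for the c-exponential and
    A1, and eps n K <= 1/2, for A2, where a scalar product costs a factor n in the sup norm. *)
Lemma expansion_bounds : exists d : R, exists K : R,
  [/\ [/\ 0 < d, d <= d0, 0 <= K & d * ((n%:R + 1) * (K + 1)) <= 2^-1],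
   (forall p p' : P, `|p - p0| < d -> `|p' - p0| < d ->
      `|r0 p - r0 p'| <= K * `|p - p'|) &
   (forall p : P, `|p - p0| < d -> forall v : P, `|'D_v r1 p| <= K * `|v|)].
Proof.
have [d1 d10 [K1 K10 H1]] := TC1_lipschitz Ao Ap0 (Cr0 1).
have [d2 d20 [K2 K20 H2]] := TC1_derive_bound Ao Ap0 (Cr1 1).
pose K := Num.max K1 K2.
have K0 : 0 <= K by rewrite le_max K10.
pose D := (n%:R + 1) * (K + 1).
have D0 : 0 < D by rewrite mulr_gt0// ltr_wpDl.
pose d := Num.min (Num.min d0 (2 * D)^-1) (Num.min d1 d2).
have dd0 : d <= d0 by rewrite !ge_min lexx.
have dD : d <= (2 * D)^-1 by rewrite !ge_min lexx orbT.
have dd1 : d <= d1 by rewrite !ge_min lexx !orbT.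
have dd2 : d <= d2 by rewrite !ge_min lexx !orbT.
exists d, K; split => //.
- split => //; first by rewrite !lt_min d0_gt0 d10 d20 invr_gt0 mulr_gt0.
  by rewrite -ler_pdivlMr// -invfM.
- move=> p p' pd pd'.
  have [_ _ H] := H1 p p' (lt_le_trans pd dd1) (lt_le_trans pd' dd1).
  by apply: (le_trans H); rewrite ler_wpM2r// le_max lexx.
- move=> p pd v; have [_ H] := H2 p (lt_le_trans pd dd2).
  by apply: (le_trans (H v)); rewrite ler_wpM2r// le_max lexx orbT.
Qed.

Let v0 : E := y0 - x0.
Let q0 : P := ((x0, v0), 0).

(* [W (x, a, e)] is the c-exponential of [a] at [x] for the cost [c_e]. *)
Lemma ex_cexp : exists d : R, exists K : R, exists d' : R, exists W : P -> E,
  [/\ [/\ 0 < d, d <= d0, 0 <= K & d * ((n%:R + 1) * (K + 1)) <= 2^-1],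
   (forall p p' : P, `|p - p0| < d -> `|p' - p0| < d ->
      `|r0 p - r0 p'| <= K * `|p - p'|),
   (forall p : P, `|p - p0| < d -> forall v : P, `|'D_v r1 p| <= K * `|v|),
   [/\ 0 < d', d' <= d & forall k, TC k [set q : P | `|q - q0| < d'] W] &
   forall q : P, `|q - q0| < d' -> `|W q - y0| < d /\
     W q = q.1.1 + q.1.2 - q.2 *: r0 ((q.1.1, W q), q.2)].
Proof.
have [d [K [[d_gt0 dd0 K0 dK] Hr0 Hr1]]] := expansion_bounds.
(* The equation (y - x) + eps r0(x, y, eps) = a, solved for the first y. *)
pose G (z : P * E) : E :=
  z.1.1.1 + z.1.1.2 - z.1.2 *: r0 ((z.1.1.1, z.2), z.1.2).
pose B := [set z : P * E | `|z.1 - q0| < d /\ `|z.2 - y0| < d].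
have Bo : open B.
  have -> : B = [set q : P | `|q - q0| < d] `*` [set y : E | `|y - y0| < d].
    by apply/seteqP; split.
  by apply: open_prod; exact: open_norm_ball.
have BA (q : P) (y : E) : `|q - q0| < d -> `|y - y0| < d ->
    `|((q.1.1, y), q.2) - p0| < d.
  case: q => [[x a] e]; rewrite /q0 /p0 !norm_triple_lt => /and3P[-> _ ->].
  by move=> ->.
have CG k : TC k B G.
  have Cid : TC k B (fun z : P * E => z) by exact: TC_id.
  have C1 : TC k B (fun z : P * E => z.1) by exact: TC_fstf.
  have C11 : TC k B (fun z : P * E => z.1.1) by exact: TC_fstf.
  have C12 : TC k B (fun z : P * E => z.1.2) by exact: TC_sndf.
  have C111 : TC k B (fun z : P * E => z.1.1.1) by exact: TC_fstf.
  have C112 : TC k B (fun z : P * E => z.1.1.2) by exact: TC_sndf.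
  have C2 : TC k B (fun z : P * E => z.2) by exact: TC_sndf.
  apply: TC_subr => //; first exact: TC_add.
  apply: TC_scale => //.
  apply: (@TC_comp _ k _ _ _ B A (fun z : P * E => ((z.1.1.1, z.2), z.1.2)) r0) => //.
    by move=> [q y] [qd yd]; exact: (lt_le_trans (BA _ _ qd yd) dd0).
  by apply: TC_pair => //; exact: TC_pair.
have dK2 : d * K <= 2^-1.
  apply: le_trans dK; rewrite ler_wpM2l ?(ltW d_gt0)//.
  rewrite -[leLHS]mul1r ler_pM//; first by rewrite lerDr.
  by rewrite lerDl.
have Gl (q : P) (y y' : E) : `|q - q0| < d -> `|y - y0| < d -> `|y' - y0| < d ->
    `|G (q, y) - G (q, y')| <= 2^-1 * `|y - y'|.
  move=> qd yd yd'; have pd := BA _ _ qd yd; have pd' := BA _ _ qd yd'.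
  rewrite /G/= opprD addrACA subrr add0r opprK addrC -scalerBr normrZ.
  have nP : `|((q.1.1, y'), q.2) - ((q.1.1, y), q.2) : P| <= `|y - y'|.
    rewrite prod_normE/= ge_max prod_normE/= ge_max !subrr !normr0 !normr_ge0.
    by rewrite distrC lexx.
  have qe : `|q.2| <= d.
    apply/ltW; apply: le_lt_trans qd; rewrite prod_normE/= subr0.
    by rewrite le_max lexx orbT.
  apply: (le_trans (ler_pM _ _ qe (Hr0 _ _ pd' pd))) => //.
  by rewrite mulrA; apply: ler_pM => //; rewrite mulr_ge0// ltW.
have Bq0 : B (q0, y0) by split; rewrite /= subrr normr0.
have G0 : G (q0, y0) = y0.
  by rewrite /G/= scale0r subr0 /v0 addrC subrK.
have Gc : {for (q0, y0), continuous G} by exact: (TC_cont (CG 0)).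
have [d1 d10 [W HW]] := @local_fixpoint R P E G q0 y0 d
  (@rV_complete R n) d_gt0 G0 Gl Gc.
pose d' := Num.min d d1.
have d'd : d' <= d by rewrite ge_min lexx.
have d'd1 : d' <= d1 by rewrite ge_min lexx orbT.
exists d, K, d', W; split => //; last first.
  move=> q qd; have [_ Wd WE] := HW q (lt_le_trans qd d'd1).
  by split => //; rewrite -[LHS]WE.
split => //; first by rewrite lt_min d_gt0.
move=> k; apply: (@fixpoint_TC _ k P E [set q : P | `|q - q0| < d'] B G W).
- exact: rV_complete.
- exact: open_norm_ball.
- exact: Bo.
- by move=> q qd; have [? ? ?] := HW q (lt_le_trans qd d'd1).
- by move=> q qd; have [? ? ?] := HW q (lt_le_trans qd d'd1).
- by move=> q y y' _ [qd yd] [_ yd']; exact: Gl.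
- exact: CG.
Qed.

End mtw_of_expansion.

(** Disposes of |u|^2 and of the acceleration term of the base curve, which are affine in s, before
    the second s-derivative of the cross-curvature is taken. *)
Lemma derive1n2_affine (R : realType) (g : R -> R) (k a c : R) :
  (\forall s \near (0 : R), derivable g s 1) -> derivable (derive1 g) 0 1 ->
  derive1n 2 (fun s => k + a * g s + s * c) 0 = a * derive1n 2 g 0.
Proof.
move=> dg ddg.
have E1 : \forall s \near (0 : R),
    derive1 (fun s => k + a * g s + s * c) s = a * derive1 g s + c.
  apply: filterS dg => s dgs.
  have Dg : is_derive s (1 : R) g (derive1 g s).
    by apply: DeriveDef; [exact: dgs|rewrite derive1E; reflexivity].
  have Did : is_derive s (1 : R) (fun s : R => s * c) c.
    have := is_deriveM (is_derive_id s (1 : R)) (is_derive_cst c s (1 : R)).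
    by move=> H; apply: is_derive_eq H _; rewrite /GRing.scale/= mulr0 add0r mulr1.
  have D := is_deriveD (is_deriveD (is_derive_cst k s (1 : R)) (is_deriveZ a Dg)) Did.
  by rewrite derive1E; have [_ ->] := D; rewrite add0r.
rewrite /derive1n/= (derive1_near_eq E1).
have Dg : is_derive (0 : R) (1 : R) (derive1 g) (derive1 (derive1 g) 0).
  by apply: DeriveDef; [exact: ddg|rewrite [in RHS]derive1E; reflexivity].
have D := is_deriveD (is_deriveZ a Dg) (is_derive_cst c (0 : R) (1 : R)).
by rewrite derive1E; have [_ ->] := D; rewrite addr0.
Qed.

Section second_tangent_line.
Context {R : realType}.

Lemma derivable_line (V : normedModType R) (D : set V) (f : V -> R) (z h : V) :
  open D -> D z -> TC 2 D f ->
  (\forall s \near (0 : R), derivable (fun s : R => f (z + s *: h)) s 1) /\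
  derivable (derive1 (fun s : R => f (z + s *: h))) 0 1.
Proof.
move=> Do Dz [df [dT _]]; split.
  have := line_near h Do Dz; apply: filterS => s Ds.
  by have [] := is_derive_line (df _ Ds).
have E0 : (z, h) + (0 : R) *: ((h, 0) : V * V) = (z, h).
  by rewrite scale0r addr0.
have dk : differentiable (fun w : V * V => 'D_(w.2) f w.1)
    ((z, h) + (0 : R) *: ((h, 0) : V * V)).
  by rewrite E0; apply: dT; split.
have [dl _] := is_derive_line dk.
apply: near_eq_derivable dl.
have := line_near h Do Dz; apply: filterS => s Ds.
rewrite /= scaler0 addr0 derive1E.
by have [_ ->] := is_derive_line (df _ Ds).
Qed.

End second_tangent_line.

(** * Positivity of the rescaled curvature near eps = 0 *)

Section curvature.
Context {R : realType} {n : nat}.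
Local Notation E := 'rV[R]_n.
Local Notation P := (E * E * R)%type.
Variables (r0 W : P -> E) (x0 y0 : E) (d0 d' : R).
Let p0 : P := ((x0, y0), 0).
Let v0 : E := y0 - x0.
Let q0 : P := ((x0, v0), 0).
Let A := [set p : P | `|p - p0| < d0].
Let A' := [set q : P | `|q - q0| < d'].
Hypothesis d'_gt0 : 0 < d'.
Hypothesis Cr0 : forall k, TC k A r0.
Hypothesis CW : forall k, TC k A' W.
Hypothesis WA : forall q, A' q -> A ((q.1.1, W q), q.2).
Hypothesis WE : forall q, A' q ->
  W q = q.1.1 + q.1.2 - q.2 *: r0 ((q.1.1, W q), q.2).
Hypothesis Hpos : forall u w : E, dot u u = 1 -> dot w w = 1 -> dot u w = 0 ->
  0 < derive1n 2 (fun s : R =>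
    dot ('D_(((u, 0), 0) : P) r0 ((x0, y0 + s *: w), 0)) u) 0.

Let A'o : open A'. Proof. exact: open_norm_ball. Qed.
Let D := A' `*` [set: E].
Let Do : open D. Proof. by apply: open_prod => //; exact: openT. Qed.
Let Aq0 : A' q0. Proof. by rewrite /A'/= subrr normr0. Qed.

(** For z = ((x, a, eps), u) this is <D_x r0 u, u> at the c-exponential of a: up to the factor -eps,
    the part of the Hessian of the cost in x that depends on a. *)
Definition curv0 (z : P * E) : R :=
  dot ('D_(((z.2, 0), 0) : P) r0 ((z.1.1.1, W z.1), z.1.2)) z.2.

(** Only a moves, along w. The cross-curvature is 3/2 eps times this quantity, which makes sense at
    eps = 0. *)
Definition curv (q : P) (u w : E) : R :=
  second_derivative curv0 (q, u) ((((0, w), 0), 0) : P * E).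

Lemma TC_curv0 k : TC k D curv0.
Proof.
have Cid : TC k D (fun z : P * E => z) by exact: TC_id.
have C1 : TC k D (fun z : P * E => z.1) by exact: TC_fstf.
have C2 : TC k D (fun z : P * E => z.2) by exact: TC_sndf.
have C11 : TC k D (fun z : P * E => z.1.1) by exact: TC_fstf.
have C111 : TC k D (fun z : P * E => z.1.1.1) by exact: TC_fstf.
have C12 : TC k D (fun z : P * E => z.1.2) by exact: TC_sndf.
have CWD : TC k D (fun z : P * E => W z.1).
  by apply: (@TC_fst _ k _ _ _ D A' W) => // z [].
apply: TC_dot => //.
have [_ Tr] := Cr0 k.+1.
apply: (@TC_comp _ k _ _ _ D (A `*` setT)
  (fun z : P * E => (((z.1.1.1, W z.1), z.1.2), (((z.2, 0), 0) : P)))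
  (fun w : P * P => 'D_(w.2) r0 w.1)) => //.
  by move=> z [Az _]; split => //; exact: WA.
apply: TC_pair => //; first by apply: TC_pair => //; exact: TC_pair.
by apply: TC_pair => //; [apply: TC_pair => //|]; exact: TC_cst.
Qed.

Lemma curv_line q u w : A' q ->
  derive1n 2 (fun s : R => curv0 ((((q.1.1, q.1.2 + s *: w), q.2), u))) 0 =
  curv q u w.
Proof.
move=> Aq; have Dq : D (q, u) by split.
rewrite /curv -(second_derivative_line _ Do Dq (TC_curv0 2)).
congr (derive1n 2 _ 0); apply/funext => s; congr curv0.
case: q {Aq Dq} => [[x a] e] /=.
by congr pair; [congr pair; [congr pair|]|]; rewrite /= ?scaler0 ?addr0.
Qed.

Lemma curv_derivable q u w : A' q ->
  (\forall s \near (0 : R), derivable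
     (fun s : R => curv0 ((((q.1.1, q.1.2 + s *: w), q.2), u))) s 1) /\
  derivable (derive1
     (fun s : R => curv0 ((((q.1.1, q.1.2 + s *: w), q.2), u)))) 0 1.
Proof.
move=> Aq; have Dq : D (q, u) by split.
have := derivable_line ((((0, w), 0), 0) : P * E) Do Dq (TC_curv0 2).
have -> : (fun s : R => curv0 ((q, u) + s *: ((((0, w), 0), 0) : P * E))) =
    (fun s : R => curv0 ((((q.1.1, q.1.2 + s *: w), q.2), u))).
  apply/funext => s; congr curv0; case: q {Aq Dq} => [[x a] e] /=.
  by congr pair; [congr pair; [congr pair|]|]; rewrite /= ?scaler0 ?addr0.
exact.
Qed.

Lemma curv_near q w : A' q ->
  \forall s \near (0 : R), A' ((q.1.1, q.1.2 + s *: w), q.2).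
Proof.
move=> Aq; have := line_near (((0, w), 0) : P) A'o Aq.
apply: filterS => s; congr A'; case: q {Aq} => [[x a] e] /=.
by congr pair; [congr pair|]; rewrite /= ?scaler0 ?addr0.
Qed.

(** Reduces positivity on orthogonal pairs to orthonormal ones. The factor in u is extracted inside
    the s-derivative, from the quadratic form; the factor in w is that of a second derivative. *)
Lemma curvZ q u w (a b : R) : A' q ->
  curv q (a *: u) (b *: w) = a ^+ 2 * b ^+ 2 * curv q u w.
Proof.
move=> Aq; have Dq v : D (q, v) by split.
have -> : curv q (a *: u) (b *: w) = b ^+ 2 * curv q (a *: u) w.
  rewrite /curv -[RHS]/(b ^+ 2 *: _).
  rewrite -(second_derivativeZ _ _ Do (Dq _) (TC_curv0 2)).
  by congr (second_derivative _ _ _); congr pair; [congr pair; [congr pair|]|];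
    rewrite /= ?scaler0.
suff -> : curv q (a *: u) w = a ^+ 2 * curv q u w by rewrite mulrCA mulrA.
rewrite -!curv_line//; have [H1 H2] := curv_derivable u w Aq.
rewrite -(@derive1n2_affine _ _ 0 (a ^+ 2) 0 H1 H2).
apply: derive1n2_near_eq; have := curv_near w Aq; apply: filterS => s As.
rewrite mulr0 addr0 add0r /curv0/=.
have dr := (Cr0 1).1 _ (WA As).
have -> : (((a *: u, 0), 0) : P) = a *: (((u, 0), 0) : P).
  by congr pair; [congr pair|]; rewrite /= ?scaler0.
rewrite !(deriveE _ dr) linearZ/= dotZl dotZr mulrA -expr2.
by [].
Qed.

Lemma curv_pos0 u w : dot u u = 1 -> dot w w = 1 -> dot u w = 0 ->
  0 < curv q0 u w.
Proof.
move=> u1 w1 uw; rewrite -(curv_line u w Aq0).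
rewrite (@derive1n2_near_eq _ _ _ (fun s : R =>
  dot ('D_(((u, 0), 0) : P) r0 ((x0, y0 + s *: w), 0)) u)).
  exact: Hpos u1 w1 uw.
have := curv_near w Aq0; apply: filterS => s As.
(* At eps = 0 the c-exponential is the translation sending a to x + a. *)
rewrite /curv0 /=; have := WE As; rewrite /= scale0r subr0 => ->.
have -> : x0 + (v0 + s *: w) = y0 + s *: w.
  by rewrite addrA /v0 (addrC x0) subrK.
reflexivity.
Qed.

Let Kc := [set z : E * E | [/\ dot z.1 z.1 = 1, dot z.2 z.2 = 1 & dot z.1 z.2 = 0]].

Lemma unit_norm_le (u : E) : dot u u = 1 -> `|u| <= 1.
Proof.
move=> u1; have := sqr_norm_le_dot u; rewrite u1.
by rewrite -[X in _ <= X](expr1n _ 2) ler_sqr// nnegrE.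
Qed.

Lemma compact_orthonormal : compact Kc.
Proof.
have cc (f g : E * E -> E) : (forall k, TC k setT f) -> (forall k, TC k setT g) ->
    forall c : R, closed [set z | dot (f z) (g z) = c].
  move=> Cf Cg c; apply: (@closed_comp _ _ (fun z => dot (f z) (g z)) [set t : R | t = c]).
    move=> z _; have oT := @openT (E * E)%type.
    by have := TC_dot oT (Cf 0%N) (Cg 0%N) => /(_ z I).
  exact: closed_eq.
have C1 k : TC k setT (@fst E E) by apply: TC_linear => // z; exact: cvg_fst.
have C2 k : TC k setT (@snd E E) by apply: TC_linear => // z; exact: cvg_snd.
have -> : Kc = [set z | dot z.1 z.1 = 1] `&`
    ([set z | dot z.2 z.2 = 1] `&` [set z | dot z.1 z.2 = 0]).
  by apply/seteqP; split => z [] // ? []; split.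
apply: (subclosed_compact _ (compact_setX (@compact_norm_ball R n 1) (@compact_norm_ball R n 1))).
  by apply: closedI; [exact: cc|apply: closedI; exact: cc].
by move=> z [z1 [z2 _]]; split; exact: unit_norm_le.
Qed.

(** Tube lemma: the curvature is jointly continuous and positive on the compact slice over q0, hence
    positive over a whole neighbourhood of q0. *)
Lemma curv_pos : exists2 d : R, 0 < d & d <= d' /\
  forall q, `|q - q0| < d -> forall u w, dot u u = 1 -> dot w w = 1 ->
    dot u w = 0 -> 0 < curv q u w.
Proof.
have := compact_orthonormal => /compact_near_coveringP cK.
pose F (zq : (E * E) * P) : R := curv zq.2 zq.1.1 zq.1.2.
pose B := [set: E * E] `*` A'.
have Bo : open B by apply: open_prod => //; exact: openT.
have CF k : TC k B F.
  have C2 := TC_second_derivative Do TC_curv0 k.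
  have Cid : TC k B (fun z : (E * E) * P => z) by exact: TC_id.
  have Cz1 : TC k B (fun z : (E * E) * P => z.1) by exact: TC_fstf.
  have Cz2 : TC k B (fun z : (E * E) * P => z.2) by exact: TC_sndf.
  have Cz11 : TC k B (fun z : (E * E) * P => z.1.1) by exact: TC_fstf.
  have Cz12 : TC k B (fun z : (E * E) * P => z.1.2) by exact: TC_sndf.
  apply: (@TC_comp _ k _ _ _ B (D `*` setT)
    (fun z : (E * E) * P => ((z.2, z.1.1), (((0, z.1.2), 0), 0) : P * E))
    (fun zh => second_derivative curv0 zh.1 zh.2)) => //.
    by move=> z [_ ?]; do 2!split.
  apply: TC_pair => //; first exact: TC_pair.
  apply: TC_pair => //; last exact: TC_cst.
  apply: TC_pair => //; last exact: TC_cst.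
  by apply: TC_pair => //; exact: TC_cst.
have : \forall q \near q0, Kc `<=` (fun k => 0 < F (k, q)).
  apply: (cK P (nbhs q0) (fun q k => 0 < F (k, q))) => k [k1 k2 k3].
  have Bk : B (k, q0) by split.
  have F0 : 0 < F (k, q0) by exact: curv_pos0.
  have Fc : {for (k, q0), continuous F} := TC_cont (CF 0%N) Bk.
  have := Fc => /cvgrPdist_lt /(_ _ F0).
  apply: filterS => -[k' q] /=.
  by rewrite ltr_distlC => /andP[+ _]; rewrite subrr.
move=> /nbhs_normP[d /= d_gt0 Hd].
exists (Num.min d d'); first by rewrite lt_min d_gt0.
split; first by rewrite ge_min lexx orbT.
move=> q qd u w u1 w1 uw; have := Hd q.
rewrite /= distrC (lt_le_trans qd) ?ge_min ?lexx// => /(_ isT) /(_ (u, w)).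
by apply; split.
Qed.

End curvature.

Section partial_derivatives.
Context {R : realType}.
Implicit Types U V W : normedModType R.

Lemma derive_partial1 U V W (f : U * V -> W) (x h : U) (y : V) :
  differentiable f (x, y) ->
  'D_h (fun x => f (x, y)) x = 'D_((h, 0) : U * V) f (x, y).
Proof.
move=> df; have did : differentiable (fun x : U => x) x by exact: ex_diff.
have dc : differentiable (fun _ : U => y) x by exact: differentiable_cst.
have dp : differentiable (fun x : U => (x, y)) x by exact: differentiable_pair.
rewrite -[LHS]/('D_h (f \o (fun x : U => (x, y))) x) derive_comp//.
by rewrite derive_pair// derive_id derive_cst.
Qed.

Lemma derive_partial2 U V W (f : U * V -> W) (x : U) (y h : V) :
  differentiable f (x, y) ->
  'D_h (fun y => f (x, y)) y = 'D_((0, h) : U * V) f (x, y).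
Proof.
move=> df; have did : differentiable (fun y : V => y) y by exact: ex_diff.
have dc : differentiable (fun _ : V => x) y by exact: differentiable_cst.
have dp : differentiable (fun y : V => (x, y)) y by exact: differentiable_pair.
rewrite -[LHS]/('D_h (f \o (fun y : V => (x, y))) y) derive_comp//.
by rewrite derive_pair// derive_id derive_cst.
Qed.

Lemma derive_dotl U n (f : U -> 'rV[R]_n) (v : 'rV[R]_n) (x h : U) :
  differentiable f x -> 'D_h (fun x => dot (f x) v) x = dot ('D_h f x) v.
Proof.
move=> df.
have ll : linear (fun w : 'rV[R]_n => dot w v).
  by move=> a u w; rewrite dotDl dotZl.
have lc : continuous (fun w : 'rV[R]_n => dot w v).
  by under eq_fun do rewrite dotC; exact: dot_continuous.
have [dl Dl] := @differentiable_linear _ _ _ _ (f x) ll lc.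
by rewrite -[LHS]/('D_h ((fun w => dot w v) \o f) x) derive_comp// Dl.
Qed.

End partial_derivatives.

(** Common ending of A1, A2 and the uniqueness of the c-exponential. *)
Lemma le_half_eq0 (R : realType) (V : normedModType R) (z : V) (a : R) :
  a <= 2^-1 -> `|z| <= a * `|z| -> z = 0.
Proof.
move=> a2 H; apply/eqP; rewrite -normr_le0.
have : a * `|z| <= 2^-1 * `|z| by rewrite ler_wpM2r.
by move: H; move: (`|z| : R) => b; lra.
Qed.

Section momentum_derivative.
Context {R : realType} {n : nat}.
Local Notation E := 'rV[R]_n.
Local Notation P := (E * E * R)%type.
Variable r : P -> E.

Lemma derive_momentum (p : P) (h : E) : differentiable r p ->
  differentiable (momentum r) p ->
  'D_(((h, 0), 0) : P) (momentum r) p = - h + p.2 *: 'D_(((h, 0), 0) : P) r p.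
Proof.
move=> dr dm.
pose k : P := ((h, 0), 0).
have pE : p + (0 : R) *: k = p by rewrite scale0r addr0.
have := @is_derive_line R P E (momentum r) p k 0; rewrite pE => /(_ dm) [_ <-].
have := @is_derive_line R P E r p k 0; rewrite pE => /(_ dr) Dr.
have -> : (fun s : R => momentum r (p + s *: k)) = (fun s : R =>
    (p.1.2 - (p.1.1 + s *: h)) + p.2 *: r (p + s *: k)).
  apply/funext => s; rewrite /momentum /k; case: p {dr dm pE Dr} => [[x y] e] /=.
  by rewrite !scaler0 !addr0.
have D1 : is_derive (0 : R) (1 : R) (fun s : R => p.1.1 + s *: h) h.
  have D := is_deriveD (is_derive_cst p.1.1 (0 : R) (1 : R)) (is_derive_scale h 0).
  by apply: is_derive_eq D _; rewrite add0r.
have D2 := is_deriveD (is_deriveB (is_derive_cst p.1.2 (0 : R) (1 : R)) D1)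
  (is_deriveZ p.2 Dr).
by have [_ ->] := D2; rewrite sub0r.
Qed.

End momentum_derivative.

(** * Conditions A0 to A3s for one small eps *)

Section conclusion.
Context {R : realType} {n : nat}.
Local Notation E := 'rV[R]_n.
Local Notation P := (E * E * R)%type.
Variables (c : E -> E -> R) (r0 r1 W : P -> E) (x0 y0 : E).
Variables (d0 d K d' d6 dl e : R).
Let p0 : P := ((x0, y0), 0).
Let v0 : E := y0 - x0.
Let q0 : P := ((x0, v0), 0).
Let A := [set p : P | `|p - p0| < d0].
Let A' := [set q : P | `|q - q0| < d'].
Let M := [set x : E | `|x - x0| < dl].
Let N := [set y : E | `|y - y0| < dl].
Hypothesis Cr0 : forall k, TC k A r0.
Hypothesis Cr1 : forall k, TC k A r1.
Hypothesis dd0 : d <= d0.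
Hypothesis K0 : 0 <= K.
Hypothesis dK : d * ((n%:R + 1) * (K + 1)) <= 2^-1.
Hypothesis Hr0 : forall p p' : P, `|p - p0| < d -> `|p' - p0| < d ->
  `|r0 p - r0 p'| <= K * `|p - p'|.
Hypothesis Hr1 : forall p : P, `|p - p0| < d ->
  forall v : P, `|'D_v r1 p| <= K * `|v|.
Hypothesis CW : forall k, TC k A' W.
Hypothesis HW : forall q : P, A' q -> `|W q - y0| < d /\
  W q = q.1.1 + q.1.2 - q.2 *: r0 ((q.1.1, W q), q.2).
Hypothesis d6d' : d6 <= d'.
Hypothesis d'd : d' <= d.
Hypothesis Hcurv : forall q, `|q - q0| < d6 -> forall u w : E, dot u u = 1 ->
  dot w w = 1 -> dot u w = 0 -> 0 < curv r0 W q u w.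
Hypothesis dld6 : dl <= d6.
Hypothesis Hdl : forall p, `|p - p0| < dl -> `|momentum r0 p - v0| < d6.
Hypothesis e_gt0 : 0 < e.
Hypothesis e_dl : e < dl.
Hypothesis Hc : forall p, A p -> p.2 = e ->
  differentiable (fun z => c z.1 z.2) p.1 /\
  forall h, 'D_h (fun z => c z.1 z.2) p.1 =
    dot (momentum r1 p) h.2 - dot (momentum r0 p) h.1.

Let dld : dl <= d. Proof. exact: le_trans dld6 (le_trans d6d' d'd). Qed.
Let Ao : open A. Proof. exact: open_norm_ball. Qed.
Let Mo : open M. Proof. exact: open_norm_ball. Qed.
Let No : open N. Proof. exact: open_norm_ball. Qed.

Let edl : `|e - 0| < dl. Proof. by rewrite subr0 gtr0_norm. Qed.

Let box x y : M x -> N y -> `|((x, y), e) - p0 : P| < dl.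
Proof. by move=> Mx Ny; rewrite norm_triple_lt; apply/and3P. Qed.

Let boxA x y : M x -> N y -> A ((x, y), e).
Proof. by move=> Mx Ny; exact: (lt_le_trans (box Mx Ny) (le_trans dld dd0)). Qed.

Let eK : e * K <= 2^-1.
Proof.
apply: le_trans dK; apply: ler_pM => //; first exact: ltW.
  by apply: ltW; apply: (lt_le_trans e_dl).
by rewrite -[leLHS]mul1r ler_pM// ?lerDl// lerDr.
Qed.

Let enK : e * (n%:R * K) <= 2^-1.
Proof.
apply: le_trans dK; apply: ler_pM => //; [exact: ltW|exact: mulr_ge0| |].
  by apply: ltW; apply: (lt_le_trans e_dl).
by rewrite ler_pM// ?lerDl// lerDr.
Qed.

Let TC_mom0 k : TC k A (momentum r0).
Proof. exact: (TC_momentum Cr0). Qed.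
Let TC_mom1 k : TC k A (momentum r1).
Proof. exact: (TC_momentum Cr1). Qed.

Lemma cost_derive x y h : M x -> N y ->
  differentiable (fun z => c z.1 z.2) (x, y) /\
  'D_h (fun z => c z.1 z.2) (x, y) =
    dot (momentum r1 ((x, y), e)) h.2 - dot (momentum r0 ((x, y), e)) h.1.
Proof.
move=> Mx Ny; have [dc Dc] := Hc (boxA Mx Ny) erefl.
by split=> //; exact: Dc.
Qed.

Lemma cost_dx x y : M x -> N y -> dx c x y = - momentum r0 ((x, y), e).
Proof.
move=> Mx Ny; apply: grad_eq_dot => v.
have [dc _] := cost_derive 0 Mx Ny.
rewrite (@derive_partial1 _ _ _ _ (fun z => c z.1 z.2))//.
have [_ ->] := cost_derive (v, 0) Mx Ny.
by rewrite /= dotC dot0l sub0r dotNl.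
Qed.

(** Only the gradient of the cost is explicit. The first layer of [Ck] is therefore
    differentiability, and the others are smoothness of the momenta. *)
Lemma cost_A0 : A0 c M N.
Proof.
have Oo : open (M `*` N) by exact: open_prod Mo No.
split; first by move=> [x y] [Mx Ny]; have [] := cost_derive 0 Mx Ny.
move=> v.
have CI k : TC k (M `*` N) (fun z : E * E => (z, e)).
  by apply: TC_pair => //; [exact: TC_id|exact: TC_cst].
have C0 k : TC k (M `*` N) (fun z : E * E => momentum r0 (z, e)).
  apply: (@TC_comp _ k _ _ _ (M `*` N) A _ (momentum r0) Oo _ (CI k)) => //.
  by move=> [x y] [Mx Ny]; exact: boxA.
have C1 k : TC k (M `*` N) (fun z : E * E => momentum r1 (z, e)).
  apply: (@TC_comp _ k _ _ _ (M `*` N) A _ (momentum r1) Oo _ (CI k)) => //.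
  by move=> [x y] [Mx Ny]; exact: boxA.
apply: (@Ck_ext _ _ _ _ (M `*` N) (fun z => dot (momentum r1 (z, e)) v.2 -
    dot (momentum r0 (z, e)) v.1) _ Oo).
  by move=> [x y] [Mx Ny]; have [_ ->] := cost_derive v Mx Ny.
apply: Ck_of_TC => //.
have CC k : TC k (M `*` N) (fun z => dot (momentum r1 (z, e)) v.2 -
    dot (momentum r0 (z, e)) v.1).
  by apply: TC_subr => //; apply: TC_dot => //; exact: TC_cst.
exact: CC.
Qed.

(** If the momenta agree, y1 - y2 is eps times a difference of values of [r0], so its norm is at
    most eps K |y1 - y2|. *)
Lemma cost_A1 : A1 c M N.
Proof.
move=> x Mx y1 y2; rewrite !inE => N1 N2; rewrite !cost_dx//.
move=> /oppr_inj; rewrite /momentum/= => H.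
apply/eqP; rewrite -subr_eq0; apply/eqP; apply: (le_half_eq0 eK).
have p1 := box Mx N1; have p2 := box Mx N2.
have zE : y1 - y2 = e *: (r0 ((x, y2), e) - r0 ((x, y1), e)).
  have : (y1 - x + e *: r0 ((x, y1), e)) - (y2 - x + e *: r0 ((x, y2), e)) = 0.
    by rewrite H subrr.
  rewrite opprD addrACA (_ : y1 - x - (y2 - x) = y1 - y2); last first.
    by rewrite opprB addrA subrK.
  by move/eqP; rewrite addr_eq0 opprB -scalerBr => /eqP.
have nz : `|y1 - y2| = e * `|r0 ((x, y2), e) - r0 ((x, y1), e)|.
  by rewrite zE normrZ (gtr0_norm e_gt0).
rewrite [X in X <= _]nz -mulrA; apply: (ler_wpM2l (ltW e_gt0)).
apply: (le_trans (Hr0 (lt_le_trans p2 dld) (lt_le_trans p1 dld))).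
apply: (ler_wpM2l K0); rewrite prod_normE/= ge_max prod_normE/= ge_max !subrr !normr0.
by rewrite !normr_ge0 distrC lexx.
Qed.

Lemma derive_mom r x y (h : E) : M x -> N y -> TC 1 A r ->
  TC 1 A (momentum r) ->
  'D_(((h, 0), 0) : P) (momentum r) ((x, y), e) =
  - h + e *: 'D_(((h, 0), 0) : P) r ((x, y), e).
Proof.
move=> Mx Ny [dr _] [dm _]; apply: derive_momentum.
  exact: (dr _ (boxA Mx Ny)).
exact: (dm _ (boxA Mx Ny)).
Qed.

(** The inner derivative is in y, so the mixed derivative is read off [r1]. Replacing the inner
    derivative by its formula needs it for all x' near x. *)
Lemma cost_dxdy x y v i : M x -> N y -> dxdy c x y v 0 i =
  - v 0 i + e * dot ('D_(((delta_mx 0 i, 0), 0) : P) r1 ((x, y), e)) v.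
Proof.
move=> Mx Ny; rewrite /dxdy /grad mxE; set h : E := delta_mx 0 i.
have dm := (TC_mom1 1).1 _ (boxA Mx Ny).
have -> : 'D_h (fun x' => 'D_v (fun y' => c x' y') y) x =
    'D_h (fun x' => dot (momentum r1 ((x', y), e)) v) x.
  apply: near_eq_derive.
  have : \forall x' \near x, M x' by exact: open_nbhs_nbhs.
  apply: filterS => x' Mx'.
  have [dc _] := cost_derive 0 Mx' Ny.
  rewrite (@derive_partial2 _ _ _ _ (fun z => c z.1 z.2))//.
  have [_ ->] := cost_derive (0, v) Mx' Ny.
  by rewrite /= [X in _ - X]dotC dot0l subr0.
pose F p := dot (momentum r1 p) v.
have CF k : TC k A F by apply: TC_dot => //; exact: TC_cst.
have dF := (CF 1%N).1 _ (boxA Mx Ny).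
have E1 : 'D_h (fun x' => dot (momentum r1 ((x', y), e)) v) x =
    'D_(((h, 0), 0) : P) F ((x, y), e).
  have CI k : TC k setT (fun z : E * E => (z, e)).
    by apply: TC_pair; [exact: openT|exact: TC_id|exact: TC_cst].
  have dI : differentiable (fun z : E * E => (z, e)) (x, y) by exact: (CI 1%N).1.
  have dG : differentiable (fun z : E * E => F (z, e)) (x, y).
    exact: (differentiable_comp dI dF).
  by rewrite (@derive_partial1 _ _ _ _ (fun z => F (z, e)))// derive_partial1.
rewrite E1 derive_dotl// (derive_mom h Mx Ny (Cr1 1) (TC_mom1 1)).
rewrite dotDl dotNl dotZl; congr (- _ + _).
rewrite /dot (bigD1 i)//= mxE !eqxx mul1r big1 ?addr0// => j ji.
by rewrite mxE eqxx/= (negPf ji) mul0r.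
Qed.

(** Each coordinate of z = v - w is eps times the scalar product of z with a vector of norm at most
    [K]; the sup norm of z is thus at most eps n K |z|. *)
Lemma cost_A2 : A2 c M N.
Proof.
move=> x y Mx Ny v w vw; apply/eqP; rewrite -subr_eq0; apply/eqP.
apply: (le_half_eq0 enK).
apply: norm_le_coord.
  exact: (mulr_ge0 (mulr_ge0 (ltW e_gt0) (mulr_ge0 (ler0n _ _) K0)) (normr_ge0 _)).
move=> i; pose D := 'D_(((delta_mx 0 i, 0), 0) : P) r1 ((x, y), e).
have H : - v 0 i + e * dot D v = - w 0 i + e * dot D w.
  have Hv := cost_dxdy v i Mx Ny; have Hw := cost_dxdy w i Mx Ny.
  exact: (etrans (esym Hv) (etrans (congr1 (fun z : E => z 0 i) vw) Hw)).
have -> : (v - w) 0 i = e * dot D (v - w).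
  rewrite dotDr dotNr mulrDr mulrN !mxE; move: H.
  by move: (e * dot D v) (e * dot D w) (v 0 i) (w 0 i) => a b a' b'; lra.
have pd := lt_le_trans (box Mx Ny) dld.
have nk : `|(((delta_mx 0 i, 0), 0) : P)| <= 1.
  rewrite prod_normE/= ge_max prod_normE/= ge_max !normr0 ler01 !andbT.
  apply: norm_le_coord; first exact: ler01.
  move=> j; rewrite mxE; case: (_ && _); first by rewrite normr1.
  by rewrite normr0 ler01.
have DK : `|D| <= K.
  apply: (le_trans (Hr1 pd _)); rewrite -[X in _ <= X]mulr1.
  exact: (ler_wpM2l K0 nk).
have Dz : `|dot D (v - w)| <= n%:R * (K * `|v - w|).
  apply: (le_trans (dot_le_norm _ _)).
  exact: (ler_wpM2l (ler0n _ _) (ler_wpM2r (normr_ge0 _) DK)).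
rewrite normrM (gtr0_norm e_gt0) -!mulrA; exact: (ler_wpM2l (ltW e_gt0) Dz).
Qed.

(* Along [g], the second derivative of the cost sees the Hessian of the cost in
   the direction [u] and, through the momentum, the acceleration of [g]. *)
Lemma cost_second_derivative x y (g : R -> E) : M x -> N y -> smooth g ->
  g 0 = x ->
  derive1n 2 (fun t : R => c (g t) y) 0 =
  dot (derive1 g 0) (derive1 g 0) -
  e * dot ('D_(((derive1 g 0, 0), 0) : P) r0 ((x, y), e)) (derive1 g 0) -
  dot (momentum r0 ((x, y), e)) (derive1n 2 g 0).
Proof.
move=> Mx Ny gs g0.
have [gP g'c] := smooth_is_prim gs; have gc := is_prim_continuous gP.
pose m (t : R) : E := momentum r0 ((g t, y), e).
have gM : \forall t \near (0 : R), M (g t).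
  by apply: (gc 0); rewrite g0; exact: open_nbhs_nbhs.
have E1 : \forall t \near (0 : R),
    derive1 (fun t : R => c (g t) y) t = - dot (m t) (derive1 g t).
  apply: filterS gM => t Mt.
  have [dc _] := cost_derive 0 Mt Ny.
  have dg : differentiable g t by apply/derivable1_diffP; have [] := gP t.
  have dy : differentiable (fun _ : R => y) t by exact: differentiable_cst.
  have dp : differentiable (fun t => (g t, y)) t by exact: differentiable_pair.
  rewrite derive1E -[LHS]/('D_1 ((fun z => c z.1 z.2) \o (fun t => (g t, y))) t).
  rewrite derive_comp// derive_pair// derive_cst.
  have [_ ->] := cost_derive ('D_1 g t, 0) Mt Ny.
  by rewrite /= dotC dot0l sub0r derive1E.
rewrite /derive1n/= (derive1_near_eq E1).
set u := derive1 g 0.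
have Dm : is_derive (0 : R) (1 : R) m ('D_(((u, 0), 0) : P) (momentum r0) ((x, y), e)).
  have dm : differentiable (momentum r0) ((g 0, y), e).
    by rewrite g0; exact: (TC_mom0 1).1 _ (boxA Mx Ny).
  have dg : differentiable g 0 by apply/derivable1_diffP; have [] := gP 0.
  have dy : differentiable (fun _ : R => y) (0 : R) by exact: differentiable_cst.
  have de : differentiable (fun _ : R => e) (0 : R) by exact: differentiable_cst.
  have dp : differentiable (fun t => (g t, y)) (0 : R) by exact: differentiable_pair.
  have dpe : differentiable (fun t => ((g t, y), e)) (0 : R) by exact: differentiable_pair.
  apply: DeriveDef.
    by apply: diff_derivable; exact: (differentiable_comp dpe dm).
  rewrite -[LHS]/('D_1 ((momentum r0) \o (fun t => ((g t, y), e))) 0).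
  rewrite (derive_comp _ dpe dm) (derive_pair _ dp de) (derive_pair _ dg dy).
  by rewrite !derive_cst g0 /u derive1E.
have Dg : is_derive (0 : R) (1 : R) (derive1 g) (derive1 (derive1 g) 0).
  have [_ H] := gs 2; have [dH _] := H 1.
  have gE : derive1 g = (fun t => 'D_1 g t) by apply/funext => t; rewrite derive1E.
  apply: DeriveDef; last by rewrite [in RHS]derive1E.
  by apply: diff_derivable; rewrite gE; exact: dH.
have D := is_deriveN (is_derive_dot Dm Dg).
rewrite derive1E; have [_ ->] := D.
rewrite (derive_mom u Mx Ny (Cr0 1) (TC_mom0 1)).
rewrite dotDl dotNl dotZl /m g0 opprD -/u; congr (_ - _).
by rewrite opprD opprK.
Qed.

Lemma momentum_cexp x a : A' ((x, a), e) ->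
  momentum r0 ((x, W ((x, a), e)), e) = a.
Proof.
move=> /HW[_ WE]; rewrite /momentum /= [X in X - x]WE /=.
by rewrite addrAC subrK addrAC subrr add0r.
Qed.

(** [cexp] takes some point with the prescribed differential; [W] exhibits one, and A1 makes it the
    one taken. *)
Lemma cexpE x a : M x -> A' ((x, a), e) -> N (W ((x, a), e)) ->
  cexp c N x a = W ((x, a), e).
Proof.
move=> Mx Aq Nw.
have ex : exists y, [set y | N y /\ dx c x y = - a] y.
  by exists (W ((x, a), e)); split => //; rewrite cost_dx// momentum_cexp.
have := @getPex _ _ ex; rewrite -/(cexp c N x a) => -[Nc dc].
apply: (cost_A1 Mx); rewrite ?inE//.
by rewrite dc cost_dx// momentum_cexp.
Qed.

(** [Hdl] keeps the momenta of M x N in the region where [W] is controlled; there y and [W] solve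
    the same equation, which contracts because eps K <= 1/2. *)
Lemma cexp_momentum x y : M x -> N y ->
  let a := momentum r0 ((x, y), e) in
  `|((x, a), e) - q0 : P| < d6 /\ W ((x, a), e) = y.
Proof.
move=> Mx Ny a; have qd : `|((x, a), e) - q0 : P| < d6.
  rewrite norm_triple_lt; apply/and3P; split.
  - exact: lt_le_trans Mx dld6.
  - exact: Hdl (box Mx Ny).
  - exact: lt_le_trans edl dld6.
split => //.
have Aq : A' ((x, a), e) by exact: (lt_le_trans qd d6d').
have [Wd WE] := HW Aq; set w := W ((x, a), e) in Wd WE *.
apply/eqP; rewrite -subr_eq0; apply/eqP; apply: (le_half_eq0 eK).
have pw : `|((x, w), e) - p0 : P| < d.
  rewrite norm_triple_lt; apply/and3P; split.
  - exact: lt_le_trans Mx dld.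
  - exact: Wd.
  - exact: lt_le_trans edl dld.
have py := lt_le_trans (box Mx Ny) dld.
have zE : w - y = e *: (r0 ((x, y), e) - r0 ((x, w), e)).
  rewrite {1}WE /a /momentum /= addrA (addrC x) subrK scalerBr.
  by rewrite [y + _]addrC addrAC addrK.
have nz : `|w - y| = e * `|r0 ((x, y), e) - r0 ((x, w), e)|.
  by rewrite zE normrZ (gtr0_norm e_gt0).
rewrite [X in X <= _]nz -mulrA; apply: (ler_wpM2l (ltW e_gt0)).
apply: (le_trans (Hr0 py pw)); apply: (ler_wpM2l K0).
rewrite prod_normE/= ge_max prod_normE/= ge_max !subrr !normr0 !normr_ge0.
by rewrite distrC lexx.
Qed.

Lemma dot_eq0 (u : E) : dot u u = 0 -> u = 0.
Proof.
move=> u0; apply/eqP; rewrite -normr_le0 -[X in X <= _]ger0_norm//.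
have := sqr_norm_le_dot u; rewrite u0 => H.
by rewrite ger0_norm// -(ler_sqr (normr_ge0 _) (lexx 0)) expr0n.
Qed.

Let WA q : A' q -> A ((q.1.1, W q), q.2).
Proof.
case: q => [[x a] e'] Aq; have [Wd _] := HW Aq.
move: Aq; rewrite /A /A' /= !norm_triple_lt => /and3P[H1 _ H3].
apply/and3P; split.
- exact: lt_le_trans H1 (le_trans d'd dd0).
- exact: lt_le_trans Wd dd0.
- exact: lt_le_trans H3 (le_trans d'd dd0).
Qed.

(** Nonzero vectors are normalised by their Euclidean lengths; if one is zero, homogeneity with the
    factor 0 makes the curvature vanish. *)
Lemma curv_sign q u w : `|q - q0| < d6 -> dot u w = 0 ->
  0 <= curv r0 W q u w /\ (curv r0 W q u w = 0 -> u = 0 \/ w = 0).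
Proof.
move=> qd uw; have Aq : A' q by exact: (lt_le_trans qd d6d').
pose a := enorm u; pose b := enorm w.
have a2 : a ^+ 2 = dot u u by exact: sqr_enorm.
have b2 : b ^+ 2 = dot w w by exact: sqr_enorm.
have CZ := @curvZ R n r0 W x0 y0 d0 d' Cr0 CW WA q _ _ _ _ Aq.
have [a0|a0] := eqVneq a 0.
  have u0 : u = 0 by apply: dot_eq0; rewrite -a2 a0 expr0n.
  split; last by left.
  have := CZ u w 0 1; rewrite scale0r scale1r u0 => ->.
  by rewrite expr0n !mul0r.
have [b0|b0] := eqVneq b 0.
  have w0 : w = 0 by apply: dot_eq0; rewrite -b2 b0 expr0n.
  split; last by right.
  have := CZ u w 1 0; rewrite scale0r scale1r w0 => ->.
  by rewrite expr0n mulr0 mul0r.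
have : 0 < curv r0 W q u w.
  have := CZ (a^-1 *: u) (b^-1 *: w) a b.
  rewrite !scalerA !divff// !scale1r => ->.
  have ap : 0 < a by rewrite lt_neqAle eq_sym a0 sqrtr_ge0.
  have bp : 0 < b by rewrite lt_neqAle eq_sym b0 sqrtr_ge0.
  apply: mulr_gt0; first by apply: mulr_gt0; exact: exprn_gt0.
  apply: Hcurv => //.
  - by rewrite dotZl dotZr -a2 mulrA -expr2 -exprMn mulVf// expr1n.
  - by rewrite dotZl dotZr -b2 mulrA -expr2 -exprMn mulVf// expr1n.
  - by rewrite dotZl dotZr uw !mulr0.
move=> H; split; first exact: ltW.
by move=> H0; move: H; rewrite H0 ltxx.
Qed.

Lemma cost_MTW : MTW_strong c M N.
Proof.
move=> x u a w g Mx [y Ny aE] wu gs g0 g1.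
have aE' : a = momentum r0 ((x, y), e) by rewrite -aE cost_dx// opprK.
have [qd Wy] := cexp_momentum Mx Ny; rewrite -aE' in qd Wy.
pose q : P := ((x, a), e).
have Aq : A' q by exact: (lt_le_trans qd d6d').
pose g2 := derive1n 2 g 0.
have near1 := @curv_near R n x0 y0 d' q w Aq.
have near2 : \forall s \near (0 : R), N (W ((x, a + s *: w), e)).
  have A'o : open A' by exact: open_norm_ball.
  have Wc : {for q, continuous W} by exact: (TC_cont (CW 0)).
  have NW : \forall q' \near q, N (W q').
    by apply: Wc; rewrite Wy; exact: open_nbhs_nbhs.
  have lc : {for (0 : R), continuous (fun s : R => ((x, a + s *: w), e) : P)}.
    have CI k : TC k setT (fun s : R => ((x, a + s *: w), e) : P).
      have oT := @openT R.
      apply: TC_pair => //; last exact: TC_cst.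
      by apply: TC_pair => //; [exact: TC_cst|exact: TC_affine].
    exact: (CI 0%N 0 I).
  rewrite /prop_for /continuous_at scale0r addr0 in lc.
  exact: (lc _ NW).
(* The momentum at the c-exponential of a + s w is a + s w itself, so the acceleration [g2] enters
   affinely in s. *)
have E1 : \forall s \near (0 : R),
    derive1n 2 (fun t : R => c (g t) (cexp c N x (a + s *: w))) 0 =
    (dot u u - dot a g2) + (- e) * curv0 r0 W (((x, a + s *: w), e), u) +
    s * (- dot w g2).
  apply: filterS2 near1 near2 => s As Ns.
  rewrite cexpE// (cost_second_derivative Mx Ns gs g0) g1 momentum_cexp//.
  rewrite -/g2 /curv0 /= dotDl dotZl.
  set X := dot _ u; set Z := dot ('D__ r0 _) u.
  by move: X Z (dot a g2) (dot w g2) => X Z Ya Yb; ring.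
have [D1 D2] := @curv_derivable R n r0 W x0 y0 d0 d' Cr0 CW WA q u w Aq.
have -> : cross_curvature c N g x a w = 3 / 2 * e * curv r0 W q u w.
  rewrite /cross_curvature (derive1n2_near_eq E1).
  rewrite (derive1n2_affine _ _ _ D1 D2).
  rewrite (@curv_line R n r0 W x0 y0 d0 d' Cr0 CW WA q u w Aq).
  by ring.
have [S1 S2] := curv_sign qd (etrans (dotC u w) wu).
have p32 : 0 < 3 / 2 * e by rewrite mulr_gt0// divr_gt0.
split; first by apply: mulr_ge0 => //; exact: ltW.
move=> /eqP; rewrite mulf_eq0 (gt_eqF p32)/= => /eqP; exact: S2.
Qed.

Lemma cost_A3s : A3s c M N.
Proof. by split; [exact: cost_A0|exact: cost_A1|exact: cost_A2|exact: cost_MTW]. Qed.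

End conclusion.

(** * The curvature at first order in eps *)

Section hypothesis_at_zero.
Context {R : realType} {n : nat}.
Local Notation E := 'rV[R]_n.
Local Notation Y := (C01 E).
Local Notation P := (E * E * R)%type.
Local Notation mu := lebesgue_measure.
Variable V : E -> R.
Hypothesis V_smooth : smooth V.

Lemma TC_Hess k : TC k setT (Hess V).
Proof.
have oT := @openT E.
have -> : Hess V = (fun p => \sum_(i <- index_enum 'I_n)
    \sum_(j <- index_enum 'I_n)
    'D_(delta_mx 0 i) (fun q => 'D_(delta_mx 0 j) V q) p *: (delta_mx i j : 'M[R]_n)).
  apply/funext => p; rewrite [LHS]matrix_sum_delta.
  by apply: eq_bigr => i _; apply: eq_bigr => j _; rewrite mxE.
apply: TC_sum => // i; apply: TC_sum => // j.
apply: TC_scale => //; last exact: TC_cst.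
apply: TC_of_Ck => //.
by have [_ H] := V_smooth k.+2; have [_ H'] := H (delta_mx 0 j); exact: H'.
Qed.

(* No symmetry of the Hessian is needed, both slots being contracted with [u]. *)
Lemma dot_derive_grad (u p : E) :
  dot ('D_u (grad V) p) u = dot u (u *m (Hess V p)^T).
Proof.
have dg := (TC_grad V_smooth 1).1 p I.
have dH i : differentiable (fun q => 'D_(delta_mx 0 i) V q) p.
  have [_ H] := V_smooth 2; have [H' _] := H (delta_mx 0 i).
  exact: H'.
have gi i : 'D_u (grad V) p 0 i = 'D_u (fun q => 'D_(delta_mx 0 i) V q) p.
  rewrite derive_mx; last exact: diff_derivable.
  by rewrite mxE; congr ('D_u _ p); apply/funext => q; rewrite mxE.
rewrite /dot; under eq_bigr do rewrite gi (derive_coord _ (dH _)) mulr_suml.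
rewrite exchange_big; apply: eq_bigr => i _ /=.
rewrite mxE mulr_sumr; apply: eq_bigr => j _.
by rewrite !mxE /GRing.scale/= -mulrA [X in _ * X]mulrC.
Qed.

(** Identifies the iterated integral of the hypothesis with the operator that defines [rem0]. *)
Lemma c01_dot_integral (th : Y) (u : E) :
  \int[mu]_(tau in `[0, 1]) (\int[mu]_(t in `[0, tau]) dot (th t) u) =
  dot (J (J th) 1) u.
Proof.
have thc := @c01_continuous _ _ th.
have dotc (f : R -> E) : continuous f -> continuous (fun t => dot (f t) u).
  move=> fc t; apply: (@TC_dot _ 0 _ _ setT f (fun _ => u) openT _ _ t I).
    by move=> s _; exact: fc.
  exact: TC_cst.
have dotP (f H : R -> E) : is_prim f H ->
    is_prim (fun t => dot (f t) u) (fun t => dot (H t) u).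
  move=> fH t; have D := is_derive_dot (fH t) (is_derive_cst u t (1 : R)).
  by apply: is_derive_eq D _; rewrite [X in _ + X]dotC dot0l addr0.
have [p0 pP] := primP thc; have pc := is_prim_continuous pP.
have [pp0 ppP] := primP pc.
have inner tau : 0 <= tau ->
    \int[mu]_(t in `[0, tau]) dot (th t) u = dot (prim th tau) u.
  move=> tau0; rewrite (Rintegral_is_prim (dotc _ thc) (dotP _ _ pP))//.
  by rewrite p0 dot0l subr0.
have -> : \int[mu]_(tau in `[0, 1]) (\int[mu]_(t in `[0, tau]) dot (th t) u) =
    \int[mu]_(tau in `[0, 1]) dot (prim th tau) u.
  apply: eq_Rintegral => tau; rewrite inE/= in_itv/= => /andP[tau0 _].
  exact: inner.
rewrite (Rintegral_is_prim (dotc _ pc) (dotP _ _ ppP))// pp0 dot0l subr0.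
congr (dot _ u); apply/esym.
have one01 : 0 <= (1 : R) <= 1 by rewrite lexx ler01.
apply: (J_prim pc _ one01) => t t01; exact: JE.
Qed.

Let TF := TC_grad V_smooth 2.
(** The linearised force along a segment. In the direction (u, 0) the segment varies by (1 - t) u,
    which is the origin of the factor 1 - t in the hypothesis. *)
Let hessian_along (z z' : E * E) : Y :=
  nem (TC_tangent_continuous TF) (c01_pair (line z) (line z')).

Lemma derive_rem0_line (z h : E * E) :
  'D_h (fun z => rem0 V_smooth (line z)) z = J (J (hessian_along z h)) 1.
Proof.
have ll : linear (@line R n).
  move=> a u v; rewrite /line /= cst01_linear.
  have -> : (a *: u.2 + v.2) - (a *: u.1 + v.1) =
      a *: (u.2 - u.1) + (v.2 - v.1) by rewrite scalerBr opprD addrACA.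
  by rewrite ramp01_linear scalerDr addrACA.
have lc : continuous (@line R n).
  have Cl k : TC k setT (fun z : E * E => line z).
    by apply: TC_line; [exact: openT|exact: TC_id].
  exact: TC_continuous Cl.
have [dl Dl] := @differentiable_linear R _ _ (@line R n) z ll lc.
have Ll : linear (fun f : Y => J (J f) 1).
  by move=> a f g; rewrite !J_linear.
have Lc : continuous (fun f : Y => J (J f) 1).
  have CL k : TC k setT (fun f : Y => J (J f) 1).
    have oT := @openT Y.
    by apply: TC_ev => //; do 2!apply: TC_J => //; exact: TC_id.
  exact: TC_continuous CL.
have [dF DF] := nem_differentiable (grad_continuous V_smooth) TF (line z).
have [dL DL] := @differentiable_linear R _ _ _ (force V_smooth (line z)) Ll Lc.
have dFl : differentiable (fun z => force V_smooth (line z)) z.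
  exact: (differentiable_comp dl dF).
rewrite -[LHS]/('D_h ((fun f : Y => J (J f) 1) \o
  (fun z => force V_smooth (line z))) z) (derive_comp _ dFl dL) DL.
congr (J (J _) 1); rewrite -[LHS]/('D_h (force V_smooth \o (@line R n)) z).
by rewrite (derive_comp _ dl dF) Dl DF.
Qed.

Lemma hessian_alongE (x0 v0 u w : E) (s t : R) : 0 <= t <= 1 ->
  dot (hessian_along (x0, (x0 + v0) + s *: w) (u, 0) t) u =
  dot u ((1 - t) *: (u *m (Hess V (x0 + t *: (v0 + s *: w)))^T)).
Proof.
move=> t01; rewrite nemE c01_pairE !lineE//= sub0r.
have -> : x0 + t *: (x0 + v0 + s *: w - x0) = x0 + t *: (v0 + s *: w).
  by rewrite -[x0 + v0 + _]addrA [x0 + (_ + _) - x0]addrAC subrr add0r.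
have -> : u + t *: - u = (1 - t) *: u by rewrite scalerN scalerBl scale1r.
have dg := (TC_grad V_smooth 1).1 (x0 + t *: (v0 + s *: w)) I.
rewrite (deriveE _ dg) linearZ/= -(deriveE _ dg) dotZl dotZr.
by rewrite dot_derive_grad.
Qed.

Lemma hessian_along_smooth (x0 y0 u w : E) (k : nat) :
  TC k setT (fun s : R => hessian_along (x0, y0 + s *: w) (u, 0)).
Proof.
have oT := @openT R.
apply: (@TC_comp _ k _ _ _ setT setT
  (fun s : R => (line (x0, y0 + s *: w), line (u, 0)))
  (fun z => nem (TC_tangent_continuous TF) (c01_pair z.1 z.2))) => //.
  apply: TC_pair => //; last exact: TC_cst.
  by apply: TC_line => //; apply: TC_pair => //; [exact: TC_cst|exact: TC_affine].
apply: (@TC_comp _ k _ _ _ setT setT (fun z : Y * Y => c01_pair z.1 z.2)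
  (nem (TC_tangent_continuous TF))) => //.
- exact: openT.
- by apply: TC_linear; [exact: c01_pair_linear|exact: c01_pair_continuous].
- apply: nem_TC; have [_ H] := TC_grad V_smooth k.+3.
  by apply: (@TC_sub _ k.+2 _ _ setT (setT `*` setT) _ _ H) => z.
Qed.

(** Differentiation under the integral without domination: the integrand is a curve s |-> [Th s] in
    C([0, 1]), smooth for the sup norm, and both the double integral and the evaluation at t are
    continuous linear maps, which commute with its s-derivatives. *)
Lemma hessian_along_second_derivative (x0 v0 u w : E) :
  derive1n 2 (fun s : R =>
    dot (J (J (hessian_along (x0, (x0 + v0) + s *: w) (u, 0))) 1) u) 0 =
  \int[mu]_(tau in `[0%R, 1%R])
    \int[mu]_(t in `[0%R, tau])
      dot u ((1 - t) *:
        (u *m (derive1n 2 (fun s : R => Hess V (x0 + t *: (v0 + s *: w))) 0)^T)).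
Proof.
pose Th s := hessian_along (x0, (x0 + v0) + s *: w) (u, 0).
have CTh k : TC k setT Th by exact: hessian_along_smooth.
have lin_dot : linear (fun v : E => dot v u).
  by move=> a v v'; rewrite dotDl dotZl.
have cont_dot : continuous (fun v : E => dot v u).
  by under eq_fun do rewrite dotC; exact: dot_continuous.
pose th := derive1n 2 Th 0.
have -> : derive1n 2 (fun s : R => dot (J (J (Th s)) 1) u) 0 =
    dot (J (J th) 1) u.
  apply: (@derive1n2_linear _ _ _ (fun f : Y => dot (J (J f) 1) u)).
  - by move=> a f g; rewrite !J_linear dotDl dotZl.
  - have CL k : TC k setT (fun f : Y => J (J f) 1).
      have oT := @openT Y.
      by apply: TC_ev => //; do 2!apply: TC_J => //; exact: TC_id.
    move=> f; apply: (@continuous_comp _ _ _ (fun f : Y => J (J f) 1)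
      (fun v : E => dot v u)).
      exact: TC_continuous CL f.
    exact: cont_dot.
  - exact: CTh.
rewrite -c01_dot_integral; apply: eq_Rintegral => tau.
rewrite inE/= in_itv/= => /andP[tau0 tau1].
apply: eq_Rintegral => t; rewrite inE/= in_itv/= => /andP[t0 ttau].
have t01 : 0 <= t <= 1 by rewrite t0 (le_trans ttau).
have -> : dot (th t) u = derive1n 2 (fun s => dot (Th s t) u) 0.
  apply/esym; apply: (@derive1n2_linear _ _ _ (fun f : Y => dot (f t) u)).
  - by move=> a f g; rewrite c01D c01Z dotDl dotZl.
  - move=> f; apply: (@continuous_comp _ _ _ (fun f : Y => f t)
      (fun v : E => dot v u)).
      exact: c01_ev_continuous.
    exact: cont_dot.
  - exact: CTh.
have -> : (fun s => dot (Th s t) u) = (fun s : R =>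
    dot u ((1 - t) *: (u *m (Hess V (x0 + t *: (v0 + s *: w)))^T))).
  by apply/funext => s; exact: hessian_alongE.
pose L (B : 'M[R]_n) : R := dot u ((1 - t) *: (u *m B^T)).
apply: (@derive1n2_linear _ _ _ L).
- move=> a B B'; rewrite /L linearD/= linearZ/= mulmxDr -scalemxAr scalerDr.
  by rewrite !dotDr !dotZr mulrCA.
- have CL k : TC k setT L.
    have oT := @openT 'M[R]_n.
    have -> : L = fun B => \sum_(i < n) (u 0 i * ((1 - t) * \sum_(j < n) (u 0 j * B i j))).
      apply/funext => B; apply: eq_bigr => i _; rewrite !mxE.
      by congr (_ * (_ * _)); apply: eq_bigr => j _; rewrite !mxE.
    apply: TC_sum => // i; apply: TC_mul => //; first exact: TC_cst.
    apply: TC_mul => //; first exact: TC_cst.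
    apply: TC_sum => // j; apply: TC_mul => //; first exact: TC_cst.
    apply: TC_linear; first by move=> a B B'; rewrite !mxE.
    exact: coord_continuous.
  exact: TC_continuous CL.
- have oT := @openT R.
  have CH k : TC k setT (fun s : R => Hess V (x0 + t *: (v0 + s *: w))).
    apply: (@TC_comp _ k _ _ _ setT setT (fun s : R => x0 + t *: (v0 + s *: w))) => //.
      apply: TC_add => //; first exact: TC_cst.
      by apply: TC_scale => //; [exact: TC_cst|exact: TC_affine].
    exact: TC_Hess.
  exact: CH.
Qed.

End hypothesis_at_zero.

(** The costs enter only through their gradient expansion, so this part is independent of the
    variational problem. *)
Lemma A3s_of_expansion (R : realType) (n : nat)
    (c : R -> 'rV[R]_n -> 'rV[R]_n -> R)
    (r0 r1 : 'rV[R]_n * 'rV[R]_n * R -> 'rV[R]_n) (x0 y0 : 'rV[R]_n) (d0 : R) :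
  let A := [set p : 'rV[R]_n * 'rV[R]_n * R | `|p - ((x0, y0), 0)| < d0] in
  0 < d0 -> (forall k, TC k A r0) -> (forall k, TC k A r1) ->
  (forall p, A p -> 0 < p.2 ->
    differentiable (fun z => c p.2 z.1 z.2) p.1 /\
    forall h, 'D_h (fun z => c p.2 z.1 z.2) p.1 =
      dot (momentum r1 p) h.2 - dot (momentum r0 p) h.1) ->
  (forall u w : 'rV[R]_n, dot u u = 1 -> dot w w = 1 -> dot u w = 0 ->
    0 < derive1n 2 (fun s : R =>
      dot ('D_((u, 0), 0) r0 ((x0, y0 + s *: w), 0)) u) 0) ->
  exists M N : set 'rV[R]_n,
    [/\ open (M `*` N), M `*` N !=set0 &
        exists e0 : R, 0 < e0 /\
          forall e : R, 0 < e -> e < e0 -> A3s (c e) M N].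
Proof.
move=> A d0_gt0 Cr0 Cr1 Hc Hpos.
have [d [K [d' [W [[d_gt0 dd0 K0 dK] Hr0 Hr1 [d'_gt0 d'd CW] HW]]]]] :=
  ex_cexp d0_gt0 Cr0 Cr1.
have WA q : `|q - ((x0, y0 - x0), 0)| < d' -> A ((q.1.1, W q), q.2).
  case: q => [[x a] e'] Aq; have [Wd _] := HW _ Aq.
  move: Aq; rewrite /A /= !norm_triple_lt => /and3P[H1 _ H3].
  apply/and3P; split.
  - exact: lt_le_trans H1 (le_trans d'd dd0).
  - exact: lt_le_trans Wd dd0.
  - exact: lt_le_trans H3 (le_trans d'd dd0).
have WE q (qd : `|q - ((x0, y0 - x0), 0)| < d') := (HW q qd).2.
have [d6 d6_gt0 [d6d' Hcurv]] := curv_pos d'_gt0 Cr0 CW WA WE Hpos.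
have Ap0 : A ((x0, y0), 0) by rewrite /A/= subrr normr0.
have mc : {for ((x0, y0), 0), continuous (momentum r0)}.
  exact: (TC_cont (TC_momentum Cr0 0) Ap0).
have m0 : momentum r0 ((x0, y0), 0) = y0 - x0.
  by rewrite /momentum /= scale0r addr0.
have := mc; rewrite /prop_for /continuous_at m0 => /cvgrPdist_lt /(_ _ d6_gt0).
move=> /nbhs_normP[d7 /= d7_gt0 Hd7].
(* [d7] keeps the momenta of M x N within [d6] of y0 - x0, where the curvature is positive. The same
   [dl] bounds eps. *)
pose dl := Num.min d6 d7.
have dl_gt0 : 0 < dl by rewrite lt_min d6_gt0.
have dld6 : dl <= d6 by rewrite ge_min lexx.
have dld7 : dl <= d7 by rewrite ge_min lexx orbT.
have Hdl p : `|p - ((x0, y0), 0)| < dl -> `|momentum r0 p - (y0 - x0)| < d6.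
  move=> pd; rewrite distrC; apply: Hd7.
  change (`|((x0, y0), 0) - p| < d7); rewrite distrC.
  exact: (lt_le_trans pd dld7).
exists [set x | `|x - x0| < dl], [set y | `|y - y0| < dl]; split.
- by apply: open_prod; exact: open_norm_ball.
- by exists (x0, y0); split; rewrite /= subrr normr0.
exists dl; split; first exact: dl_gt0.
move=> e e_gt0 e_dl.
apply: (@cost_A3s R n (c e) r0 r1 W x0 y0 d0 d K d' d6 dl e Cr0 Cr1 dd0
  K0 dK Hr0 Hr1 CW HW d6d' d'd Hcurv dld6 Hdl e_gt0 e_dl) => p Ap pe.
by have := Hc p Ap; rewrite pe => /(_ e_gt0).
Qed.

Unset Implicit Arguments.

Theorem theorem1p2 (R : realType) (n : nat) (V : 'rV[R]_n -> R)
  (V_smooth : smooth V)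
  (V_bounded_above : exists B : R, forall x, V x <= B)
  (C : R) (C_gt0 : 0 < C)
  (U : set ('rV[R]_n * 'rV[R]_n))
  (U_nonempty : U !=set0) (U_bounded : bounded_set U) (U_open : open U)
  (HU : forall x v u w : 'rV[R]_n, U (x, v) ->
     enorm u = 1 -> enorm w = 1 -> dot u w = 0 ->
     C <= \int[lebesgue_measure]_(tau in `[0%R, 1%R])
            \int[lebesgue_measure]_(t in `[0%R, tau])
              (* [u *m A^T] is the vector A u in row notation *)
              dot u ((1 - t) *:
                (u *m (derive1n 2 (fun s : R => Hess V (x + t *: (v + s *: w))) 0)^T))) :
  exists M N : set 'rV[R]_n,
    [/\ open (M `*` N), M `*` N !=set0 &
        exists e0 : R, 0 < e0 /\
          forall e : R, 0 < e -> e < e0 -> A3s (cost V e) M N].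
Proof.
have [B VB] := V_bounded_above; have [[x0 v0] Uxv] := U_nonempty.
have [d0 [r0 [r1 [d0_gt0 Cr0 Cr1 Hc H0]]]] :=
  local_cost_gradient V_smooth (x0, x0 + v0) VB.
apply: (A3s_of_expansion d0_gt0 Cr0 Cr1 Hc) => u w u1 w1 uw.
apply: (lt_le_trans C_gt0).
have unit_enorm (v : 'rV[R]_n) : dot v v = 1 -> enorm v = 1.
  by rewrite /enorm => ->; rewrite sqrtr1.
apply: (le_trans (HU x0 v0 u w Uxv (unit_enorm u u1) (unit_enorm w w1) uw)).
(* The integral of the hypothesis equals the second derivative to be bounded; the two functions of s
   agree near 0, as long as the points remain in [A]. *)
rewrite -(hessian_along_second_derivative V_smooth) le_eqVlt.
apply/orP; left; apply/eqP/esym; apply: derive1n2_near_eq.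
pose A := [set p : 'rV[R]_n * 'rV[R]_n * R | `|p - ((x0, x0 + v0), 0)| < d0].
have Ao : open A by exact: open_norm_ball.
have Ap0 : A ((x0, x0 + v0), 0) by rewrite /A/= subrr normr0.
have := line_near (((0, w), 0) : 'rV[R]_n * 'rV[R]_n * R) Ao Ap0.
apply: filterS => s.
have -> : ((x0, x0 + v0), 0) + s *: (((0, w), 0) : 'rV[R]_n * 'rV[R]_n * R) =
    ((x0, x0 + v0 + s *: w), 0).
  by congr pair; [congr pair|]; rewrite /= ?scaler0 ?addr0.
set y := x0 + v0 + s *: w => Ay.
congr (dot _ u); rewrite -(derive_rem0_line V_smooth).
have dr := (Cr0 1).1 _ Ay.
rewrite -(derive_partial1 _ dr); apply: near_eq_derive.
(* A derivative at (x0, y) sees a neighbourhood, so the formula for [r0] at eps = 0 is needed on an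
   open set of end points. *)
pose O := [set z : 'rV[R]_n * 'rV[R]_n | A (z, 0)].
have Oo : open O.
  apply: (@open_comp _ _ (fun z : 'rV[R]_n * 'rV[R]_n => (z, 0 : R)) A) => // z _.
  have CI k : TC k setT (fun z : 'rV[R]_n * 'rV[R]_n => (z, 0 : R)).
    by apply: TC_pair; [exact: openT|exact: TC_id|exact: TC_cst].
  exact: (CI 0%N z I).
have : \forall z \near ((x0, y) : 'rV[R]_n * 'rV[R]_n), O z.
  by apply: open_nbhs_nbhs; split.
by apply: filterS => z Oz; exact: H0.
Qed.
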